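(* Fix a real number $0<\delta<1/2$ and a real number $\lambda>0$. For large $x$, call an integer $n<x^2$ ''$\delta$-normal'' if $|\omega(n)-\log\log x|\le \sqrt{\pi/2}\,(\log\log x)^{\delta}$, where $\omega(n)$ is the number of distinct prime factors of $n$. Let $N_1<N_2<N_3<\cdots$ be the $\delta$-normal integers listed in increasing order, and set $\widetilde N_i=N_i(\log\log x)^{-1/2+\delta}$. Then $$\frac{1}{x}\,\#\{ i\le x:\ \widetilde N_{i+1}-\widetilde N_i>\lambda\}\longrightarrow e^{-\lambda}\qquad (x\to\infty).$$
   Context: $\log_2 x$ denotes $\log\log x$. The notion of $\delta$-normal, and hence the sequence $N_i$, depends on $x$. *)

(* Defs.v *)
From HB Require Import structures.
From mathcomp Require Import all_boot all_order all_algebra.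
From mathcomp Require Import all_classical all_reals all_analysis.
Set Implicit Arguments.
Unset Strict Implicit.
Unset Printing Implicit Defensive.
Import Order.TTheory GRing.Theory Num.Theory.
Import numFieldNormedType.Exports.
Local Open Scope classical_set_scope.
Local Open Scope ring_scope.

Definition omega (n : nat) : nat := size (primes n).

Definition loglog (R : realType) (x : R) : R := ln (ln x).

(* Only positive integers are considered: [omega 0] is a junk value. *)
Definition delta_normal (R : realType) (delta x : R) (n : nat) : bool :=
  [&& (0 < n)%N, n%:R < x ^+ 2 &
      `|(omega n)%:R - loglog x| <= Num.sqrt (pi / 2) * loglog x `^ delta].

(* The [delta]-normal integers in increasing order; the bound n < x ^+ 2 makes
   this a finite list. *)
Definition normals (R : realType) (delta x : R) : seq nat :=
  [seq n <- iota 1 (Num.truncn (x ^+ 2)) | delta_normal delta x n].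

Lemma mem_normals (R : realType) (delta x : R) (n : nat) :
  (n \in normals delta x) = delta_normal delta x n.
Proof.
rewrite mem_filter mem_iota; case: (boolP (delta_normal _ _ _)) => //=.
case/and3P=> n_gt0 ltnx _.
by rewrite n_gt0 add1n ltnS truncn_ge_nat ?sqr_ge0 // ltW.
Qed.

Lemma normals_sorted (R : realType) (delta x : R) :
  sorted ltn (normals delta x).
Proof. by apply: sorted_filter (iota_ltn_sorted _ _); apply: ltn_trans. Qed.

(* Indexing starts at 1; the value is junk unless
   1 <= i <= size (normals delta x). *)
Definition normal_nth (R : realType) (delta x : R) (i : nat) : nat :=
  nth 0%N (normals delta x) i.-1.

Definition normal_scaled (R : realType) (delta x : R) (i : nat) : R :=
  (normal_nth delta x i)%:R * loglog x `^ (- (1 / 2) + delta).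

(* The number of indices 1 <= i <= x such that the i-th and (i+1)-st
   [delta]-normal integers exist and their scaled gap exceeds [lambda]. *)
Definition num_large_gaps (R : realType) (delta lambda x : R) : nat :=
  count (fun i => (i < size (normals delta x))%N &&
           (normal_scaled delta x i.+1 - normal_scaled delta x i > lambda))
        (iota 1 (Num.truncn x)).

(* Main.v *)
(** Write [L = log log x]. The density of delta-normal integers is asymptotic to
    [q = L^(delta-1/2)], and the claim is that the normality of the [k ~ lambda/q]
    consecutive integers after [n] behaves like independent trials of success
    probability [q], so that a gap longer than [lambda/q] has probability
    [(1-q)^(lambda/q) -> exp(-lambda)].

    Independence: let [P] be the primes in the range from [exp(L^3)] to
    [exp(e^L/L^3)]. Each [p] in [P] divides at most one of [n+1, ..., n+k], and by
    the Chinese remainder theorem the joint moments of the events [p | n+h] agree,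
    up to order [40 L^2], with those of independent Bernoulli(1/p) variables, up to
    tiny errors. Truncated Moebius inversion on the lattice of sets of events turns
    this into closeness of all statistics of the vector of the numbers of prime
    factors in [P]. By Mertens-type bounds the discarded primes have reciprocal sum
    [O(log L)], so off a negligible set they contribute [O(log L) = o(L^delta)] to
    each [omega(n+h)]. In the Bernoulli model the number of primes takes each value
    within [O(L^delta)] of [L] with probability asymptotic to [1/sqrt(2 pi L)]
    (elementary symmetric functions and Stirling), and summing over the window gives
    [q]. Finally the [i]-th normal integer is about [i/q], so counting indices
    [i <= x] is sandwiched between counting [n <= (1 -+ eps) x/q]. *)

Require Import Defs.
From mathcomp Require Import all_boot all_order all_algebra.
From mathcomp Require Import zify ring lra.
Set Implicit Arguments.
Unset Strict Implicit.
Unset Printing Implicit Defensive.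
Import Order.TTheory GRing.Theory Num.Theory.
Local Open Scope ring_scope.

(** * Comparison of set-valued random variables through joint moments *)

(** The event counted has probability of order [q >= 1/L], so errors must be [o(1/L)]; all of them
    are brought below a multiple of [L^-3]. The [k <= L] shifts have together at most [2 L^2]
    expected prime divisors in [P], and summing over sets of events costs factors [exp(O(L^2))].
    This fixes the constants. Order [40 L^2] suffices for the truncation because weighting a set [D]
    by [16^|D|] leaves [(3/16)^(40 L^2) exp(32 L^2)]. In the model, unlike in the integers, one
    prime may divide two shifts; the lower end [exp(L^3)] of the range makes this negligible. The
    upper end keeps the number of sets of events, roughly [exp(82 e^L/L)], far below the length
    [N >= exp(e^L/2)] of the interval of integers, as each set costs a rounding error [1/N]. The
    discarded primes move the edges of the window by [O(log L)], which is harmless as [delta > 0];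
    [delta < 1/2] makes the local probabilities flat across the window. Flatness also absorbs an
    error [O(log L)] in the sum of [1/p], so a weak form of Mertens' theorem is enough. *)

Section MomentComparison.
Variables (R : realFieldType) (E : finType).
Implicit Types (A B D : {set E}) (Phi : {set E} -> R).

Definition moebius Phi D : R :=
  \sum_(B : {set E} | B \subset D) (-1) ^+ #|D :\: B| * Phi B.

(** The sum factors over the points of [E]: points of [B] are forced in, points outside [A] are
    forced out, and each point of [A :\: B] contributes the factor [-1 + 1]. *)
Lemma sum_sign_interval A B : B \subset A ->
  \sum_(D : {set E} | (B \subset D) && (D \subset A)) (-1) ^+ #|D :\: B|
  = (A == B)%:R :> R.
Proof.
move=> BA.
pose F (i : E) : R := if i \in B then 1 else if i \in A then -1 else 0.
pose G (i : E) : R := if i \in B then 0 else 1.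
transitivity (\prod_i (F i + G i)).
  rewrite bigA_distr; under [RHS]eq_bigl => D do rewrite inE.
  rewrite [RHS](bigID (fun D : {set E} => (B \subset D) && (D \subset A))) /=.
  rewrite [X in _ + X]big1 ?addr0; last first.
    move=> D; rewrite negb_and => /orP[] /subsetPn[i iin inot].
      by rewrite (bigD1 i) //= (negbTE inot) /G iin mul0r.
    rewrite (bigD1 i) //= iin /F (negbTE inot).
    by rewrite (contraNF (subsetP BA i) inot) mul0r.
  apply: eq_bigr => D. move=> /andP[BD DA].
  rewrite (bigID (mem (D :\: B))) /= [X in _ * X]big1 ?mulr1; last first.
    move=> i; rewrite !inE negb_and negbK => iDB; rewrite /F /G.
    case: ifP => [iD|iD]; first by rewrite iD orbF in iDB; rewrite iDB.
    by rewrite (contraFF (subsetP BD i) iD).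
  rewrite (eq_bigr (fun=> -1)) ?prodr_const; last first.
    move=> i; rewrite !inE => /andP[iB iD]; rewrite iD /F (negbTE iB).
    by rewrite (subsetP DA).
  by congr (_ ^+ _); apply: eq_card => i; rewrite !inE.
have [AB|nAB] := eqVneq A B.
  by rewrite big1 // => i _; rewrite /F /G AB; case: (i \in B); rewrite ?addr0 ?add0r.
have /subsetPn[i iA iB] : ~~ (A \subset B).
  by apply: contra nAB => AB; rewrite eqEsubset AB.
by rewrite (bigD1 i) //= /F /G (negbTE iB) iA addNr mul0r.
Qed.

Lemma moebius_inversion Phi A :
  Phi A = \sum_(D : {set E} | D \subset A) moebius Phi D.
Proof.
rewrite /moebius (exchange_big_dep (fun B : {set E} => B \subset A)) /=; last first.
  by move=> D B DA BD; apply: subset_trans DA.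
under eq_bigr => B BA.
  rewrite -big_distrl /=.
  under eq_bigl => D do rewrite andbC.
  rewrite sum_sign_interval //.
  over.
rewrite (bigD1 A) //= eqxx mul1r big1 ?addr0 // => B /andP[_ BA].
by rewrite eq_sym (negbTE BA) mul0r.
Qed.

Lemma norm_moebius_le Phi D : (forall A, `|Phi A| <= 1) ->
  `|moebius Phi D| <= 2 ^+ #|D|.
Proof.
move=> Phi1; apply: le_trans (ler_norm_sum _ _ _) _.
have -> : 2 ^+ #|D| = \sum_(B : {set E} | B \subset D) 1 :> R.
  rewrite sumr_const -[2]/(2%:R) -natrX -card_powerset; congr (_%:R).
  by apply: eq_card => B; rewrite !inE.
by apply: ler_sum => B _; rewrite normrM normrX normrN1 expr1n mul1r.
Qed.

Lemma sum_card_subset (A : {set E}) (j : nat) :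
  \sum_(D : {set E} | (D \subset A) && (#|D| == j)) 1 = 'C(#|A|, j)%:R :> R.
Proof. by rewrite sumr_const -cards_draws; congr (_%:R); apply: eq_card => B; rewrite !inE. Qed.

(** Trinomial revision: [C(a,K) C(K,d) = C(a,d) C(a-d,K-d)], and the last factor is at least 1. *)
Lemma bin_le_mul (a d K : nat) : (d <= K <= a)%N ->
  ('C(a, d) <= 'C(a, K) * 'C(K, d))%N.
Proof.
case/andP=> dK Ka.
have da := leq_trans dK Ka.
have f_gt0 : (0 < d`! * (K - d)`! * (a - K)`!)%N by rewrite !muln_gt0 !fact_gt0.
rewrite -(leq_pmul2r f_gt0).
have -> : ('C(a, K) * 'C(K, d) * (d`! * (K - d)`! * (a - K)`!))%N = a`!.
  by rewrite -(bin_fact Ka) -(bin_fact dK); lia.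
have Kd : (K - d <= a - d)%N by rewrite leq_sub2r.
rewrite -(bin_fact da) leq_mul2l -mulnA leq_mul2l.
have := bin_fact Kd; rewrite subnBA // subnK // => <-.
by rewrite leq_pmull ?bin_gt0 ?orbT.
Qed.

(** If [#|A| < K] nothing is truncated and inversion is exact. Otherwise the terms are bounded
    trivially by [1 + sum_(d<K) 2^d C(|A|,d)], and pulling out [C(|A|,K)] leaves a binomial
    expansion of [(1+2)^K]. The bound is a multiple of the number of [K]-subsets of [A], so
    averaging it again produces joint moments. *)
Lemma moebius_truncation Phi K A : (forall A, `|Phi A| <= 1) ->
  `|Phi A - \sum_(D : {set E} | (D \subset A) && (#|D| < K)%N) moebius Phi D|
  <= 3 ^+ K * 'C(#|A|, K)%:R.
Proof.
move=> Phi1; have [AK|KA] := ltnP #|A| K.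
  rewrite (moebius_inversion Phi A).
  rewrite (eq_bigl (fun D : {set E} => (D \subset A) && (#|D| < K)%N)).
    by rewrite subrr normr0 mulr_ge0 // exprn_ge0.
  move=> D; case: (boolP (D \subset A)) => //= DA.
  by rewrite (leq_ltn_trans (subset_leq_card DA)).
apply: le_trans (ler_normB _ _) _.
apply: (@le_trans _ _ (1 + \sum_(d < K) 2 ^+ d * 'C(#|A|, d)%:R)).
  apply: lerD => //; apply: le_trans (ler_norm_sum _ _ _) _.
  case: K KA => [|K] KA; first by rewrite big_ord0 big_pred0 // => D; rewrite andbF.
  rewrite (partition_big (fun D : {set E} => inord #|D| : 'I_K.+1) xpredT) //=.
  apply: ler_sum => d _; rewrite -(sum_card_subset A d) big_distrr /=.
  rewrite [leRHS](eq_bigl (fun D : {set E} => ((D \subset A) && (#|D| < K.+1)%N)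
     && (inord #|D| == d))); last first.
    move=> D; case: (boolP (D \subset A)) => //= DA.
    have [DK|KD] := ltnP #|D| K.+1 => /=; first by rewrite -val_eqE /= inordK.
    by apply/negbTE; move: (ltn_ord d); lia.
  apply: ler_sum => D /andP[/andP[DA DK] /eqP Dd].
  by rewrite mulr1 -Dd inordK // norm_moebius_le.
apply: (@le_trans _ _ ('C(#|A|, K)%:R * (1 + \sum_(d < K) 2 ^+ d * 'C(K, d)%:R))).
  rewrite mulrDr mulr1 lerD //; first by rewrite ler1n bin_gt0.
  rewrite big_distrr /=; apply: ler_sum => d _; rewrite mulrCA ler_pM2l ?exprn_gt0 //.
  by rewrite -natrM ler_nat bin_le_mul // ltnW.
rewrite mulrC ler_wpM2r //; have -> : 3 = 1 + 2 :> R by ring.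
rewrite exprDn.
rewrite big_ord_recr /= subnn expr0 mul1r binn mulr1n addrC; apply: lerD.
  by rewrite exprn_ege1 // ler1n.
by apply: ler_sum => d _; rewrite expr1n mul1r mulr_natr.
Qed.

Definition joint_moment (T : finType) (w : T -> R) (A : T -> {set E}) D : R :=
  \sum_(t | D \subset A t) w t.

Lemma sum_joint_moment (T : finType) (w : T -> R) (A : T -> {set E})
    (P : pred {set E}) (F : {set E} -> R) :
  \sum_t w t * (\sum_(D : {set E} | (D \subset A t) && P D) F D)
  = \sum_(D : {set E} | P D) F D * joint_moment w A D.
Proof.
under eq_bigr => t _ do rewrite big_distrr /=.
rewrite (exchange_big_dep P) /=; last by move=> ? ? _ /andP[].
apply: eq_bigr => D PD; rewrite /joint_moment big_distrr /=.
by apply: eq_big => [t|t _]; rewrite ?PD ?andbT // mulrC.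
Qed.

Lemma truncation_average (T : finType) (w : T -> R) (A : T -> {set E}) Phi K :
  (forall t, 0 <= w t) -> (forall A, `|Phi A| <= 1) ->
  `|\sum_t w t * Phi (A t)
    - \sum_(D : {set E} | (#|D| < K)%N) moebius Phi D * joint_moment w A D|
  <= 3 ^+ K * \sum_(D : {set E} | #|D| == K) joint_moment w A D.
Proof.
move=> w0 Phi1; rewrite -sum_joint_moment -sumrB.
have -> : \sum_(D : {set E} | #|D| == K) joint_moment w A D =
    \sum_(D : {set E} | #|D| == K) 1 * joint_moment w A D.
  by apply: eq_bigr => D _; rewrite mul1r.
rewrite -sum_joint_moment big_distrr /=.
apply: le_trans (ler_norm_sum _ _ _) _; apply: ler_sum => t _.
rewrite -mulrBr normrM ger0_norm // mulrCA ler_wpM2l // sum_card_subset.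
exact: moebius_truncation.
Qed.

(** Both truncation errors involve moments of order [K]. Those of the first variable are replaced by
    those of the second at the cost of their difference, so that a tail estimate is required only in
    the model. *)
Lemma moment_comparison (T1 T2 : finType) (w1 : T1 -> R) (w2 : T2 -> R)
    (A1 : T1 -> {set E}) (A2 : T2 -> {set E}) Phi K :
  (forall t, 0 <= w1 t) -> (forall t, 0 <= w2 t) -> (forall A, `|Phi A| <= 1) ->
  `|\sum_t w1 t * Phi (A1 t) - \sum_t w2 t * Phi (A2 t)|
  <= 3 ^+ K *
     (\sum_(D : {set E} | (#|D| <= K)%N) `|joint_moment w1 A1 D - joint_moment w2 A2 D|
      + 2 * \sum_(D : {set E} | #|D| == K) joint_moment w2 A2 D).
Proof.
move=> w10 w20 Phi1.
have h1 := truncation_average A1 K w10 Phi1.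
have h2 := truncation_average A2 K w20 Phi1.
set e1 := \sum_t _ in h1 *; set e2 := \sum_t _ in h2 *.
set s1 := \sum_(D | _) _ in h1; set s2 := \sum_(D | _) _ in h2.
set m1 := \sum_(D | _) _ in h1; set m2 := \sum_(D | _) _ in h2 *.
pose dK := \sum_(D : {set E} | #|D| == K) `|joint_moment w1 A1 D - joint_moment w2 A2 D|.
pose dl := \sum_(D : {set E} | (#|D| < K)%N) `|joint_moment w1 A1 D - joint_moment w2 A2 D|.
have -> : \sum_(D : {set E} | (#|D| <= K)%N)
    `|joint_moment w1 A1 D - joint_moment w2 A2 D| = dK + dl.
  rewrite (bigID (fun D : {set E} => #|D| == K)) /=; congr (_ + _).
    by apply: eq_bigl => D; rewrite andb_idl // => /eqP ->.
  by apply: eq_bigl => D; rewrite ltn_neqAle andbC.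
have m1m2 : m1 <= dK + m2.
  rewrite -big_split /=; apply: ler_sum => D _.
  by rewrite -lerBlDr ler_norm.
have ss : `|s1 - s2| <= 3 ^+ K * dl.
  rewrite -sumrB big_distrr /=; apply: le_trans (ler_norm_sum _ _ _) _.
  apply: ler_sum => D DK; rewrite -mulrBr normrM ler_wpM2r //.
  apply: le_trans (norm_moebius_le _ Phi1) _.
  apply: (@le_trans _ _ (3 ^+ #|D|)); first by rewrite lerXn2r ?nnegrE // ler_nat.
  by rewrite ler_eXn2l ?(ltnW DK) // ltr1n.
have -> : e1 - e2 = (e1 - s1) - (e2 - s2) + (s1 - s2) by ring.
apply: le_trans (ler_normD _ _) _.
apply: le_trans (lerD (ler_normB _ _) ss) _.
apply: le_trans (lerD (lerD h1 h2) (lexx _)) _.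
have : 3 ^+ K * m1 <= 3 ^+ K * (dK + m2) by rewrite ler_wpM2l ?exprn_ge0.
set t := 3 ^+ K; lra.
Qed.
End MomentComparison.

(** * Counting integers in residue classes *)

Section Counting.

(** The count increases when [N] passes an integer congruent to [r]; adding [M - 1 - r] aligns these
    jumps with the multiples of [M]. *)
Lemma sum_eqmod (N M r : nat) : (r < M)%N ->
  (\sum_(n < N) (n == r %[mod M]) = (N + (M.-1 - r)) %/ M)%N.
Proof.
move=> rM; have M_gt0 : (0 < M)%N by apply: leq_ltn_trans rM.
elim: N => [|N IHN]; first by rewrite big_ord0 add0n divn_small //; lia.
rewrite big_ord_recr /= IHN addSn divnS // addnC; congr (nat_of_bool _ + _)%N.
rewrite -(eqn_modDr (M - r)) subnKC ?(ltnW rM) // modnn.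
by have -> : (N + (M.-1 - r)).+1 = (N + (M - r))%N by lia.
Qed.

Lemma sum_dvdS (N M : nat) : (0 < M)%N ->
  (\sum_(n < N) (M %| n.+1) = N %/ M)%N.
Proof.
move=> M_gt0; transitivity (\sum_(n < N) (n == M.-1 %[mod M]))%N.
  apply: eq_bigr => n _; congr nat_of_bool.
  by rewrite -(eqn_modDr 1) !addn1 prednK // modnn.
by rewrite sum_eqmod ?prednK // subnn addn0.
Qed.

(** The entries of [s] are pairs (modulus, residue). *)
Lemma chinese_seq (s : seq (nat * nat)) :
  pairwise (fun u v => coprime u.1 v.1) s -> (0 < \prod_(u <- s) u.1)%N ->
  {r | (r < \prod_(u <- s) u.1)%N &
    forall n, all (fun u => n == u.2 %[mod u.1]) s = (n == r %[mod \prod_(u <- s) u.1])}.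
Proof.
elim: s => [|u s IHs] /=; first by exists 0%N => [|n]; rewrite big_nil ?modn1.
case/andP=> us /IHs{}IHs; rewrite big_cons muln_gt0 => /andP[u_gt0 s_gt0].
have [r _ rP] := IHs s_gt0.
have co : coprime u.1 (\prod_(v <- s) v.1).
  elim: s us {IHs s_gt0 r rP} => [|v s IHs] /=; first by rewrite big_nil coprimen1.
  by case/andP=> uv us; rewrite big_cons coprimeMr uv IHs.
exists (chinese u.1 (\prod_(v <- s) v.1) u.2 r %% (u.1 * \prod_(v <- s) v.1))%N.
  by rewrite ltn_mod muln_gt0 u_gt0.
move=> n; rewrite rP modn_mod chinese_remainder //.
by rewrite chinese_modl // chinese_modr.
Qed.

Lemma norm_eqmod_density (R : realFieldType) (N M r : nat) : (r < M)%N ->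
  `|(\sum_(n < N) (n == r %[mod M]))%:R - N%:R / M%:R| <= 1 :> R.
Proof.
move=> rM; have M_gt0 : (0 < M)%N by apply: leq_ltn_trans rM.
have M0 : 0 < M%:R :> R by rewrite ltr0n.
rewrite sum_eqmod //; set a := (N + _)%N; set c := (a %/ M)%N.
have cl : (c * M <= N + M)%N.
  by apply: leq_trans (leq_divM a M) _; rewrite /a leq_add2l; lia.
have cu : (N <= c * M + M)%N.
  by apply: ltnW; have := ltn_ceil a M_gt0; rewrite -/c /a; lia.
rewrite ler_distl; apply/andP; split.
  by rewrite lerBlDr ler_pdivrMr // mulrDl mul1r -natrM -natrD ler_nat.
by rewrite -lerBlDr ler_pdivlMr // mulrBl mul1r lerBlDr -natrM -natrD ler_nat.
Qed.

End Counting.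

(** * The Bernoulli model and prime divisors of consecutive integers *)

Lemma prod_addr_set (R : comPzRingType) (I : finType) (F G : I -> R) :
  \prod_i (F i + G i) = \sum_(J : {set I}) \prod_i (if i \in J then F i else G i).
Proof. by rewrite bigA_distr; apply: eq_bigl => J; rewrite inE. Qed.

Section BernoulliModel.
Variables (R : realFieldType) (I : finType) (k : nat) (x : I -> R).
Hypothesis x01 : forall i, 0 <= x i <= 1.
Local Notation E := (I * 'I_k)%type.

Definition bernoulli (s : {set I}) : R :=
  \prod_i (if i \in s then x i else 1 - x i).

Definition bernoulli_mean (f : nat -> R) : R := \sum_s bernoulli s * f #|s|.

Lemma bernoulli_ge0 s : 0 <= bernoulli s.
Proof.
by apply: prodr_ge0 => i _; have := x01 i; case: ifP => _; lra.
Qed.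

Lemma sum_bernoulli : \sum_s bernoulli s = 1.
Proof.
rewrite -(prod_addr_set x (fun i => 1 - x i)).
by apply: big1 => i _; rewrite addrC subrK.
Qed.

(** Packs [k] random subsets of [I], one per shift, into a single subset of [E], so that the
    comparison of set-valued variables applies to all shifts at once. *)
Definition columns (g : {ffun 'I_k -> {set I}}) : {set E} :=
  [set e : E | e.1 \in g e.2].

(** The sum factors over all pairs [(i, h)]. A pair in [D] loses its term [1 - x i] and leaves
    [x i]; any other pair sums to 1. *)
Lemma joint_moment_bernoulli (D : {set E}) :
  joint_moment (fun g : {ffun 'I_k -> {set I}} => \prod_h bernoulli (g h)) columns D
  = \prod_(e in D) x e.1.
Proof.
pose F (h : 'I_k) (s : {set I}) : R :=
  \prod_i (if i \in s then x i else if (i, h) \in D then 0 else 1 - x i).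
transitivity (\sum_(g : {ffun 'I_k -> {set I}}) \prod_h F h (g h)).
  rewrite /joint_moment big_mkcond; apply: eq_bigr => g _.
  case: ifP => [/subsetP DA|/negbT/subsetPn[[i h] iD iA]].
    apply: eq_bigr => h _; apply: eq_bigr => i _.
    case: ifP => // igh; case: ifP => // /DA.
    by rewrite inE /= igh.
  rewrite (bigD1 h) //= /F (bigD1 i) //=; rewrite inE /= in iA.
  by rewrite (negbTE iA) iD !mul0r.
rewrite -bigA_distr_bigA /=.
transitivity (\prod_h \prod_i (if (i, h) \in D then x i else 1)).
  apply: eq_bigr => h _; rewrite /F.
  rewrite -(prod_addr_set x (fun i => if (i, h) \in D then 0 else 1 - x i)).
  by apply: eq_bigr => i _; case: ifP => _; rewrite ?addr0 // addrC subrK.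
by rewrite exchange_big pair_big /= [RHS]big_mkcond; apply: eq_bigr => -[].
Qed.

Lemma mean_columns (f : 'I_k -> nat -> R) :
  \sum_(g : {ffun 'I_k -> {set I}}) (\prod_h bernoulli (g h)) *
     \prod_h f h #|[set i | (i, h) \in columns g]|
  = \prod_h bernoulli_mean (f h).
Proof.
rewrite bigA_distr_bigA; apply: eq_bigr => g _; rewrite -big_split /=.
apply: eq_bigr => h _; congr (_ * f h _); apply: eq_card => i.
by rewrite !inE.
Qed.

End BernoulliModel.

(** * Sums of products over families of subsets *)

Section SubsetSums.
Variables (R : realFieldType) (E : finType).
Implicit Types (y : E -> R) (B D : {set E}).

Lemma sum_prod_subset y : \sum_(D : {set E}) \prod_(e in D) y e = \prod_e (1 + y e).
Proof.
under [RHS]eq_bigr => e _ do rewrite addrC.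
by rewrite prod_addr_set; apply: eq_bigr => D _; rewrite [LHS]big_mkcond.
Qed.

(** The exact value has [y e] on [B] and [1 + y e] off [B]. Inserting [1 + y e >= 1] on [B] as well
    makes the second factor independent of [B]. *)
Lemma sum_prod_superset_le y B : (forall e, 0 <= y e) ->
  \sum_(D : {set E} | B \subset D) \prod_(e in D) y e
  <= \prod_(e in B) y e * \prod_e (1 + y e).
Proof.
move=> y0; pose G e : R := if e \in B then 0 else 1.
have -> : \sum_(D : {set E} | B \subset D) \prod_(e in D) y e = \prod_e (y e + G e).
  rewrite prod_addr_set big_mkcond; apply: eq_bigr => D _.
  case: ifP => [/subsetP BD|/negbT/subsetPn[e eB eD]].
    rewrite big_mkcond; apply: eq_bigr => e _; case: ifP => // /negbT eD.
    by rewrite /G (negbTE (contra (BD e) eD)).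
  by rewrite (bigD1 e) //= (negbTE eD) /G eB mul0r.
rewrite [X in X * _]big_mkcond -big_split /=; apply: ler_prod => e _.
rewrite /G; have := y0 e; case: ifP => _ ye; apply/andP; split; nra.
Qed.

(** Rankin's trick: the weight [t^(#|D| - K)] is positive and equals 1 on the sets of size [K], and
    the weighted sum over all sets is a product. *)
Lemma sum_prod_card_le y K (t : R) : 0 < t -> (forall e, 0 <= y e) ->
  \sum_(D : {set E} | #|D| == K) \prod_(e in D) y e
  <= t ^- K * \prod_e (1 + t * y e).
Proof.
move=> t0 y0; rewrite -sum_prod_subset big_distrr /=.
rewrite [leRHS](bigID (fun D : {set E} => #|D| == K)) /= ler_wpDr //.
  apply: sumr_ge0 => D _; rewrite mulr_ge0 ?invr_ge0 ?exprn_ge0 ?(ltW t0) //.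
  by apply: prodr_ge0 => e _; rewrite mulr_ge0 // ltW.
apply: ler_sum => D /eqP <-; rewrite big_split /= prodr_const mulKf //.
by rewrite expf_neq0 // gt_eqF.
Qed.

(** The same trick with [t <= 1], where the weight [t^(#|D| - K)] is at least 1 on all sets of size
    at most [K]. *)
Lemma card_small_sets_le K (t : R) : 0 < t <= 1 ->
  \sum_(D : {set E} | (#|D| <= K)%N) 1 <= t ^- K * (1 + t) ^+ #|E|.
Proof.
case/andP=> t0 t1.
have -> : (1 + t) ^+ #|E| = \prod_(e : E) (1 + t) by rewrite prodr_const.
rewrite -sum_prod_subset big_distrr /=.
rewrite [leRHS](bigID (fun D : {set E} => (#|D| <= K)%N)) /= ler_wpDr //.
  apply: sumr_ge0 => D _; rewrite mulr_ge0 ?invr_ge0 ?exprn_ge0 ?(ltW t0) //.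
  by apply: prodr_ge0 => e _; rewrite ltW.
apply: ler_sum => D DK; rewrite prodr_const mulrC -ler_pdivrMr ?invr_gt0 ?exprn_gt0 //.
by rewrite invrK mul1r ler_wiXn2l // ltW.
Qed.

End SubsetSums.

(** * Prime divisors of consecutive integers against the model *)

Section ShiftedDivisors.
Variables (R : realFieldType) (I : finType) (k N : nat) (pr : I -> nat).
Hypotheses (pr_prime : forall i, prime (pr i)) (pr_inj : injective pr)
  (k_le_pr : forall i, (k <= pr i)%N) (N_gt0 : (0 < N)%N).
Local Notation E := (I * 'I_k)%type.
Local Notation x i := ((pr i)%:R^-1 : R).
Local Notation w := (fun _ : 'I_N => N%:R^-1 : R).

Definition shift_divisors (n : 'I_N) : {set E} :=
  [set e : E | (pr e.1 %| (n + e.2).+1)%N].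

(** The right-hand residue is a natural number representing [-(h+1)]. As [n] counts from 0, the
    integer tested for shift [h] is [n + h + 1]. *)
Lemma dvdn_shift (n h p : nat) : (0 < p)%N ->
  (p %| (n + h).+1)%N = (n == p * h.+1 - h.+1 %[mod p]).
Proof.
move=> p_gt0; rewrite -(eqn_modDr h.+1) subnK ?leq_pmull // modnMr.
by rewrite /dvdn addnS.
Qed.

(** The primes involved are distinct, so the conditions define one class modulo their product. A
    class modulo [M] has [N/M + O(1)] members below [N] however large [M] is, whence an error of
    [1/N]. *)
Lemma joint_moment_shift (D : {set E}) :
  {in D &, injective (fun e : E => e.1)} ->
  `|joint_moment w shift_divisors D - \prod_(e in D) x e.1| <= N%:R^-1.
Proof.
move=> Dinj.
pose s := [seq (pr e.1, (pr e.1 * (val e.2).+1 - (val e.2).+1)%N) | e <- enum D].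
have pM : (\prod_(u <- s) u.1 = \prod_(e in D) pr e.1)%N.
  by rewrite big_map big_enum.
have s_gt0 : (0 < \prod_(u <- s) u.1)%N.
  by rewrite pM prodn_cond_gt0 // => e _; rewrite prime_gt0.
have s_co : pairwise (fun u v => coprime u.1 v.1) s.
  have : {subset enum D <= D} by move=> e; rewrite mem_enum.
  rewrite /s; elim: (enum D) (enum_uniq D) => //= e l IHl /andP[el lu] lD.
  have lD' : {subset l <= D} by move=> f fl; apply: lD; rewrite inE fl orbT.
  rewrite IHl // andbT all_map; apply/allP => f fl /=.
  rewrite prime_coprime // dvdn_prime2 //; apply: contra el => /eqP /pr_inj ef.
  by rewrite (Dinj e f) // ?lD ?mem_head // inE fl orbT.
have [r rM rP] := chinese_seq s_co s_gt0.
have -> : joint_moment w shift_divisors D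
    = (\sum_(n < N) (n == r %[mod \prod_(u <- s) u.1]))%:R / N%:R.
  rewrite /joint_moment natr_sum big_distrl big_mkcond; apply: eq_bigr => n _.
  rewrite -rP; have -> : (D \subset shift_divisors n) =
      all (fun u => n == u.2 %[mod u.1]) s.
    rewrite all_map; apply/subsetP/allP => DA e.
      by rewrite mem_enum => /DA; rewrite inE dvdn_shift // prime_gt0.
    by move=> eD; rewrite inE dvdn_shift ?prime_gt0 //; apply: DA; rewrite mem_enum.
  by case: all; rewrite /= ?mul1r ?mul0r.
have -> : \prod_(e in D) x e.1 = N%:R / (\prod_(u <- s) u.1)%:R / N%:R.
  rewrite pM natr_prod prodfV mulrAC divff ?mul1r //.
  by rewrite pnatr_eq0 -lt0n.
rewrite -mulrBl normrM [X in _ * X]ger0_norm ?invr_ge0 //.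
by rewrite ler_piMl ?invr_ge0 // norm_eqmod_density.
Qed.

(** A prime dividing two shifts would divide their difference, which is positive and less than
    [k <= pr i]. *)
Lemma joint_moment_shift_noninj (D : {set E}) (i : I) (h h' : 'I_k) :
  h != h' -> (i, h) \in D -> (i, h') \in D ->
  joint_moment w shift_divisors D = 0.
Proof.
move=> hh' iD iD'; apply: big1 => n /subsetP DA; exfalso.
have := DA _ iD; have := DA _ iD'; rewrite !inE /= -!addnS.
wlog hlt : h h' hh' iD iD' / (h < h')%N.
  move=> H; move: (hh'); rewrite -val_eqE neq_ltn => /orP[]; first exact: H.
  by move=> hlt ? ?; apply: (H h' h) => //; rewrite eq_sym.
move=> d' d; have : (pr i %| h' - h)%N.
  by have := dvdn_sub d' d; rewrite subnDl subSS.
apply/negP; rewrite gtnNdvd ?subn_gt0 //.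
by have := ltn_ord h'; have := k_le_pr i; lia.
Qed.

Local Notation y := (fun e : E => x e.1).

(** The first term collects the rounding error [1/N] of each small set. The second bounds the
    model's mass on the [bad] sets, which use one prime at two shifts and have moment 0 for the
    integers: a pair of equal primes costs [x i ^+ 2], and there are at most [k^2] pairs of
    shifts. *)
Lemma sum_moment_difference K (t : R) : 0 < t <= 1 ->
  \sum_(D : {set E} | (#|D| <= K)%N)
     `|joint_moment w shift_divisors D - \prod_(e in D) y e|
  <= t ^- K * (1 + t) ^+ #|{: E}| / N%:R
     + k%:R ^+ 2 * (\sum_i x i ^+ 2) * \prod_e (1 + y e).
Proof.
move=> t01.
have x0 i : 0 <= x i by rewrite invr_ge0.
pose bad (D : {set E}) := [exists u : I * ('I_k * 'I_k),
   [&& u.2.1 != u.2.2, (u.1, u.2.1) \in D & (u.1, u.2.2) \in D]].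
apply: (@le_trans _ _ (\sum_(D : {set E} | (#|D| <= K)%N) N%:R^-1 +
   \sum_(D : {set E} | bad D) \prod_(e in D) y e)).
  rewrite [X in _ + X]big_mkcond [X in _ + X](bigID (fun D : {set E} => (#|D| <= K)%N)) /=.
  rewrite addrA ler_wpDr //.
    by apply: sumr_ge0 => D _; case: ifP => // _; apply: prodr_ge0.
  rewrite -big_split /=; apply: ler_sum => D _.
  case: ifP => [/existsP[[i [h h']]] /= /and3P[hh' iD iD']|/negbT nbad].
    rewrite (joint_moment_shift_noninj hh' iD iD') sub0r normrN.
    by rewrite ger0_norm ?prodr_ge0 // ler_wpDl ?invr_ge0.
  rewrite addr0; apply: joint_moment_shift => -[i h] [i' h'] /= iD iD' ii'.
  rewrite -ii' in iD' *; congr pair; apply/eqP/negPn; apply: contra nbad => hh'.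
  by apply/existsP; exists (i, (h, h')); rewrite /= hh' iD iD'.
apply: lerD.
  have -> : \sum_(D : {set E} | (#|D| <= K)%N) N%:R^-1 =
      (\sum_(D : {set E} | (#|D| <= K)%N) 1) / N%:R :> R.
    by rewrite big_distrl /=; apply: eq_bigr => D _; rewrite mul1r.
  by rewrite ler_wpM2r ?invr_ge0 // card_small_sets_le.
pose B (u : I * ('I_k * 'I_k)) : {set E} := [set (u.1, u.2.1); (u.1, u.2.2)].
apply: (@le_trans _ _ (\sum_(u : I * ('I_k * 'I_k) | u.2.1 != u.2.2)
    \sum_(D : {set E} | B u \subset D) \prod_(e in D) y e)).
  rewrite (exchange_big_dep xpredT) //=.
  rewrite [leRHS](bigID bad) /= ler_wpDr //.
    by apply: sumr_ge0 => D _; apply: sumr_ge0 => u _; apply: prodr_ge0.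
  apply: ler_sum => D /existsP[u /and3P[uu uD uD']].
  rewrite (bigD1 u) /=; last by rewrite uu subUset !sub1set uD uD'.
  by rewrite ler_wpDr // sumr_ge0 // => v _; apply: prodr_ge0.
apply: (@le_trans _ _ (\sum_(u : I * ('I_k * 'I_k) | u.2.1 != u.2.2)
    x u.1 ^+ 2 * \prod_e (1 + y e))).
  apply: ler_sum => u uu; apply: le_trans (sum_prod_superset_le _ _) _ => //.
  by rewrite big_setU1 ?big_set1 // inE xpair_eqE eqxx.
rewrite -big_distrl /= ler_wpM2r //.
  by apply: prodr_ge0 => e _; rewrite addr_ge0.
apply: (@le_trans _ _ (\sum_(u : I * ('I_k * 'I_k)) x u.1 ^+ 2)).
  rewrite [leRHS](bigID (fun u => u.2.1 != u.2.2)) /= ler_wpDr //.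
  by apply: sumr_ge0 => u _; rewrite exprn_ge0.
rewrite -(pair_big xpredT xpredT (fun i _ => x i ^+ 2)) /= big_distrr /=.
apply: ler_sum => i _; rewrite sumr_const card_prod card_ord.
by rewrite -[leLHS]mulr_natl natrM expr2.
Qed.

Lemma shift_correlations (f : 'I_k -> nat -> R) (K : nat) (t : R) : 0 < t <= 1 ->
  (forall h a, 0 <= f h a <= 1) ->
  `|N%:R^-1 * \sum_(n < N) \prod_h f h #|[set i | (pr i %| (n + h).+1)%N]|
    - \prod_h bernoulli_mean (fun i => x i) (f h)|
  <= 3 ^+ K * (t ^- K * (1 + t) ^+ #|{: E}| / N%:R
     + k%:R ^+ 2 * (\sum_i x i ^+ 2) * \prod_e (1 + y e)
     + 2 * (16 ^- K * \prod_e (1 + 16 * y e))).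
Proof.
move=> t01 f01.
have x0 i : 0 <= x i by rewrite invr_ge0.
have x1 i : 0 <= x i <= 1.
  by rewrite x0 invf_le1 ?ltr0n ?ler1n prime_gt0.
pose Phi (A : {set E}) : R := \prod_h f h #|[set i | (i, h) \in A]|.
have Phi1 A : `|Phi A| <= 1.
  rewrite ger0_norm; last by apply: prodr_ge0 => h _; case/andP: (f01 h #|[set i | (i, h) \in A]|).
  by apply: prodr_ile1 => h _.
rewrite -mean_columns; set m2 := \sum_g _.
have -> : N%:R^-1 * \sum_(n < N) \prod_h f h #|[set i | (pr i %| (n + h).+1)%N]|
    = \sum_(n < N) N%:R^-1 * Phi (shift_divisors n).
  rewrite big_distrr /=; apply: eq_bigr => n _; congr (_ * _); apply: eq_bigr => h _.
  by congr f; apply: eq_card => i; rewrite !inE.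
have w20 (g : {ffun 'I_k -> {set I}}) : 0 <= \prod_h bernoulli (fun i => x i) (g h).
  by apply: prodr_ge0 => h _; apply: bernoulli_ge0.
apply: le_trans (moment_comparison shift_divisors (@columns I k) K _ w20 Phi1) _.
  by move=> n; rewrite invr_ge0.
rewrite ler_wpM2l ?exprn_ge0 //.
rewrite (eq_bigr (fun D : {set E} => `|joint_moment w shift_divisors D - \prod_(e in D) y e|)); last first.
  by move=> D _; rewrite joint_moment_bernoulli.
apply: lerD; first exact: sum_moment_difference.
rewrite ler_wpM2l // (eq_bigr (fun D : {set E} => \prod_(e in D) y e)); last first.
  by move=> D _; rewrite joint_moment_bernoulli.
by apply: sum_prod_card_le => //; rewrite ltr0n.
Qed.

End ShiftedDivisors.

(** * An exponential moment of the number of prime divisors *)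

Section DivisorTail.
Variables (R : realFieldType) (I : finType) (N : nat) (pr : I -> nat).
Hypotheses (pr_prime : forall i, prime (pr i)) (pr_inj : injective pr).

(** [2 ^+ #|A|] counts the subsets of [A]. After exchanging sums, a set [D] of primes contributes
    the number of multiples of its product up to [N], at most [N] over that product. *)
Lemma sum_pow2_divisors_le :
  \sum_(n < N) 2 ^+ #|[set i | (pr i %| n.+1)%N]|
  <= N%:R * \prod_i (1 + (pr i)%:R^-1) :> R.
Proof.
rewrite -sum_prod_subset big_distrr /=.
have -> : \sum_(n < N) 2 ^+ #|[set i | (pr i %| n.+1)%N]| =
    \sum_(n < N) \sum_(D : {set I} | D \subset [set i | (pr i %| n.+1)%N]) 1 :> R.
  apply: eq_bigr => n _; rewrite sumr_const -natrX -card_powerset; congr (_%:R).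
  by apply: eq_card => D; rewrite !inE.
rewrite (exchange_big_dep xpredT) //=; apply: ler_sum => D _.
have dvdD n : (D \subset [set i | (pr i %| n)%N]) = (\prod_(i in D) pr i %| n)%N.
  rewrite -big_enum; have : {subset enum D <= D} by move=> i; rewrite mem_enum.
  have -> : (D \subset [set i | (pr i %| n)%N]) = all (fun i => pr i %| n)%N (enum D).
    apply/subsetP/allP => DA i; first by rewrite mem_enum => /DA; rewrite inE.
    by move=> iD; rewrite inE; apply: DA; rewrite mem_enum.
  elim: (enum D) (enum_uniq D) => [|i l IHl] /=; first by rewrite big_nil dvd1n.
  case/andP=> il lu lD; rewrite big_cons Gauss_dvd ?IHl //.
    by move=> j jl; apply: lD; rewrite inE jl orbT.
  elim: l il {IHl lu lD} => [|j l IHl] il; first by rewrite big_nil coprimen1.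
  move: il; rewrite inE negb_or => /andP[ij il].
  rewrite big_cons coprimeMr IHl // andbT prime_coprime // dvdn_prime2 //.
  by apply: contra ij => /eqP/pr_inj ->.
have M_gt0 : (0 < \prod_(i in D) pr i)%N.
  by rewrite prodn_cond_gt0 // => i _; rewrite prime_gt0.
rewrite prodfV -natr_prod -[1]/(1%:R) -natr_sum.
rewrite ler_pdivlMr ?ltr0n // -natrM ler_nat.
rewrite big_mkcond (eq_bigr (fun n : 'I_N => nat_of_bool (\prod_(i in D) pr i %| n.+1)))%N.
  by rewrite sum_dvdS // leq_divM.
by move=> n _; rewrite dvdD; case: dvdn.
Qed.

End DivisorTail.

(** * Elementary symmetric functions *)

Section ElementarySymmetric.
Variables (R : realFieldType) (I : finType) (y : I -> R).
Hypothesis y_ge0 : forall i, 0 <= y i.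

Definition elem_sym (a : nat) : R :=
  \sum_(s : {set I} | #|s| == a) \prod_(i in s) y i.

Lemma elem_sym_ge0 a : 0 <= elem_sym a.
Proof. by apply: sumr_ge0 => s _; apply: prodr_ge0. Qed.

Lemma elem_sym0 : elem_sym 0 = 1.
Proof.
rewrite /elem_sym (eq_bigl (pred1 set0)) ?big_pred1_eq ?big_set0 //.
by move=> s; rewrite cards_eq0.
Qed.

(** Double counting: a set of size [a+1] with a marked element [i] is the same as a set of size [a]
    with a point [i] outside it. *)
Lemma elem_symS a : a.+1%:R * elem_sym a.+1 =
  \sum_(s : {set I} | #|s| == a) (\sum_(i | i \notin s) y i) * \prod_(i in s) y i.
Proof.
transitivity (\sum_i \sum_(t : {set I} | (#|t| == a.+1) && (i \in t)) \prod_(j in t) y j).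
  rewrite (exchange_big_dep (fun t : {set I} => #|t| == a.+1)) /=; last first.
    by move=> i t _ /andP[].
  rewrite /elem_sym big_distrr /=; apply: eq_bigr => t /eqP ta.
  rewrite mulr_natl sumr_const; congr (_ *+ _).
  by rewrite -[LHS]ta; apply: eq_card => i; rewrite [RHS]unfold_in ta eqxx.
rewrite [RHS](eq_bigr (fun s : {set I} => \sum_(i | i \notin s) y i * \prod_(j in s) y j));
  last by move=> s _; rewrite big_distrl.
rewrite [RHS](exchange_big_dep xpredT) //=; apply: eq_bigr => i _.
rewrite (reindex_onto (fun s => i |: s) (fun t => t :\ i)) /=; last first.
  by move=> t /andP[_ it]; rewrite setD1K.
apply: eq_big => [s|s /andP[/andP[_ _] /eqP si]].
  have [is_|nis] := boolP (i \in s).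
    rewrite andbF; apply/negbTE; rewrite !negb_and; apply/orP; right.
    by apply/eqP => /setP/(_ i); rewrite !inE eqxx is_.
  by rewrite setU1K // eqxx cardsU1 nis add1n eqSS setU11 !andbT.
have nis : i \notin s by rewrite -si !inE eqxx.
by rewrite big_setU1.
Qed.

Lemma elem_sym_le a : elem_sym a <= (\sum_i y i) ^+ a / a`!%:R.
Proof.
elim: a => [|a IHa]; first by rewrite elem_sym0 expr0 fact0 divr1.
have a0 : 0 < a.+1%:R :> R by rewrite ltr0n.
rewrite -(ler_pM2l a0) elem_symS factS natrM invfM exprS.
rewrite [leRHS](_ : _ = (\sum_i y i) * ((\sum_i y i) ^+ a / a`!%:R)); last first.
  by field; rewrite pnatr_eq0 -lt0n fact_gt0 nat1r pnatr_eq0.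
apply: (@le_trans _ _ ((\sum_i y i) * elem_sym a)); last first.
  by rewrite ler_wpM2l // sumr_ge0.
rewrite /elem_sym big_distrr /=; apply: ler_sum => s _.
rewrite ler_wpM2r ?prodr_ge0 // [leRHS](bigID (mem s)) /= ler_wpDl //.
by rewrite sumr_ge0.
Qed.

(** In the recursion of [elem_symS] the weight outside a set of size [a] is at least the total minus
    [a * eta]. Using the final, largest deficit in every factor turns the product into a power. *)
Lemma elem_sym_ge (eta : R) a : (forall i, y i <= eta) ->
  0 <= eta -> a%:R * eta <= \sum_i y i ->
  (\sum_i y i - a%:R * eta) ^+ a / a`!%:R <= elem_sym a.
Proof.
move=> yeta eta0; elim: a => [|a IHa] aS; first by rewrite elem_sym0 expr0 fact0 divr1.
have a0 : 0 < a.+1%:R :> R by rewrite ltr0n.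
have aS' : a%:R * eta <= \sum_i y i.
  by apply: le_trans aS; rewrite ler_wpM2r // ler_nat.
rewrite -(ler_pM2l a0) elem_symS factS natrM invfM exprS.
set T := \sum_i y i in aS aS' IHa *.
rewrite [leLHS](_ : _ = (T - a.+1%:R * eta) * ((T - a.+1%:R * eta) ^+ a / a`!%:R));
  last by field; rewrite pnatr_eq0 -lt0n fact_gt0 nat1r pnatr_eq0.
apply: (@le_trans _ _ ((T - a%:R * eta) * elem_sym a)).
  have sub : T - a.+1%:R * eta <= T - a%:R * eta.
    by rewrite lerB // ler_wpM2r // ler_nat.
  apply: ler_pM; rewrite ?mulr_ge0 ?exprn_ge0 ?invr_ge0 ?subr_ge0 //.
  apply: le_trans (IHa aS'); rewrite ler_wpM2r ?invr_ge0 //.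
  by rewrite lerXn2r ?nnegrE ?subr_ge0.
rewrite /elem_sym big_distrr /=; apply: ler_sum => s /eqP sa.
rewrite ler_wpM2r ?prodr_ge0 // lerBlDl /T (bigID (mem s)) /= lerD2r.
rewrite -sa mulr_natl -sumr_const; exact: ler_sum.
Qed.

End ElementarySymmetric.

Lemma sum_bernoulli_card (R : realFieldType) (I : finType) (x : I -> R) (a : nat) :
  (forall i, x i < 1) ->
  \sum_(s : {set I} | #|s| == a) bernoulli x s
  = \prod_i (1 - x i) * elem_sym (fun i => x i / (1 - x i)) a.
Proof.
move=> x1; rewrite big_distrr /=; apply: eq_bigr => s _.
rewrite [X in _ * X]big_mkcond -big_split /=; apply: eq_bigr => i _.
by case: ifP => _; rewrite ?mulr1 // mulrC divfK // subr_eq0 gt_eqF.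
Qed.

(** [M] may exceed [#|I|], so that the sum can run past the right end of the window whatever the
    number of primes is. *)
Lemma bernoulli_mean_sum (R : realFieldType) (I : finType) (x : I -> R) (P : pred nat)
    (M : nat) : (#|I| <= M)%N ->
  bernoulli_mean x (fun a => (P a)%:R)
  = \sum_(a < M.+1 | P a) \sum_(s : {set I} | #|s| == a) bernoulli x s.
Proof.
move=> IM.
rewrite /bernoulli_mean (partition_big (fun s : {set I} => inord #|s| : 'I_M.+1) xpredT) //=.
rewrite [RHS]big_mkcond; apply: eq_bigr => a _.
have key (s : {set I}) : (inord #|s| == a) = (#|s| == a).
  by rewrite -val_eqE /= inordK // ltnS (leq_trans (max_card _)).
under eq_bigl => s do rewrite key.
case: ifP => Pa; last by apply: big1 => s /eqP ->; rewrite Pa mulr0.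
by apply: eq_bigr => s /eqP ->; rewrite Pa mulr1.
Qed.

(** * Gaps of a sorted sequence *)

Section SortedGaps.
Local Open Scope nat_scope.
Variables (s : seq nat) (H : nat).
Hypotheses (s_sorted : sorted ltn s) (s_gt0 : all (leq 1) s).
Local Notation nth := (nth 0).

Definition gap_after (n : nat) : bool := all (fun h => n + h.+1 \notin s) (iota 0 H).

Lemma sum_ord_count (p : pred nat) (N : nat) : \sum_(n < N) p n = count p (iota 0 N).
Proof.
rewrite -(big_mkord xpredT (fun n => nat_of_bool (p n))) -sum1_count /index_iota subn0.
by rewrite [RHS]big_mkcond; apply: eq_bigr => n _; case: (p n).
Qed.

Lemma filter_leq_sorted (N : nat) :
  [seq n <- s | n <= N] = take (count (leq^~ N) s) s.
Proof.
apply: (Order.POrderTheory.sorted_filter_le (N : nat)).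
by apply: sub_sorted s_sorted => i j /ltnW.
Qed.

Lemma filter_mem_iota (N : nat) : [seq n <- iota 1 N | n \in s] = [seq n <- s | n <= N].
Proof.
apply: (irr_sorted_eq ltn_trans ltnn).
- by apply: sorted_filter (iota_ltn_sorted _ _); apply: ltn_trans.
- by apply: sorted_filter s_sorted; apply: ltn_trans.
move=> n; rewrite !mem_filter mem_iota add1n ltnS.
have [ns|] := boolP (n \in s); last by rewrite andbF.
by rewrite (allP s_gt0 n ns) andbT.
Qed.

Lemma sum_mem_count (N : nat) : \sum_(n < N) (n.+1 \in s) = count (leq^~ N) s.
Proof.
rewrite (sum_ord_count (fun n => n.+1 \in s)) -[RHS]size_filter -filter_mem_iota.
by rewrite size_filter (iotaDl 1 0) count_map.
Qed.

Lemma isolated_nth (i : nat) : i.+1 < size s ->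
  gap_after (nth s i) = (nth s i + H < nth s i.+1).
Proof.
move=> iS; have mono := Order.POrderTheory.lt_sorted_ltn_nth 0 s_sorted.
have monoP a b : a < size s -> b < size s -> (nth s a < nth s b) = (a < b).
  by move=> a_s b_s; apply: mono.
have i_lt : nth s i < nth s i.+1 by rewrite monoP // ltnW.
apply/allP/idP => [iso|gap h].
  rewrite ltnNge; apply/negP => le.
  have := iso (nth s i.+1 - (nth s i).+1); rewrite mem_iota => /(_ _)/negP[].
    by lia.
  by rewrite (_ : _ + _ = nth s i.+1) ?mem_nth //; lia.
rewrite mem_iota add0n => /andP[_ hH]; apply/negP => /(nthP 0)[j js je].
have : nth s i < nth s j by rewrite je; lia.
have : nth s j < nth s i.+1 by rewrite je; lia.
by rewrite !monoP ?(ltnW iS) //; lia.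
Qed.

(** The members of [s] up to [N] form an initial segment of [s], so a count over integers becomes a
    count over the indices below the number of such members. *)
Lemma sum_isolated_count (N : nat) :
  \sum_(n < N) ((n.+1 \in s) && gap_after n.+1) =
  count (fun i => gap_after (nth s i)) (iota 0 (\sum_(n < N) (n.+1 \in s))).
Proof.
rewrite (sum_ord_count (fun n => (n.+1 \in s) && gap_after n.+1)).
transitivity (count gap_after [seq n <- iota 1 N | n \in s]).
  by rewrite count_filter (iotaDl 1 0) count_map; apply: eq_count => n /=; rewrite andbC.
rewrite filter_mem_iota filter_leq_sorted sum_mem_count.
have := count_size (leq^~ N) s; move: (count _ s) => c cs.
rewrite -(count_map (nth s) gap_after) map_nth_iota0 //.
Qed.

Definition large_gaps (X : nat) : nat :=
  count (fun i => (i < size s) && (nth s i.-1 + H < nth s i)) (iota 1 X).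

Lemma large_gapsE (X : nat) :
  large_gaps X = count (fun i => (i.+1 < size s) && (nth s i + H < nth s i.+1)) (iota 0 X).
Proof. by rewrite /large_gaps (iotaDl 1 0) count_map. Qed.

(** The strict inequality with [size s] guarantees that every element counted on the left has a
    successor in [s], as [large_gaps] demands. *)
Lemma large_gaps_ge (N X : nat) : \sum_(n < N) (n.+1 \in s) <= X ->
  \sum_(n < N) (n.+1 \in s) < size s ->
  \sum_(n < N) ((n.+1 \in s) && gap_after n.+1) <= large_gaps X.
Proof.
rewrite sum_isolated_count large_gapsE; move: (\sum_(n < N) _) => c cX cs.
rewrite -(subnKC cX) iotaD count_cat; apply: leq_trans (leq_addr _ _).
rewrite leq_eqVlt; apply/orP; left; apply/eqP/eq_in_count => i.
rewrite mem_iota add0n => ic; have iS : i.+1 < size s by apply: leq_ltn_trans cs.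
by rewrite iS isolated_nth.
Qed.

Lemma large_gaps_le (N X : nat) : X <= \sum_(n < N) (n.+1 \in s) ->
  large_gaps X <= \sum_(n < N) ((n.+1 \in s) && gap_after n.+1).
Proof.
rewrite sum_isolated_count large_gapsE; move: (\sum_(n < N) _) => c Xc.
rewrite -(subnKC Xc) iotaD count_cat; apply: leq_trans (leq_addr _ _).
by apply: sub_count => i /andP[iS]; rewrite isolated_nth.
Qed.

End SortedGaps.

(** * Sums over smooth integers *)

Section SmoothSums.
Variables (R : realFieldType) (f : nat -> R).
Hypotheses (f_ge0 : forall n, 0 <= f n) (f1 : f 1 = 1)
  (fM : forall p n, (0 < p)%N -> (0 < n)%N -> f (p * n) = f p * f n).

Lemma sum_multiples (F : nat -> R) (p N : nat) : (0 < p)%N ->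
  \sum_(1 <= m < N.+1 | (p %| m)%N) F m = \sum_(1 <= m < (N %/ p).+1) F (p * m)%N.
Proof.
move=> p_gt0; rewrite big_mkcond; elim: N => [|N IHN]; first by rewrite div0n !big_geq.
rewrite big_nat_recr //= IHN divnS //.
have [pN|npN] := boolP (p %| N.+1)%N; last by rewrite addr0 add0n.
rewrite add1n [RHS]big_nat_recr //=; congr (_ + F _).
by have := divnK pN; rewrite divnS // pN add1n mulnC.
Qed.

Definition smooth (s : seq nat) (n : nat) : bool := all (fun p => p \in s) (primes n).

Definition smooth_sum (s : seq nat) (N : nat) : R :=
  \sum_(1 <= m < N.+1 | smooth s m) f m.

Lemma smooth_consM (s : seq nat) (p m : nat) : prime p -> (0 < m)%N ->
  smooth (p :: s) (p * m) = smooth (p :: s) m.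
Proof.
move=> p_prime m_gt0; apply/allP/allP => sm q qm.
  by apply: sm; rewrite primesM ?(prime_gt0 p_prime) // qm orbT.
move: qm; rewrite primesM ?(prime_gt0 p_prime) // primes_prime // inE => /orP[/eqP ->|/sm //].
exact: mem_head.
Qed.

Lemma smooth_cons_ndvd (s : seq nat) (p m : nat) : prime p -> (0 < m)%N ->
  ~~ (p %| m)%N -> smooth (p :: s) m = smooth s m.
Proof.
move=> p_prime m_gt0 pm; apply/allP/allP => sm q qm; have := sm q qm;
  rewrite !inE; last by move=> ->; rewrite orbT.
case/orP => // /eqP qp; case/negP: pm; rewrite -qp.
by move: qm; rewrite mem_primes => /and3P[].
Qed.

Lemma sum_smooth_multiples (s : seq nat) (p N : nat) : prime p ->
  \sum_(1 <= m < N.+1 | smooth (p :: s) m && (p %| m)%N) f m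
  = f p * smooth_sum (p :: s) (N %/ p).
Proof.
move=> p_prime; under eq_bigl => m do rewrite andbC.
rewrite big_mkcondr sum_multiples ?prime_gt0 // big_distrr [RHS]big_mkcond /=.
apply: eq_big_nat => m /andP[m_gt0 _].
by rewrite smooth_consM // fM // prime_gt0.
Qed.

Lemma smooth_sum_mono (s : seq nat) (M N : nat) : (M <= N)%N ->
  smooth_sum s M <= smooth_sum s N.
Proof.
move=> MN; rewrite /smooth_sum [leRHS](@big_cat_nat _ _ _ M.+1) //=.
by rewrite ler_wpDr // sumr_ge0.
Qed.

(** Multiples of [p] contribute [f p] times a shorter sum. Solved for the new sum, this yields one
    factor [(1 - f p)^-1] of the Euler product without summing a geometric series. *)
Lemma smooth_sum_cons_le (s : seq nat) (p N : nat) : prime p ->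
  smooth_sum (p :: s) N <= smooth_sum s N + f p * smooth_sum (p :: s) N.
Proof.
move=> p_prime; rewrite {1}/smooth_sum (bigID (fun m => p %| m)%N) /=.
rewrite sum_smooth_multiples // addrC lerD //; last first.
  by rewrite ler_wpM2l // smooth_sum_mono // leq_div.
rewrite /smooth_sum big_mkcond [leRHS]big_mkcond /=.
rewrite big_seq [leRHS]big_seq; apply: ler_sum => m; rewrite mem_index_iota => /andP[m0 _].
have [pm|npm] := boolP (p %| m)%N; first by rewrite andbF; case: ifP.
by rewrite andbT smooth_cons_ndvd.
Qed.

(** As [p \notin s], the integers [m] and [p * m] with [m] smooth over [s] never coincide; the range
    must grow by the factor [p] to hold the second kind. *)
Lemma smooth_sum_cons_ge (s : seq nat) (p N : nat) : prime p -> p \notin s ->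
  smooth_sum s N * (1 + f p) <= smooth_sum (p :: s) (p * N).
Proof.
move=> p_prime ps; rewrite {2}/smooth_sum (bigID (fun m => p %| m)%N) /=.
rewrite sum_smooth_multiples // mulKn ?prime_gt0 // mulrDr mulr1.
rewrite addrC (mulrC _ (f p)); apply: lerD; last first.
  rewrite ler_wpM2l // /smooth_sum big_mkcond [leRHS]big_mkcond.
  apply: ler_sum => m _; case: ifP => // [/allP sm|_]; last by case: ifP.
  by rewrite ifT //; apply/allP => q /sm qs; rewrite inE qs orbT.
apply: (@le_trans _ _ (\sum_(1 <= m < (p * N).+1 | smooth s m) f m)).
  by apply: smooth_sum_mono; rewrite leq_pmull // prime_gt0.
rewrite big_mkcond [leRHS]big_mkcond big_seq [leRHS]big_seq.
apply: ler_sum => m; rewrite mem_index_iota => /andP[m0 _].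
have [pm|npm] := boolP (p %| m)%N; last by rewrite andbT smooth_cons_ndvd.
rewrite andbF; case: ifP => // /allP sm.
by case/negP: ps; apply: sm; rewrite mem_primes p_prime m0.
Qed.

Lemma smooth_nil (m : nat) : (0 < m)%N -> smooth [::] m = (m == 1%N).
Proof.
case: m => [|[|m]] // _; apply/allP => /(_ (pdiv m.+2)).
by rewrite mem_primes pdiv_prime // pdiv_dvd => /(_ isT).
Qed.

Lemma smooth_sum_nil (N : nat) : smooth_sum [::] N = ((0 < N)%N)%:R.
Proof.
case: N => [|N]; first by rewrite /smooth_sum big_geq.
rewrite /smooth_sum big_ltn_cond // smooth_nil //= f1 big_nat_cond big1 ?addr0 //.
by move=> m /andP[/andP[m1 _]]; rewrite smooth_nil ?gtn_eqF // ltnW.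
Qed.

Lemma smooth_sum_le_prod (s : seq nat) (N : nat) : all prime s ->
  all (fun p => f p < 1) s -> smooth_sum s N <= \prod_(p <- s) (1 - f p)^-1.
Proof.
elim: s => [_ _|p s IHs /= /andP[p_prime sp] /andP[fp sf]].
  by rewrite smooth_sum_nil big_nil; case: N.
rewrite big_cons mulrC ler_pdivlMr ?subr_gt0 //.
apply: le_trans (IHs sp sf); rewrite mulrBr mulr1 lerBlDr mulrC.
exact: smooth_sum_cons_le.
Qed.

Lemma prod_le_smooth_sum (s : seq nat) : all prime s -> uniq s ->
  \prod_(p <- s) (1 + f p) <= smooth_sum s (\prod_(p <- s) p).
Proof.
elim: s => [_ _|p s IHs /= /andP[p_prime sp] /andP[ps us]].
  by rewrite smooth_sum_nil !big_nil.
rewrite !big_cons mulrC; apply: le_trans (smooth_sum_cons_ge _ p_prime ps).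
by rewrite ler_wpM2r ?IHs // addr_ge0.
Qed.

End SmoothSums.

Definition primes_upto (N : nat) : seq nat := [seq p <- iota 0 N.+1 | prime p].

Lemma mem_primes_upto (N p : nat) : (p \in primes_upto N) = prime p && (p <= N)%N.
Proof. by rewrite mem_filter mem_iota add0n ltnS. Qed.

Lemma primes_upto_uniq (N : nat) : uniq (primes_upto N).
Proof. by rewrite filter_uniq ?iota_uniq. Qed.

(** Over all integers [n >= 2] the sum of [1/(n(n-1))] telescopes; the primes only omit terms. *)
Lemma sum_inv_prime_pred_le (R : realFieldType) (N : nat) :
  \sum_(p <- primes_upto N) (p%:R * (p%:R - 1))^-1 <= 1 :> R.
Proof.
case: N => [|N]; first by rewrite (_ : primes_upto 0 = [::]) // big_nil.
rewrite big_filter -[iota _ _]/(index_iota 0 N.+2) /= big_ltn_cond // big_ltn_cond //=.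
apply: (@le_trans _ _ (1 - N.+1%:R^-1)); last by rewrite gerBl invr_ge0.
elim: N => [|N IHN]; first by rewrite big_geq // invr1 subrr.
rewrite big_mkcond big_nat_recr //= -big_mkcond.
have N1 : N.+1%:R != 0 :> R by rewrite pnatr_eq0.
have N2 : N.+2%:R != 0 :> R by rewrite pnatr_eq0.
have e : (N.+2%:R * (N.+2%:R - 1))^-1 = N.+1%:R^-1 - N.+2%:R^-1 :> R.
  move: N1 N2; rewrite -[N.+2]addn1 natrD; set a := N.+1%:R => a0 a1.
  by clearbody a; rewrite addrK; field; rewrite a0 a1.
case: ifP => _; last first.
  rewrite addr0; apply: le_trans IHN _; rewrite lerB // lef_pV2 ?posrE ?ltr0n //.
  by rewrite ler_nat.
rewrite e; move: IHN; move: (\sum_(2 <= i < _ | _) _) (N.+1%:R^-1) (N.+2%:R^-1).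
by move=> u v v'; lra.
Qed.

(** * Normal integers followed by a gap *)

Section GapCount.
Variable R : realFieldType.

Definition prime_model_mean (s : seq nat) (f : nat -> R) : R :=
  bernoulli_mean (fun i : 'I_(size s) => (nth 0%N s i)%:R^-1) f.

(** The three terms are the rounding errors of small sets, the model's mass on sets using a prime
    twice, and the truncation tail with Rankin weight 16. *)
Definition correlation_error (s : seq nat) (k K N : nat) (tau : R) : R :=
  3 ^+ K * (tau ^- K * (1 + tau) ^+ (size s * k) / N%:R
    + k%:R ^+ 2 * (\sum_(p <- s) (p%:R^-1) ^+ 2) * (\prod_(p <- s) (1 + p%:R^-1)) ^+ k
    + 2 * (16 ^- K * (\prod_(p <- s) (1 + 16 * p%:R^-1)) ^+ k)).

Definition num_divisors_in (s : seq nat) (n : nat) : nat := count (fun p => p %| n)%N s.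

Lemma card_divisors_nth (s : seq nat) (n : nat) :
  #|[set i : 'I_(size s) | (nth 0%N s i %| n)%N]| = num_divisors_in s n.
Proof.
rewrite /num_divisors_in -sum1_card -sum1_count (big_nth 0%N) big_mkord.
by apply: eq_bigl => i; rewrite inE.
Qed.

Variable s : seq nat.
Hypotheses (s_prime : all prime s) (s_uniq : uniq s).

Let pr (i : 'I_(size s)) := nth 0%N s i.
Let pr_prime i : prime (pr i). Proof. exact: (allP s_prime) (mem_nth _ _). Qed.
Let pr_inj : injective pr.
Proof. by move=> i j /eqP; rewrite nth_uniq // => /eqP/val_inj. Qed.

Lemma seq_correlations (k N K : nat) (f : 'I_k -> nat -> R) (tau : R) :
  all (leq k) s -> (0 < N)%N -> 0 < tau <= 1 -> (forall h a, 0 <= f h a <= 1) ->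
  `|N%:R^-1 * \sum_(n < N) \prod_h f h (num_divisors_in s (n + h).+1)
    - \prod_h prime_model_mean s (f h)| <= correlation_error s k K N tau.
Proof.
move=> ks N_gt0 tau01 f01.
have k_le i : (k <= pr i)%N by apply: (allP ks); rewrite mem_nth.
have -> : \sum_(n < N) \prod_h f h (num_divisors_in s (n + h).+1) =
    \sum_(n < N) \prod_h f h #|[set i | (pr i %| (n + h).+1)%N]|.
  apply: eq_bigr => n _; apply: eq_bigr => h _.
  by rewrite -card_divisors_nth.
have := shift_correlations pr_prime pr_inj k_le N_gt0 K tau01 f01.
rewrite card_prod !card_ord.
have prodE (c : R) : \prod_(e : 'I_(size s) * 'I_k) (1 + c * (pr e.1)%:R^-1)
    = (\prod_(p <- s) (1 + c * p%:R^-1)) ^+ k.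
  rewrite -(pair_big xpredT xpredT (fun i _ => 1 + c * (pr i)%:R^-1)) /=.
  rewrite (big_nth 0%N) big_mkord -prodrXl; apply: eq_bigr => i _.
  by rewrite prodr_const card_ord.
have prodE1 : \prod_(e : 'I_(size s) * 'I_k) (1 + (pr e.1)%:R^-1)
    = (\prod_(p <- s) (1 + p%:R^-1)) ^+ k :> R.
  transitivity (\prod_(e : 'I_(size s) * 'I_k) (1 + 1 * (pr e.1)%:R^-1 : R)).
    by apply: eq_bigr => e _; rewrite mul1r.
  by rewrite prodE; congr (_ ^+ _); apply: eq_bigr => p _; rewrite mul1r.
rewrite prodE prodE1.
have -> : \sum_i (pr i)%:R^-1 ^+ 2 = \sum_(p <- s) (p%:R^-1) ^+ 2 :> R.
  by rewrite (big_nth 0%N) big_mkord.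
by [].
Qed.

Lemma sum_pow2_num_divisors_le (N : nat) :
  \sum_(n < N) 2 ^+ num_divisors_in s n.+1 <= N%:R * \prod_(p <- s) (1 + p%:R^-1) :> R.
Proof.
rewrite (big_nth 0%N) big_mkord.
apply: le_trans (sum_pow2_divisors_le R N pr_prime pr_inj).
by apply: ler_sum => n _; rewrite -card_divisors_nth.
Qed.

End GapCount.

Section NormalGaps.
Variables (R : realFieldType) (s t : seq nat) (B : nat) (L w : R) (m : nat).
Hypotheses (s_prime : all prime s) (s_uniq : uniq s)
  (t_prime : all prime t) (t_uniq : uniq t)
  (omega_split : forall n, (0 < n <= B)%N ->
     size (primes n) = (num_divisors_in s n + num_divisors_in t n)%N).

Definition in_window (v : R) (a : nat) : bool := `|a%:R - L| <= v.

Local Notation normal n := (in_window w (size (primes n))).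
Local Notation lo a := (in_window (w - m%:R) a).
Local Notation hi a := (in_window (w + m%:R) a).
Local Notation ds := (num_divisors_in s).
Local Notation dt := (num_divisors_in t).

Definition normal_gaps (N H : nat) : nat :=
  \sum_(n < N) (normal n.+1 && all (fun h => ~~ normal (n.+1 + h.+1)) (iota 0 H)).

(** The primes in [t] can only raise the count given by [s], and by at most [m], so moving both
    edges of the window by [m] traps normality. *)
Lemma window_sandwich (n : nat) : (0 < n <= B)%N -> (dt n <= m)%N ->
  (lo (ds n) ==> normal n) && (normal n ==> hi (ds n)).
Proof.
move=> nB tm; rewrite /in_window omega_split // natrD.
have tm' : 0 <= ((dt n)%:R : R) <= m%:R by rewrite ler0n ler_nat.
by apply/andP; split; apply/implyP; rewrite !ler_norml; lra.
Qed.

(** Markov's inequality for the exponential moment with base 2. *)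
Lemma exceptional_count_le (N : nat) :
  \sum_(n < N) (m < dt n.+1)%N%:R <= 2 ^- m * N%:R * \prod_(p <- t) (1 + p%:R^-1) :> R.
Proof.
rewrite -mulrA -ler_pdivrMl ?invr_gt0 ?exprn_gt0 // invrK.
apply: le_trans (sum_pow2_num_divisors_le R t_prime t_uniq N).
rewrite big_distrr /=; apply: ler_sum => n _.
case: leqP => mt; first by rewrite mulr0 exprn_ge0.
by rewrite mulr1 ler_eXn2l ?ltr1n // ltnW.
Qed.

Let bad (n H : nat) : bool := has (fun h => m < dt (n + h).+1)%N (iota 0 H.+1).

Lemma sum_bad_le (N H : nat) : \sum_(n < N) (bad n H)%:R
  <= H.+1%:R * (2 ^- m * (N + H)%:R * \prod_(p <- t) (1 + p%:R^-1)) :> R.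
Proof.
apply: (@le_trans _ _ (\sum_(n < N) \sum_(h < H.+1) (m < dt (n + h).+1)%N%:R)).
  apply: ler_sum => n _; rewrite /bad; case: hasP => [[h]|_]; last by rewrite sumr_ge0.
  rewrite mem_iota => /andP[_ hH] mt.
  by rewrite (bigD1 (Ordinal hH)) //= mt ler_wpDr // sumr_ge0.
rewrite exchange_big /= mulr_natl -[X in _ *+ X]card_ord -sumr_const.
(* Shifted by [h <= H], the block of [N] integers stays among the first [N + H], so one bound serves
   all shifts. *)
apply: ler_sum => h _; apply: le_trans (exceptional_count_le (N + H)).
pose F (n : nat) : R := (m < dt n.+1)%N%:R.
rewrite -[leLHS](_ : \sum_(h <= n < N + h) F n = _); last first.
  by rewrite -{1}[h : nat]add0n big_addn addnK big_mkord.
rewrite -(big_mkord xpredT F).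
have hNH : (N + h <= N + H)%N by rewrite leq_add2l -ltnS.
rewrite [leRHS](@big_cat_nat _ _ _ (N + h)) //= ler_wpDr ?sumr_ge0 //.
by rewrite [leRHS](@big_cat_nat _ _ _ h) ?leq_addl //= ler_wpDl ?sumr_ge0.
Qed.

(** For a lower bound the first integer must hit the narrow window and the following ones must miss
    the wide one; the upper bound swaps the two windows. *)
Let lower_event (H : nat) (h : 'I_H.+1) (a : nat) : R :=
  (if h == ord0 then lo a else ~~ hi a)%:R.
Let upper_event (H : nat) (h : 'I_H.+1) (a : nat) : R :=
  (if h == ord0 then hi a else ~~ lo a)%:R.

Lemma normal_gap_prod (N H n : nat) :
  (normal n.+1 && all (fun h => ~~ normal (n.+1 + h.+1)) (iota 0 H))%:R
  = \prod_(h < H.+1) (if h == ord0 then normal (n + h).+1 else ~~ normal (n + h).+1)%:R :> R.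
Proof.
rewrite big_ord_recl eqxx addn0 -mulnb natrM; congr (_ * _).
rewrite -big_all /= -(big_mkord xpredT (fun h => (~~ normal (n + h.+1).+1)%:R)).
rewrite /index_iota subn0; elim: (iota 0 H) => [|h l IHl]; first by rewrite !big_nil.
by rewrite !big_cons -IHl -mulnb natrM addSn.
Qed.

Lemma normal_gap_bounds (H n : nat) : (n + H < B)%N ->
  \prod_(h < H.+1) lower_event h (ds (n + h).+1) - (bad n H)%:R
  <= (normal n.+1 && all (fun h => ~~ normal (n.+1 + h.+1)) (iota 0 H))%:R
  <= \prod_(h < H.+1) upper_event h (ds (n + h).+1) + (bad n H)%:R.
Proof.
move=> nHB; rewrite (normal_gap_prod 0); case: (boolP (bad n H)) => [_|nbad].
  have p01 (P : 'I_H.+1 -> bool) : 0 <= \prod_h ((P h)%:R : R) <= 1.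
    rewrite prodr_ge0 //=; apply: prodr_ile1 => h _.
    by case: (P h); rewrite ?lexx ler01.
  rewrite /lower_event /upper_event lerBlDr; apply/andP; split.
    have /andP[_ h1] := p01 (fun h => if h == ord0 then lo (ds (n + h).+1) else ~~ hi (ds (n + h).+1)).
    have /andP[h2 _] := p01 (fun h : 'I_H.+1 => if h == ord0 then normal (n + h).+1 else ~~ normal (n + h).+1).
    by apply: le_trans h1 _; rewrite ler_wpDl.
  have /andP[_ h1] := p01 (fun h : 'I_H.+1 => if h == ord0 then normal (n + h).+1 else ~~ normal (n + h).+1).
  have /andP[h2 _] := p01 (fun h => if h == ord0 then hi (ds (n + h).+1) else ~~ lo (ds (n + h).+1)).
  by apply: le_trans h1 _; rewrite ler_wpDl.
rewrite subr0 addr0.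
have key (h : 'I_H.+1) : (lo (ds (n + h).+1) ==> normal (n + h).+1)
    && (normal (n + h).+1 ==> hi (ds (n + h).+1)).
  apply: window_sandwich; first by have := ltn_ord h; lia.
  rewrite leqNgt; apply: contra nbad => mt; apply/hasP; exists (h : nat) => //.
  by rewrite mem_iota /=.
rewrite /lower_event /upper_event; apply/andP; split; apply: ler_prod => h _;
  rewrite ler0n ler_nat; have := key h; case: (h == ord0);
  by case: (lo _); case: (in_window w _); case: (hi _).
Qed.

Local Notation mean f := (prime_model_mean s f).
Local Notation blo := (mean (fun a => (lo a)%:R)).
Local Notation bhi := (mean (fun a => (hi a)%:R)).

Lemma mean_compl (P : pred nat) :
  mean (fun a => (~~ P a)%:R) = 1 - mean (fun a => (P a)%:R) :> R.
Proof.
rewrite /prime_model_mean /bernoulli_mean.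
rewrite -[X in X - _](sum_bernoulli (fun i : 'I_(size s) => (nth 0%N s i)%:R^-1)) -sumrB.
by apply: eq_bigr => A _; case: (P _); rewrite /= ?mulr1 ?mulr0 ?subrr ?subr0.
Qed.

Lemma prod_mean_events (H : nat) (P Q : pred nat) :
  \prod_(h < H.+1) mean (fun a => (if h == ord0 then P a else ~~ Q a)%:R)
  = mean (fun a => (P a)%:R) * (1 - mean (fun a => (Q a)%:R)) ^+ H :> R.
Proof.
rewrite big_ord_recl /=; congr (_ * _); rewrite -mean_compl.
by rewrite prodr_const card_ord.
Qed.

Definition gap_error (N H K : nat) (tau : R) : R :=
  correlation_error s H.+1 K N tau
  + H.+1%:R * (2 ^- m * ((N + H)%:R / N%:R) * \prod_(p <- t) (1 + p%:R^-1)).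

Lemma normal_gaps_bounds (N H K : nat) (tau : R) :
  all (leq H.+1) s -> (0 < N)%N -> (N + H <= B)%N -> 0 < tau <= 1 ->
  blo * (1 - bhi) ^+ H - gap_error N H K tau
    <= (normal_gaps N H)%:R / N%:R
    <= bhi * (1 - blo) ^+ H + gap_error N H K tau.
Proof.
move=> Hs N_gt0 NHB tau01; rewrite /gap_error.
have N0 : 0 < N%:R^-1 :> R by rewrite invr_gt0 ltr0n.
have ev01 (P : 'I_H.+1 -> nat -> bool) h a : 0 <= ((P h a)%:R : R) <= 1.
  by case: (P h a); rewrite ?lexx ler01.
have := seq_correlations s_prime s_uniq K Hs N_gt0 tau01
  (ev01 (fun h a => if h == ord0 then lo a else ~~ hi a)).
have := seq_correlations s_prime s_uniq K Hs N_gt0 tau01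
  (ev01 (fun h a => if h == ord0 then hi a else ~~ lo a)).
rewrite !prod_mean_events !ler_distl => /andP[_ up] /andP[low _].
have badle := sum_bad_le N H.
have {}badle : N%:R^-1 * \sum_(n < N) (bad n H)%:R <=
    H.+1%:R * (2 ^- m * ((N + H)%:R / N%:R) * \prod_(p <- t) (1 + p%:R^-1)) :> R.
  apply: (@le_trans _ _ (N%:R^-1 * (H.+1%:R * (2 ^- m * (N + H)%:R * \prod_(p <- t) (1 + p%:R^-1))))).
    by rewrite ler_pM2l.
  by rewrite le_eqVlt; apply/orP; left; apply/eqP; ring.
rewrite /normal_gaps natr_sum [(\sum_(n < N) _) / N%:R]mulrC; apply/andP; split.
  apply: (@le_trans _ _ (N%:R^-1 * (\sum_(n < N) \prod_(h < H.+1) lower_event h (ds (n + h).+1)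
     - \sum_(n < N) (bad n H)%:R))).
    rewrite mulrBr; move: low badle; rewrite /lower_event; lra.
  rewrite ler_pM2l // -sumrB; apply: ler_sum => n _.
  have nHB : (n + H < B)%N by apply: leq_trans NHB; rewrite ltn_add2r.
  by have /andP[] := normal_gap_bounds nHB.
apply: (@le_trans _ _ (N%:R^-1 * (\sum_(n < N) \prod_(h < H.+1) upper_event h (ds (n + h).+1)
     + \sum_(n < N) (bad n H)%:R))).
  rewrite ler_pM2l // -big_split /=; apply: ler_sum => n _.
  have nHB : (n + H < B)%N by apply: leq_trans NHB; rewrite ltn_add2r.
  by have /andP[] := normal_gap_bounds nHB.
rewrite mulrDr; move: up badle; rewrite /upper_event; lra.
Qed.

End NormalGaps.

(** * Mertens-type bounds *)

From mathcomp Require Import all_classical all_reals all_analysis.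
Import numFieldNormedType.Exports.
Local Open Scope classical_set_scope.

Section MertensBounds.
Variable R : realType.
Implicit Types N n : nat.

Lemma ln_succ_bounds n : (0 < n)%N ->
  n.+1%:R^-1 <= ln n.+1%:R - ln n%:R :> R /\ ln n.+1%:R - ln n%:R <= n%:R^-1 :> R.
Proof.
move=> n_gt0; have n0 : 0 < n%:R :> R by rewrite ltr0n.
have n1 : 0 < n.+1%:R :> R by rewrite ltr0n.
split; last first.
  rewrite -ln_div ?posrE //.
  have -> : n.+1%:R / n%:R = 1 + n%:R^-1 :> R.
    by rewrite -[n.+1]addn1 natrD mulrDl divff ?gt_eqF // mul1r.
  by apply: le_ln1Dx; apply: lt_trans (_ : 0 < _); rewrite ?ltrN10 ?invr_gt0.
rewrite -opprB lerNr -ln_div ?posrE //.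
have -> : n%:R / n.+1%:R = 1 + (- n.+1%:R^-1) :> R.
  by rewrite -{1}[n%:R](addrK 1) natr1 mulrBl divff ?gt_eqF // mul1r.
by apply: le_ln1Dx; rewrite ltrN2 invf_lt1 // ltr1n.
Qed.

Lemma ln_le_harmonic N : ln N.+1%:R <= \sum_(1 <= m < N.+1) m%:R^-1 :> R.
Proof.
elim: N => [|N IHN]; first by rewrite ln1 big_geq.
rewrite big_nat_recr //=; have [_] := @ln_succ_bounds N.+1 isT.
by rewrite lerBlDl => h; apply: le_trans h _; apply: lerD.
Qed.

Definition inv_sum (s : seq nat) : R := \sum_(p <- s) p%:R^-1.

(** Euler's argument: the harmonic sum is at most the product of
    [(1 - 1/p)^-1 = 1 + 1/p + 1/(p(p-1))], hence at most the exponential of the sum of the last two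
    terms. The terms [1/(p(p-1))] account for the constant 1. *)
Lemma loglog_le_inv_sum N : (0 < N)%N ->
  ln (ln N.+1%:R) <= inv_sum (primes_upto N) + 1.
Proof.
move=> N_gt0; have lnN : 0 < ln N.+1%:R :> R by rewrite ln_gt0 // ltr1n.
rewrite -[leRHS]expRK ler_ln ?posrE ?expR_gt0 //.
apply: le_trans (ln_le_harmonic N) _.
pose f n : R := n%:R^-1.
have f_ge0 n : 0 <= f n by rewrite invr_ge0.
have fM p n : (0 < p)%N -> (0 < n)%N -> f (p * n)%N = f p * f n.
  by move=> _ _; rewrite /f natrM invfM.
have f1 : f 1%N = 1 by rewrite /f invr1.
have pr : all prime (primes_upto N).
  by apply/allP => p; rewrite mem_primes_upto => /andP[].
have -> : \sum_(1 <= m < N.+1) m%:R^-1 = smooth_sum f (primes_upto N) N.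
  rewrite /smooth_sum big_nat [RHS]big_nat_cond; apply: eq_bigl => m.
  rewrite ltnS; case: (boolP (1 <= m <= N)%N) => // /andP[m_gt0 mN] /=; apply/esym/allP => p.
  rewrite mem_primes mem_primes_upto => /and3P[-> _ /(dvdn_leq m_gt0) pm].
  exact: leq_trans pm mN.
have f_lt1 : all (fun p => f p < 1) (primes_upto N).
  apply/allP => p /(allP pr) /prime_gt1 p1.
  by rewrite /f invf_lt1 ?ltr1n // ltr0n ltnW.
apply: le_trans (smooth_sum_le_prod f_ge0 f1 fM N pr f_lt1) _.
apply: (@le_trans _ _ (\prod_(p <- primes_upto N) expR (p%:R^-1 + (p%:R * (p%:R - 1))^-1))).
  rewrite big_seq [leRHS]big_seq; apply: ler_prod => p /(allP pr) /prime_gt1 p1.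
  have p0 : 0 < p%:R :> R by rewrite ltr0n ltnW.
  have p10 : 0 < p%:R - 1 :> R by rewrite subr_gt0 ltr1n.
  have -> : (1 - f p)^-1 = 1 + (p%:R^-1 + (p%:R * (p%:R - 1))^-1).
    rewrite /f; field; rewrite !gt_eqF //=.
  rewrite expR_ge1Dx andbT addr_ge0 // addr_ge0 ?invr_ge0 ?ltW //.
  by rewrite mulr_gt0.
rewrite -expR_sum ler_expR big_split /= lerD2l.
exact: sum_inv_prime_pred_le.
Qed.

Section Rankin.
Variable eps : R.
Hypothesis eps_gt0 : 0 < eps.
Let f n : R := n%:R^-1 * expR (- (eps * ln n%:R)).

Let f_ge0 n : 0 <= f n. Proof. by rewrite mulr_ge0 ?invr_ge0 ?expR_ge0. Qed.
Let f1 : f 1%N = 1. Proof. by rewrite /f ln1 mulr0 oppr0 expR0 invr1 mulr1. Qed.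
Let fM p n : (0 < p)%N -> (0 < n)%N -> f (p * n)%N = f p * f n.
Proof.
move=> p0 n0; rewrite /f natrM lnM ?posrE ?ltr0n // invfM mulrDr opprD expRD.
by rewrite mulrACA.
Qed.

(** Comparison of the zeta sum at [1 + eps] with an integral, done by induction: the term at [m+1]
    is at most [(m^(-eps) - (m+1)^(-eps)) / eps]. *)
Lemma zeta_partial_le N : (0 < N)%N ->
  \sum_(1 <= m < N.+1) f m <= 1 + eps^-1 * (1 - expR (- (eps * ln N%:R))).
Proof.
case: N => // N _; elim: N => [|N IHN].
  by rewrite big_nat1 f1 ln1 mulr0 oppr0 expR0 subrr mulr0 addr0.
rewrite big_nat_recr //=; apply: le_trans (lerD IHN (lexx _)) _.
rewrite -addrA lerD2l -lerBrDl -mulrBr opprB addrC addrA subrK.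
rewrite mulrC ler_pdivlMr // /f.
have [h _] := @ln_succ_bounds N.+1 isT.
set d := _ - _ in h.
have -> : expR (- (eps * ln N.+1%:R)) = expR (- (eps * ln N.+2%:R)) * expR (eps * d).
  by rewrite -expRD; congr expR; rewrite /d; ring.
set g := expR (- _).
have g0 : 0 <= g by rewrite expR_ge0.
rewrite -[X in _ - X]mulr1 -mulrBr mulrC mulrA mulrC ler_wpM2l //.
rewrite lerBrDl; apply: le_trans (expR_ge1Dx _); rewrite lerD2l.
by rewrite ler_wpM2l // ltW.
Qed.

(** The product of [1 + f p] expands into distinct terms of the zeta sum at [1 + eps], so it is at
    most [1 + 1/eps]. Taking logarithms loses at most [f p ^ 2 <= 1/(p(p-1))] for each prime. *)
Lemma sum_rankin_le (s : seq nat) : all prime s -> uniq s ->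
  \sum_(p <- s) f p <= ln (1 + eps^-1) + \sum_(p <- s) (p%:R * (p%:R - 1))^-1.
Proof.
move=> pr us.
apply: (@le_trans _ _ (\sum_(p <- s) (ln (1 + f p) + (p%:R * (p%:R - 1))^-1))).
  rewrite big_seq [leRHS]big_seq; apply: ler_sum => p /(allP pr) /prime_gt1 p1.
  have fp : f p <= p%:R^-1.
    rewrite /f ler_piMr ?invr_ge0 // expR_le1 oppr_le0 mulr_ge0 ?(ltW eps_gt0) //.
    by rewrite ln_ge0 // ler1n ltnW.
  have p0 : 0 < p%:R :> R by rewrite ltr0n ltnW.
  have p10 : 0 < p%:R - 1 :> R by rewrite subr_gt0 ltr1n.
  have f2 : f p * f p <= (p%:R * (p%:R - 1))^-1.
    apply: (@le_trans _ _ (p%:R^-1 * p%:R^-1)); first by rewrite ler_pM.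
    rewrite -invfM lef_pV2 ?posrE ?mulr_gt0 // ler_pM2l // gerBl //.
  suff : f p - f p * f p <= ln (1 + f p) by move: f2; set z := _^-1; lra.
  have fpD : 0 < 1 + f p by rewrite ltr_pwDl.
  (* [ln v <= v - 1] at [v = 1/(1+u)] gives [ln (1+u) >= u/(1+u) >= u - u^2]. *)
  have : ln (1 + ((1 + f p)^-1 - 1)) <= (1 + f p)^-1 - 1.
    by apply: le_ln1Dx; rewrite ltrBrDl subrr invr_gt0.
  rewrite addrC subrK lnV ?posrE // -lerN2 opprK opprB; apply: le_trans.
  rewrite -(ler_pM2r fpD) [leRHS]mulrBl mulVf ?gt_eqF // mul1r.
  have := f_ge0 p; nra.
rewrite big_split /= lerD2r.
have -> : \sum_(p <- s) ln (1 + f p) = ln (\prod_(p <- s) (1 + f p)).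
  have : forall p, 0 < 1 + f p by move=> p; rewrite ltr_pwDl.
  elim: s {pr us} => [|p s IHs] f_gt; first by rewrite !big_nil ln1.
  by rewrite !big_cons lnM ?posrE ?IHs ?prodr_gt0.
rewrite ler_ln ?posrE ?prodr_gt0 //; last first.
- by rewrite addr_gt0 ?invr_gt0.
- by move=> p _; rewrite ltr_pwDl.
apply: le_trans (prod_le_smooth_sum f_ge0 f1 fM pr us) _.
have s_gt0 : (0 < \prod_(p <- s) p)%N.
  rewrite big_seq prodn_cond_gt0 // => p /(allP pr); exact: prime_gt0.
apply: (@le_trans _ _ (\sum_(1 <= m < (\prod_(p <- s) p).+1) f m)).
  rewrite /smooth_sum big_mkcond; apply: ler_sum => m _; case: ifP => //.
apply: le_trans (zeta_partial_le s_gt0) _; rewrite lerD2l.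
by rewrite ler_piMr ?invr_ge0 ?(ltW eps_gt0) // gerBl expR_ge0.
Qed.

End Rankin.

(* Rankin's trick: [1/p <= e^eta p^(-1-eps)] for [p <= N] when [eps = eta / ln N]. *)
Lemma inv_sum_le N (eta : R) : (1 < N)%N -> 0 < eta ->
  inv_sum (primes_upto N) <= expR eta * (ln (1 + ln N%:R / eta) + 1).
Proof.
move=> N1 eta0; have lnN : 0 < ln N%:R :> R by rewrite ln_gt0 // ltr1n.
pose eps := eta / ln N%:R; have eps0 : 0 < eps by rewrite divr_gt0.
have pr : all prime (primes_upto N).
  by apply/allP => p; rewrite mem_primes_upto => /andP[].
apply: (@le_trans _ _ (expR eta *
   \sum_(p <- primes_upto N) (p%:R^-1 * expR (- (eps * ln p%:R))))).
  rewrite big_distrr /= /inv_sum big_seq [leRHS]big_seq; apply: ler_sum => p.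
  rewrite mem_primes_upto => /andP[/prime_gt0 p0 pN].
  rewrite mulrCA ler_peMr ?invr_ge0 // -expRD.
  apply: le_trans (expR_ge1Dx _); rewrite lerDl subr_ge0.
  rewrite /eps mulrAC ler_pdivrMr // ler_pM2l // ler_ln ?posrE ?ltr0n ?ler_nat //.
  exact: ltnW.
rewrite ler_wpM2l ?expR_ge0 //.
apply: le_trans (sum_rankin_le eps0 pr (primes_upto_uniq N)) _.
by rewrite /eps invf_div lerD2l sum_inv_prime_pred_le.
Qed.

End MertensBounds.

(** * Stirling's formula *)

Section Monotonicity.
Variable R : realType.

Lemma is_derive_ge0_le (f df : R -> R) (a b : R) : a <= b ->
  (forall x, a <= x <= b -> is_derive x 1 f (df x)) ->
  (forall x, a <= x <= b -> 0 <= df x) -> f a <= f b.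
Proof.
move=> ab fdf df0.
have cf : {within `[a, b], continuous f}.
  apply: derivable_within_continuous => x; rewrite in_itv /= => xab.
  by have := fdf x xab => -[].
have [|c cab e] := @MVT_segment R f df a b ab _ cf.
  move=> x; rewrite in_itv /= => /andP[ax xb].
  by apply: fdf; rewrite !ltW.
by rewrite -subr_ge0 e mulr_ge0 ?subr_ge0 // df0.
Qed.

Lemma ln_le_sub1 (y : R) : 0 < y -> ln y <= y - 1.
Proof.
move=> y0; have := @le_ln1Dx R (y - 1); rewrite [1 + _]addrC subrK; apply.
by rewrite ltrBrDl subrr.
Qed.

(** The trapezoidal rule overestimates the integral of the convex function [1/t] from 1 to [y]; the
    midpoint rule of [ln_ge_midpoint] underestimates it. Together they control one step of the
    Stirling remainder. *)
Lemma ln_le_trapezoid (y : R) : 1 <= y -> 2 * y * ln y <= y ^+ 2 - 1.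
Proof.
move=> y1; rewrite -subr_ge0.
pose f : R -> R := (@GRing.exp R ^~ 2) - cst 1 - 2 \*: (id * @ln R).
have -> : y ^+ 2 - 1 - 2 * y * ln y = f y.
  by rewrite /f !fctE /= /GRing.scale /= mulrA.
have -> : 0 = f 1 by rewrite /f !fctE /= ln1 mulr0 scaler0 expr1n subrr subr0.
apply: (@is_derive_ge0_le f (fun x => 2 * x - 2 * (1 + ln x)) 1 y y1) => x /andP[x1 xy].
  have x0 : 0 < x by rewrite (lt_le_trans _ x1).
  have := is_derive1_ln x0 => ?.
  rewrite /f; apply: is_derive_eq; rewrite /GRing.scale /=.
  by field; rewrite gt_eqF.
have x0 : 0 < x by rewrite (lt_le_trans _ x1).
have := ln_le_sub1 x0; lra.
Qed.

Lemma ln_ge_midpoint (y : R) : 1 <= y -> 2 * (y - 1) <= (y + 1) * ln y.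
Proof.
move=> y1; rewrite -subr_ge0.
pose f : R -> R := (id + cst 1) * @ln R - 2 \*: (id - cst 1).
have -> : (y + 1) * ln y - 2 * (y - 1) = f y by rewrite /f !fctE.
have -> : 0 = f 1 by rewrite /f !fctE /= ln1 mulr0 subrr scaler0 subr0.
apply: (@is_derive_ge0_le f (fun x => ln x + x^-1 - 1) 1 y y1) => x /andP[x1 xy].
  have x0 : 0 < x by rewrite (lt_le_trans _ x1).
  have := is_derive1_ln x0 => ?.
  rewrite /f; apply: is_derive_eq; rewrite !fctE /GRing.scale /=.
  by field; rewrite gt_eqF.
have x0 : 0 < x by rewrite (lt_le_trans _ x1).
have : ln x^-1 <= x^-1 - 1 by apply: ln_le_sub1; rewrite invr_gt0.
rewrite lnV ?posrE //; lra.
Qed.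

End Monotonicity.

Section Stirling.
Variable R : realType.

(* Antiderivatives of the powers of [sin], by the usual reduction formula. *)
Fixpoint sin_power_prim (n : nat) : R -> R :=
  match n with
  | 0 => id
  | 1 => - @cos R
  | (m.+1 as m').+1 =>
      m'.+1%:R^-1 \*: (m'%:R \*: sin_power_prim m - @cos R * @sin R ^+ m')
  end.

Lemma is_derive_sin_power_prim (n : nat) (x : R) :
  is_derive x 1 (sin_power_prim n) (sin x ^+ n).
Proof.
suff [] : is_derive x 1 (sin_power_prim n) (sin x ^+ n) /\
    is_derive x 1 (sin_power_prim n.+1) (sin x ^+ n.+1) by [].
elim: n => [|n [IHn IHn1]]; split => //=.
- by rewrite expr0; exact: is_derive_id.
- by rewrite expr1; apply: is_derive_eq; rewrite opprK.
apply: is_derive_eq; rewrite !fctE /GRing.scale /=.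
have cs : cos x * cos x + sin x * sin x = 1 by rewrite -!expr2 cos2Dsin2.
have n0 : n.+2%:R != 0 :> R by rewrite pnatr_eq0.
apply: (mulfI n0); rewrite mulVKf // !exprS -[n.+2%:R]natr1.
move: cs; move: (cos x) (sin x) (sin x ^+ n) (n.+1%:R : R) => c s p a cs.
apply/eqP; rewrite -subr_eq0.
set u := (X in X == 0); have -> : u = a * p * (1 - (c * c + s * s)) by rewrite /u; ring.
by rewrite cs subrr mulr0.
Qed.

(** The integral of [sin^n] over [[0, pi/2]], expressed by an antiderivative. *)
Definition wallis (n : nat) : R := sin_power_prim n (pi / 2) - sin_power_prim n 0.

Lemma wallis0 : wallis 0 = pi / 2. Proof. by rewrite /wallis /= subr0. Qed.

Lemma wallis1 : wallis 1 = 1.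
Proof. by rewrite /wallis /= !fctE cos_pihalf cos0 oppr0 sub0r opprK. Qed.

Lemma wallisSS (n : nat) : wallis n.+2 = n.+1%:R / n.+2%:R * wallis n.
Proof.
rewrite /wallis /= !fctE /GRing.scale /= cos_pihalf sin0 mul0r expr0n mulr0 !subr0.
move: (sin_power_prim n 0) (sin_power_prim n (pi / 2)) (n.+2%:R^-1 : R) (n.+1%:R : R).
by move=> a b c d; rewrite -[d *: b]/(d * b) -[d *: a]/(d * a); ring.
Qed.

Lemma wallis_le (n : nat) : wallis n.+1 <= wallis n.
Proof.
have pi0 : 0 <= pi / 2 :> R by rewrite divr_ge0 ?pi_ge0.
have := @is_derive_ge0_le R (sin_power_prim n - sin_power_prim n.+1)
  (fun x => sin x ^+ n - sin x ^+ n.+1) 0 (pi / 2) pi0.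
have h (x : R) : is_derive x 1 (sin_power_prim n - sin_power_prim n.+1)
    (sin x ^+ n - sin x ^+ n.+1).
  by have := is_derive_sin_power_prim n x; have := is_derive_sin_power_prim n.+1 x;
     move=> ? ?; apply: is_deriveB.
move=> /(_ (fun x _ => h x)); rewrite /wallis !fctE => H.
suff : 0 <= wallis n - wallis n.+1 by rewrite subr_ge0.
have : forall x : R, 0 <= x <= pi / 2 -> 0 <= sin x ^+ n - sin x ^+ n.+1.
  move=> x /andP[x0 xpi]; have s0 : 0 <= sin x.
    apply: sin_ge0_pi; rewrite x0 (le_trans xpi) //.
    by rewrite ler_pdivrMr // ler_peMr ?pi_ge0 // ler1n.
  by rewrite exprS -{1}[sin x ^+ n]mul1r -mulrBl mulr_ge0 ?exprn_ge0 // subr_ge0 sin_le1.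
by move=> /H; rewrite /wallis; lra.
Qed.

Lemma wallis_mul (n : nat) : wallis n * wallis n.+1 = pi / 2 / n.+1%:R.
Proof.
elim: n => [|n IHn]; first by rewrite wallis0 wallis1 mulr1 divr1.
rewrite wallisSS mulrCA [_ * wallis n]mulrC IHn.
have n1 : n.+1%:R != 0 :> R by rewrite pnatr_eq0.
by move: n1; move: (n.+1%:R : R) (n.+2%:R^-1 : R) => v w v0; field.
Qed.

Lemma wallis_even (n : nat) :
  wallis n.*2 = pi / 2 * (n.*2`!%:R / (4 ^+ n * n`!%:R ^+ 2)).
Proof.
elim: n => [|n IHn]; first by rewrite double0 wallis0 fact0 expr0 expr1n mulr1 divr1 mulr1.
rewrite doubleS wallisSS IHn !factS !natrM [4 ^+ n.+1]exprS.
have f0 : n`!%:R != 0 :> R by rewrite pnatr_eq0 -lt0n fact_gt0.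
have g0 : 4 ^+ n != 0 :> R by rewrite expf_neq0 // pnatr_eq0.
have -> : n.*2.+2%:R = 2 * n.+1%:R :> R by rewrite -doubleS -mul2n natrM.
have n1 : n.+1%:R != 0 :> R by rewrite pnatr_eq0.
move: (n.*2.+1%:R : R) (n.+1%:R : R) n1 (n`!%:R : R) f0 (4 ^+ n : R) g0 (n.*2`!%:R : R).
by move=> u v v0 f f0 g g0 w; field; rewrite f0 g0 v0.
Qed.

Lemma wallis_gt0 (n : nat) : 0 < wallis n.*2.
Proof.
by rewrite wallis_even !mulr_gt0 ?invr_gt0 ?mulr_gt0 ?pi_gt0 ?exprn_gt0 ?ltr0n ?fact_gt0.
Qed.

(* Expected limit [ln (2 * pi) / 2]. It is approached by [2 r(n) - r(2n)], which Wallis'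
   product evaluates, while [r(n) - r(2n)] telescopes. *)
Definition stirling_rem (n : nat) : R :=
  ln n`!%:R - (n%:R + 2^-1) * ln n%:R + n%:R.

(** Consecutive remainders differ by [(m + 1/2) ln (1 + 1/m) - 1]. The midpoint rule makes this
    nonnegative and the trapezoidal rule bounds it by [1/(4m(m+1))], which telescopes. *)
Lemma stirling_remB (n k : nat) : (0 < n)%N ->
  0 <= stirling_rem n - stirling_rem (n + k)
    <= 4^-1 * (n%:R^-1 - (n + k)%:R^-1).
Proof.
move=> n_gt0; elim: k => [|k IHk]; first by rewrite addn0 !subrr mulr0 lexx.
rewrite addnS; have m_gt0 : (0 < n + k)%N by rewrite ltn_addr.
move: (n + k)%N m_gt0 IHk => m m_gt0 IHk.
suff : 0 <= stirling_rem m - stirling_rem m.+1 <= 4^-1 * (m%:R^-1 - m.+1%:R^-1).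
  move: IHk; move: (n%:R^-1) (m%:R^-1) (m.+1%:R^-1) (stirling_rem _) (stirling_rem _).
  move=> a b c d e /andP[? ?] /andP[? ?]; apply/andP; lra.
have m0 : 0 < m%:R :> R by rewrite ltr0n.
have m10 : 0 < m.+1%:R :> R by rewrite ltr0n.
have em : m.+1%:R = m%:R + 1 :> R by rewrite -natr1.
pose y : R := m.+1%:R / m%:R.
have y1 : 1 <= y by rewrite /y ler_pdivlMr // mul1r ler_nat.
have lny : ln y = ln m.+1%:R - ln m%:R by rewrite ln_div ?posrE.
have -> : stirling_rem m - stirling_rem m.+1 = (m%:R + 2^-1) * ln y - 1.
  rewrite /stirling_rem factS natrM lnM ?posrE ?ltr0n ?fact_gt0 // lny em.
  set l1 := ln _; set l2 := ln _; set l3 := ln _; lra.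
have h1 := ln_le_trapezoid y1; have h2 := ln_ge_midpoint y1.
have my : m%:R * y = m%:R + 1 by rewrite /y mulrCA divff ?gt_eqF // mulr1 em.
have {}h2 : 2 <= (2 * m%:R + 1) * ln y.
  rewrite [leLHS](_ : 2 = m%:R * (2 * (y - 1))); last by lra.
  rewrite [leRHS](_ : _ = m%:R * ((y + 1) * ln y)); last by rewrite mulrA mulrDr my; lra.
  by rewrite ler_wpM2l // ltW.
have {}h1 : 2 * m%:R * (m%:R + 1) * ln y <= 2 * m%:R + 1.
  rewrite [leRHS](_ : _ = m%:R * m%:R * (y ^+ 2 - 1)); last first.
    rewrite mulrBr mulr1 expr2 mulrACA my; lra.
  rewrite [leLHS](_ : _ = m%:R * m%:R * (2 * y * ln y)); last first.
    rewrite -my; ring.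
  by rewrite ler_wpM2l // mulr_ge0 // ltW.
apply/andP; split; first by lra.
rewrite em; have -> : 4^-1 * (m%:R^-1 - (m%:R + 1)^-1) = (4 * m%:R * (m%:R + 1))^-1 :> R.
  by field; rewrite -em !gt_eqF.
rewrite -(ler_pM2l (_ : 0 < 4 * m%:R * (m%:R + 1))); last by rewrite !mulr_gt0 // -em.
rewrite divff; last by rewrite gt_eqF // !mulr_gt0 // -em.
move: m0 h1 h2; move: (m%:R : R) (ln y) => a l; nra.
Qed.

Lemma stirling_rem_double (n : nat) : (0 < n)%N ->
  2 * stirling_rem n - stirling_rem n.*2
  = 2^-1 * (ln (2 * pi) - ln (4 * n%:R * wallis n.*2 ^+ 2 / pi)).
Proof.
move=> n_gt0; have n0 : 0 < n%:R :> R by rewrite ltr0n.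
have pi0 := pi_gt0 R; have w0 := wallis_gt0 n.
have f0 m : 0 < m`!%:R :> R by rewrite ltr0n fact_gt0.
have lw : ln (wallis n.*2) = ln pi - ln 2 + ln n.*2`!%:R - (2 * n%:R * ln 2 + 2 * ln n`!%:R).
  rewrite wallis_even lnM ?posrE ?divr_gt0 ?mulr_gt0 ?exprn_gt0 //.
  rewrite !ln_div ?posrE ?mulr_gt0 ?exprn_gt0 // lnM ?posrE ?exprn_gt0 //.
  have -> : 4 = 2 ^+ 2 :> R by rewrite expr2; lra.
  rewrite -exprM !lnXn // -[ln 2 *+ _]mulr_natl -[ln n`!%:R *+ _]mulr_natl natrM; lra.
rewrite ln_div ?posrE ?mulr_gt0 ?exprn_gt0 // !lnM ?posrE ?mulr_gt0 ?exprn_gt0 //.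
have -> : 4 = 2 ^+ 2 :> R by rewrite expr2; lra.
rewrite !lnXn // lw /stirling_rem -mul2n natrM lnM ?posrE //.
rewrite -[ln 2 *+ _]mulr_natl.
move: (ln _) (ln _) (ln _) (ln _) (ln _) => a b c d e; lra.
Qed.

Lemma stirling (n : nat) : (0 < n)%N ->
  `|stirling_rem n - 2^-1 * ln (2 * pi)| <= (4 * n%:R)^-1.
Proof.
move=> n_gt0; have n0 : 0 < n%:R :> R by rewrite ltr0n.
have pi0 := pi_gt0 R; have w0 := wallis_gt0 n.
have := @stirling_remB n n n_gt0; rewrite addnn => /andP[d0 d1].
have := stirling_rem_double n_gt0; set t := _ / pi => e.
have nE : n.*2.+1%:R = 2 * n%:R + 1 :> R by rewrite -natr1 -mul2n natrM.
have nE2 : n.*2.+2%:R = 2 * n%:R + 2 :> R by rewrite -natr1 nE; lra.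
(* Monotonicity and the product formula squeeze [t] between [2n/(2n+1)] and 1. Hence
   [2 r(n) - r(2n)] exceeds [ln (2 pi) / 2] by at most [1/(4n)], while [r(n) - r(2n)] lies between 0
   and [1/(8n)]. *)
have w1 : wallis n.*2 * wallis n.*2.+1 <= wallis n.*2 ^+ 2.
  by rewrite expr2 ler_pM2l // wallis_le.
have w2 : wallis n.*2 * wallis n.*2.+2 <= wallis n.*2 * wallis n.*2.+1.
  by rewrite ler_pM2l // wallis_le.
rewrite wallis_mul in w1 w2; rewrite wallisSS in w2.
have a1 : 0 < 2 * n%:R + 1 :> R by lra.
have a2 : 0 < 2 * n%:R + 2 :> R by lra.
have t1 : t <= 1.
  rewrite /t ler_pdivrMr // mul1r.
  have h : wallis n.*2 ^+ 2 * (2 * n%:R + 1) ^+ 2 <= pi * (n%:R + 1).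
    move: w2; rewrite nE nE2 ler_pdivlMr //; set W := wallis n.*2 => w2.
    rewrite -(ler_pM2l (_ : 0 < (2 * n%:R + 2)^-1)) ?invr_gt0 //.
    apply: le_trans (_ : pi / 2 <= _); last first.
      by rewrite le_eqVlt; apply/orP; left; apply/eqP; field; rewrite gt_eqF //; lra.
    apply: le_trans w2; rewrite le_eqVlt; apply/orP; left; apply/eqP.
    by field; rewrite gt_eqF //; lra.
  rewrite -(ler_pM2r (exprn_gt0 2 a1)).
  apply: (@le_trans _ _ (4 * n%:R * (pi * (n%:R + 1)))).
    by rewrite -[leLHS]mulrA ler_pM2l // mulr_gt0.
  have : 4 * n%:R * (n%:R + 1) <= (2 * n%:R + 1) ^+ 2 :> R by rewrite expr2; lra.
  rewrite -(ler_pM2l pi0) => h'; apply: le_trans h'.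
  by rewrite le_eqVlt; apply/orP; left; apply/eqP; ring.
have t2 : 2 * n%:R / (2 * n%:R + 1) <= t.
  rewrite nE in w1; rewrite /t ler_pdivlMr //.
  apply: le_trans (_ : 4 * n%:R * (pi / 2 / (2 * n%:R + 1)) <= _); last first.
    by rewrite ler_pM2l // mulr_gt0.
  by rewrite le_eqVlt; apply/orP; left; apply/eqP; field; rewrite gt_eqF.
have t0 : 0 < t by rewrite /t !mulr_gt0 ?invr_gt0 ?exprn_gt0.
have lt1 : ln t <= 0 by apply: ln_le0.
have lt2 : - ln t <= (2 * n%:R)^-1.
  rewrite -lnV ?posrE //; apply: le_trans (ln_le_sub1 _) _; first by rewrite invr_gt0.
  have : t^-1 <= (2 * n%:R / (2 * n%:R + 1))^-1.
    by rewrite lef_pV2 ?posrE // divr_gt0 // mulr_gt0.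
  have -> : (2 * n%:R / (2 * n%:R + 1))^-1 = 1 + (2 * n%:R)^-1 :> R.
    by field; rewrite !gt_eqF.
  lra.
have i2 : (2 * n%:R)^-1 = 2 * (4 * n%:R)^-1 :> R by field; rewrite gt_eqF.
have i1 : n%:R^-1 = 4 * (4 * n%:R)^-1 :> R by field; rewrite gt_eqF.
have i3 : 0 < (4 * n%:R)^-1 :> R by rewrite invr_gt0 mulr_gt0.
move: d1; rewrite -mul2n natrM i1 i2 in lt2 *; rewrite mul2n => d1.
rewrite ler_norml; apply/andP; split; lra.
Qed.

End Stirling.

(** * Local probabilities of sums of Bernoulli variables *)

Section PoissonLocal.
Variable R : realType.

Definition poisson_pt (T : R) (a : nat) : R := expR (- T) * (T ^+ a / a`!%:R).

(** By Stirling the product is the exponential of [a - T - a ln (a/T)] up to [1/(4a)]. Applying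
    [ln v <= v - 1] to [T/a] and to [a/T] puts this exponent between [-(a-T)^2/T] and 0. *)
Lemma poisson_pt_bounds (T : R) (a : nat) : 0 < T -> (0 < a)%N ->
  expR (- ((4 * a%:R)^-1 + (a%:R - T) ^+ 2 / T)) <=
    poisson_pt T a * Num.sqrt (2 * pi * a%:R) <= expR ((4 * a%:R)^-1).
Proof.
move=> T0 a_gt0; have a0 : 0 < a%:R :> R by rewrite ltr0n.
have p0 := pi_gt0 R.
have f0 : 0 < a`!%:R :> R by rewrite ltr0n fact_gt0.
have sqrtE : Num.sqrt (2 * pi * a%:R) = expR (2^-1 * (ln (2 * pi) + ln a%:R)) :> R.
  rewrite -lnM ?posrE ?mulr_gt0 // -powR12_sqrt ?mulr_ge0 ?ltW //.
  by rewrite /powR gt_eqF ?mulr_gt0 //.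
have -> : poisson_pt T a * Num.sqrt (2 * pi * a%:R) =
    expR ((a%:R - T + a%:R * ln (T / a%:R)) - (stirling_rem R a - 2^-1 * ln (2 * pi))).
  rewrite /poisson_pt sqrtE -[T ^+ a]lnK ?posrE ?exprn_gt0 // -[X in _ / X]lnK ?posrE //.
  rewrite -expRN -!expRD; congr expR; rewrite lnXn // ln_div ?posrE // /stirling_rem.
  rewrite -[(ln _) *+ _]mulr_natl; lra.
rewrite !ler_expR.
have := stirling R a_gt0; rewrite ler_norml => /andP[s1 s2].
have h1 : ln (T / a%:R) <= T / a%:R - 1 by apply: ln_le_sub1; rewrite divr_gt0.
have h2 : ln (a%:R / T) <= a%:R / T - 1 by apply: ln_le_sub1; rewrite divr_gt0.
have {}h1 : a%:R * ln (T / a%:R) <= T - a%:R.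
  apply: le_trans (_ : a%:R * (T / a%:R - 1) <= _); first by rewrite ler_pM2l.
  by rewrite mulrBr mulrCA divff ?gt_eqF // !mulr1.
have {}h2 : - (a%:R * ln (T / a%:R)) <= a%:R * (a%:R / T - 1).
  by rewrite -mulrN ler_pM2l // -lnV ?posrE ?divr_gt0 // invf_div.
have e : (a%:R - T) ^+ 2 / T = a%:R * (a%:R / T - 1) - (a%:R - T).
  by field; rewrite gt_eqF.
apply/andP; split; lra.
Qed.

Variables (I : finType) (x : I -> R) (rho : R).
Hypotheses (rho_ge0 : 0 <= rho) (x_bounds : forall i, 0 <= x i <= rho) (rho_le : rho <= 2^-1).

Definition bernoulli_pt (a : nat) : R := \sum_(s : {set I} | #|s| == a) bernoulli x s.

Let S := \sum_i x i.
Let y i := x i / (1 - x i).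
Let T := \sum_i y i.

Let x_ge0 i : 0 <= x i. Proof. by case/andP: (x_bounds i). Qed.
Let x_le i : x i <= rho. Proof. by case/andP: (x_bounds i). Qed.
Let x_le_half i : x i <= 2^-1. Proof. exact: le_trans (x_le i) rho_le. Qed.
Let x_lt1 i : 0 < 1 - x i. Proof. have := x_le_half i; lra. Qed.
Let y_ge0 i : 0 <= y i. Proof. by rewrite divr_ge0 // ltW. Qed.

Let y_bounds i : x i <= y i <= x i * (1 + 2 * rho).
Proof.
have := x_ge0 i; have := x_le_half i; have := x_lt1 i; have := x_le i => h1 h2 h3 h4.
rewrite /y ler_pdivlMr // ler_pdivrMr // -mulrA.
by apply/andP; split; [nra | rewrite ler_peMr //; nra].
Qed.

Let prod_1x : expR (- T) <= \prod_i (1 - x i) <= expR (- S).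
Proof.
have expE (u : I -> R) : expR (- \sum_i u i) = \prod_i expR (- u i).
  by rewrite -sumrN expR_sum.
rewrite /T /S !expE; apply/andP; split; apply: ler_prod => i _; apply/andP; split.
- exact: expR_ge0.
- rewrite expRN -[leRHS]invrK lef_pV2 ?posrE ?expR_gt0 ?invr_gt0 //.
  apply: le_trans (expR_ge1Dx _); rewrite /y le_eqVlt; apply/orP; left; apply/eqP.
  by field; rewrite gt_eqF.
- by rewrite ltW.
- exact: expR_ge1Dx.
Qed.

(** The odds [y] carry the elementary symmetric function, but the product of [1 - x i] is only
    bounded by [exp(-S)]; the factor [expR (T - S)] records the mismatch. *)
Lemma bernoulli_pt_le (a : nat) : bernoulli_pt a <= expR (T - S) * poisson_pt T a.
Proof.
rewrite /bernoulli_pt sum_bernoulli_card; last by move=> i; rewrite -subr_gt0.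
rewrite /poisson_pt mulrA -expRD (_ : T - S - T = - S); last by lra.
case/andP: prod_1x => _ h; apply: ler_pM => //.
- by apply: prodr_ge0 => i _; rewrite ltW.
- exact: elem_sym_ge0.
- exact: elem_sym_le.
Qed.

(** Since [rho <= 1/2], the odds are at most [2 rho], so choosing [a] distinct indices costs at most
    [a * (2 * rho)] of the total. The leading exponential compensates for the lowered Poisson
    parameter. *)
Lemma bernoulli_pt_ge (a : nat) : a%:R * (2 * rho) <= T ->
  expR (- (a%:R * (2 * rho))) * poisson_pt (T - a%:R * (2 * rho)) a <= bernoulli_pt a.
Proof.
move=> aT; rewrite /bernoulli_pt sum_bernoulli_card; last by move=> i; rewrite -subr_gt0.
rewrite /poisson_pt mulrA -expRD (_ : _ + - (T - _) = - T); last by lra.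
case/andP: prod_1x => h _; apply: ler_pM => //.
- by rewrite mulr_ge0 ?invr_ge0 ?exprn_ge0 // subr_ge0.
apply: elem_sym_ge => //; last first.
- by rewrite mulr_ge0.
move=> i; case/andP: (y_bounds i) => _ /le_trans; apply.
have := x_ge0 i; have := x_le i; have := rho_le; nra.
Qed.

(** In units of [u^2/L] the exponent collects at most 10 from the quadratic term, 1 from Stirling
    and 1 from replacing [a] by [L] under the root; 13 leaves room. The [rho] terms amount to at
    most [5/2 rho L], since [S] and [a] are at most [5/4 L]. *)
Lemma bernoulli_pt_local (L u : R) (a : nat) :
  1 <= u -> 4 * u <= L -> 8 * rho * L <= 1 -> `|S - L| <= u -> `|a%:R - L| <= u ->
  expR (- (13 * u ^+ 2 / L + 4 * rho * L)) <= bernoulli_pt a * Num.sqrt (2 * pi * L)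
    <= expR (13 * u ^+ 2 / L + 4 * rho * L).
Proof.
move=> u1 uL rhoL; rewrite !ler_norml => /andP[S1 S2] /andP[a1 a2].
have L0 : 0 < L by lra.
have a0 : 0 < a%:R :> R by lra.
have a_gt0 : (0 < a)%N by rewrite -(ltr0n R).
have ST : S <= T by apply: ler_sum => i _; case/andP: (y_bounds i).
have TS : T <= S + 2 * rho * S.
  rewrite -[X in X + _]mulr1 [X in _ + X]mulrC -mulrDr /S big_distrl /=.
  by apply: ler_sum => i _; case/andP: (y_bounds i).
have p0 := pi_gt0 R.
have rS : rho * S <= rho * (5 / 4 * L) by apply: ler_wpM2l => //; lra.
have ra : rho * a%:R <= rho * (5 / 4 * L) by apply: ler_wpM2l => //; lra.
have ra0 : 0 <= rho * a%:R by rewrite mulr_ge0 // ltW.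
have rL0 : 0 <= rho * L by rewrite mulr_ge0 // ltW.
have u2 : u <= u ^+ 2 by rewrite expr2 ler_peMr //; lra.
have u2L : u / L <= u ^+ 2 / L by rewrite ler_pM2r ?invr_gt0.
have aL : (4 * a%:R)^-1 <= u ^+ 2 / L.
  apply: le_trans u2L; rewrite -[leLHS]div1r ler_pdivrMr ?mulr_gt0 //.
  rewrite mulrAC ler_pdivlMr // mul1r mulrCA.
  by have : 1 * L <= u * (4 * a%:R) by [apply: ler_pM; lra]; lra.
have lL : ln (L / a%:R) <= 2 * (u / L).
  apply: le_trans (ln_le_sub1 _) _; first by rewrite divr_gt0.
  rewrite lerBlDr ler_pdivrMr // mulrDl mul1r.
  have : 2 * u / L * (3 / 4 * L) <= 2 * u / L * a%:R.
    by apply: ler_wpM2l; [rewrite divr_ge0 //; lra | lra].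
  rewrite (_ : 2 * u / L * (3 / 4 * L) = 3 / 2 * u); last by field; rewrite gt_eqF.
  rewrite mulrA; lra.
have lL' : - (2 * (u / L)) <= ln (L / a%:R).
  rewrite lerNl -lnV ?posrE ?divr_gt0 // invf_div.
  apply: le_trans (ln_le_sub1 _) _; first by rewrite divr_gt0.
  have : a%:R / L <= 1 + u / L.
    by rewrite ler_pdivrMr // mulrDl mul1r divfK ?gt_eqF //; lra.
  have : 0 <= u / L by rewrite divr_ge0 //; lra.
  lra.
have -> : Num.sqrt (2 * pi * L) = Num.sqrt (2 * pi * a%:R) * expR (2^-1 * ln (L / a%:R)).
  rewrite -[2 * pi * L in LHS](_ : 2 * pi * a%:R * (L / a%:R) = _); last first.
    by field; rewrite gt_eqF.
  rewrite sqrtrM ?mulr_ge0 ?(ltW p0) ?(ltW a0) //; congr (_ * _).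
  by rewrite -powR12_sqrt ?divr_ge0 ?ltW // /powR gt_eqF // divr_gt0.
have sq0 : 0 <= Num.sqrt (2 * pi * a%:R) :> R by rewrite sqrtr_ge0.
have sq1 : 0 <= expR (2^-1 * ln (L / a%:R)) by rewrite expR_ge0.
rewrite [bernoulli_pt a * _]mulrA; apply/andP; split; last first.
  have T0 : 0 < T by lra.
  have /andP[_ pu] := poisson_pt_bounds T0 a_gt0.
  apply: (@le_trans _ _ (expR (T - S) * expR ((4 * a%:R)^-1) * expR (2^-1 * ln (L / a%:R)))).
    rewrite ler_wpM2r //; apply: (@le_trans _ _ (expR (T - S) * poisson_pt T a * Num.sqrt (2 * pi * a%:R))).
      by rewrite ler_wpM2r // bernoulli_pt_le.
    by rewrite -mulrA ler_wpM2l ?expR_ge0.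
  rewrite -!expRD ler_expR; lra.
set T' := T - a%:R * (2 * rho).
(* By [8 rho L <= 1] and [a <= 5/4 L], lowering [T] costs at most [5/16 <= u/2]. So
   [|a - T'| <= 5/2 u] and [T' >= 5/8 L], and the 10 below is [(25/4) / (5/8)]. *)
have T'L : `|T' - L| <= 3 / 2 * u by rewrite /T' ler_norml; apply/andP; split; lra.
move: T'L; rewrite ler_norml => /andP[T1 T2].
have T'0 : 5 / 8 * L <= T' by lra.
have T'0' : 0 < T' by lra.
have /andP[pl _] := poisson_pt_bounds T'0' a_gt0.
have aT : (a%:R - T') ^+ 2 / T' <= 10 * (u ^+ 2 / L).
  rewrite ler_pdivrMr //.
  apply: (@le_trans _ _ (25 / 4 * u ^+ 2)).
    rewrite -(_ : (5 / 2 * u) ^+ 2 = 25 / 4 * u ^+ 2); last by rewrite !expr2; lra.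
    by rewrite -[leLHS]real_normK ?num_real // lerXn2r ?nnegrE // ?ler_norml; lra.
  apply: (@le_trans _ _ (10 * (u ^+ 2 / L) * (5 / 8 * L))).
    by rewrite le_eqVlt; apply/orP; left; apply/eqP; field; rewrite gt_eqF.
  by rewrite ler_wpM2l // mulr_ge0 // divr_ge0 ?sqr_ge0 // ltW.
apply: (@le_trans _ _ (expR (- (a%:R * (2 * rho))) *
   expR (- ((4 * a%:R)^-1 + (a%:R - T') ^+ 2 / T')) * expR (2^-1 * ln (L / a%:R)))).
  rewrite -!expRD ler_expR; lra.
rewrite ler_wpM2r //; apply: (@le_trans _ _ (expR (- (a%:R * (2 * rho))) * poisson_pt T' a * Num.sqrt (2 * pi * a%:R))).
  by rewrite -mulrA ler_wpM2l ?expR_ge0.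
rewrite ler_wpM2r // bernoulli_pt_ge //; lra.
Qed.

End PoissonLocal.

Section WindowProbability.
Variable R : realType.

(** The window is a difference of two initial segments of the naturals, each counted by a floor. *)
Lemma sum_window_bounds (L w : R) (M : nat) : 0 <= w -> w <= L -> L + w < M%:R ->
  2 * w - 1 <= \sum_(a < M | `|a%:R - L| <= w) 1 <= 2 * w + 2.
Proof.
move=> w0 wL LwM.
have count_le (t : nat) : (t < M)%N -> \sum_(a < M) (a <= t)%N%:R = t.+1%:R :> R.
  move=> tM; rewrite -natr_sum; congr (_%:R).
  rewrite -(big_mkord xpredT (fun a => nat_of_bool (a <= t)%N)).
  rewrite (@big_cat_nat _ _ _ t.+1) //= [X in (_ + X)%N]big_nat_cond.
  rewrite [X in (_ + X)%N]big1 ?addn0; last first.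
    by move=> a /andP[/andP[ta _] _]; rewrite leqNgt ta.
  rewrite big_nat_cond (eq_bigr (fun=> 1%N)).
    by rewrite -big_nat_cond sum_nat_const_nat subn0 muln1.
  by move=> a /andP[/andP[_ at1] _]; rewrite -ltnS at1.
have lo0 : 0 <= L - w by rewrite subr_ge0.
have hi0 : 0 <= L + w by lra.
have := truncn_le (L + w); have := truncnS_gt (L + w); rewrite hi0.
set t1 := Num.truncn (L + w) => h1 h2.
have := truncn_le (L - w); have := truncnS_gt (L - w); rewrite lo0.
set t0 := Num.truncn (L - w) => h3 h4.
have t1M : (t1 < M)%N by rewrite -(ltr_nat R) (le_lt_trans h2).
have t0M : (t0 < M)%N by rewrite -(ltr_nat R) (le_lt_trans h4) //; lra.
rewrite -!natr1 in h1 h3.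
have e : \sum_(a < M | `|a%:R - L| <= w) 1 =
    \sum_(a < M) (a <= t1)%N%:R - \sum_(a < M) (a%:R < L - w)%R%:R :> R.
  rewrite -sumrB big_mkcond; apply: eq_bigr => a _.
  rewrite truncn_ge_nat // ler_distl ltNge.
  case: (boolP (L - w <= a%:R)) => h /=; first by case: ifP => /=; rewrite subr0.
  rewrite -ltNge in h; have -> : a%:R <= L + w by lra.
  by rewrite subrr.
have l1 : t0%:R <= \sum_(a < M) (a%:R < L - w)%R%:R :> R.
  case: (posnP t0) => [->|t0_gt0]; first by rewrite sumr_ge0.
  have := count_le t0.-1; rewrite prednK // => <-; last exact: ltnW.
  apply: ler_sum => a _; rewrite ler_nat; case: (leqP a t0.-1) => // at0.
  have {}at0 : (a < t0)%N by clearbody t0; lia.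
  have h : a%:R < L - w by apply: lt_le_trans h4; rewrite ltr_nat.
  by rewrite h.
have l2 : \sum_(a < M) (a%:R < L - w)%R%:R <= t0%:R + 1 :> R.
  rewrite natr1 -count_le //; apply: ler_sum => a _; rewrite ler_nat.
  case: (boolP (a%:R < L - w)) => //= h.
  by rewrite truncn_ge_nat // ltW.
rewrite e count_le // -natr1; apply/andP; split; lra.
Qed.

Variables (I : finType) (x : I -> R) (rho : R).
Hypotheses (rho_ge0 : 0 <= rho) (x_bounds : forall i, 0 <= x i <= rho) (rho_le : rho <= 2^-1).

Lemma bernoulli_window (L u w : R) :
  1 <= u -> 4 * u <= L -> 8 * rho * L <= 1 -> `|\sum_i x i - L| <= u ->
  0 <= w <= u ->
  (2 * w - 1) * expR (- (13 * u ^+ 2 / L + 4 * rho * L)) <=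
    bernoulli_mean x (fun a : nat => (`|a%:R - L| <= w)%R%:R) * Num.sqrt (2 * pi * L)
    <= (2 * w + 2) * expR (13 * u ^+ 2 / L + 4 * rho * L).
Proof.
move=> u1 uL rhoL SL /andP[w0 wu].
pose M := maxn #|I| (Num.truncn (L + w)).
have IM : (#|I| <= M)%N by rewrite leq_maxl.
have LwM : L + w < M.+1%:R.
  apply: lt_le_trans (truncnS_gt _) _; by rewrite ler_nat ltnS leq_maxr.
have wL : w <= L by lra.
have /andP[c1 c2] := sum_window_bounds w0 wL LwM.
rewrite (bernoulli_mean_sum x (fun a : nat => `|a%:R - L| <= w) IM) big_distrl /=.
set E := 13 * _ / _ + _.
have loc a : `|a%:R - L| <= w -> expR (- E) <= bernoulli_pt x a * Num.sqrt (2 * pi * L) <= expR E.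
  by move=> aw; apply: bernoulli_pt_local => //; apply: le_trans aw wu.
apply/andP; split.
  apply: (@le_trans _ _ ((\sum_(a < M.+1 | `|a%:R - L| <= w) 1) * expR (- E))).
    by rewrite ler_wpM2r ?expR_ge0.
  by rewrite big_distrl /=; apply: ler_sum => a /loc /andP[]; rewrite mul1r.
apply: (@le_trans _ _ ((\sum_(a < M.+1 | `|a%:R - L| <= w) 1) * expR E)).
  by rewrite big_distrl /=; apply: ler_sum => a /loc /andP[]; rewrite mul1r.
by rewrite ler_wpM2r ?expR_ge0.
Qed.

End WindowProbability.

(** * Choice of parameters and error terms *)

Section PrimeRange.
Variables (z Y B : nat).
Hypotheses (zY : (z <= Y)%N) (YB : (Y <= B)%N).

Definition range_primes : seq nat := [seq p <- primes_upto Y | (z < p)%N].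
Definition off_range_primes : seq nat :=
  [seq p <- primes_upto B | ~~ ((z < p) && (p <= Y))%N].

Lemma range_primes_prime : all prime range_primes.
Proof. by apply/allP => p; rewrite mem_filter mem_primes_upto => /and3P[]. Qed.

Lemma range_primes_uniq : uniq range_primes.
Proof. by rewrite filter_uniq ?primes_upto_uniq. Qed.

Lemma off_range_primes_prime : all prime off_range_primes.
Proof. by apply/allP => p; rewrite mem_filter mem_primes_upto => /and3P[]. Qed.

Lemma off_range_primes_uniq : uniq off_range_primes.
Proof. by rewrite filter_uniq ?primes_upto_uniq. Qed.

Lemma perm_range_primes :
  perm_eq (primes_upto B) (range_primes ++ off_range_primes).
Proof.
apply: uniq_perm; first exact: primes_upto_uniq.
  rewrite cat_uniq range_primes_uniq off_range_primes_uniq andbT.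
  apply/hasPn => p; rewrite mem_filter => /andP[h _]; apply: contra h => /= ps.
  have : p \in range_primes := ps.
  by rewrite mem_filter mem_primes_upto => /and3P[-> _ ->].
move=> p; rewrite mem_cat !mem_filter !mem_iota !add0n !ltnS.
case: (prime p); rewrite ?andbF //= ?andbT.
case: (leqP p Y) => pY; rewrite ?andbT ?andbF //=.
by rewrite (leq_trans pY YB) andbT; case: ltnP.
Qed.

Lemma perm_primes_upto_range :
  perm_eq (primes_upto Y) (primes_upto z ++ range_primes).
Proof.
apply: uniq_perm; first exact: primes_upto_uniq.
  rewrite cat_uniq range_primes_uniq primes_upto_uniq andbT.
  apply/hasPn => p; rewrite mem_filter => /andP[zp _]; apply/negP => ps.
  have : p \in primes_upto z := ps.
  by rewrite mem_primes_upto leqNgt zp andbF.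
move=> p; rewrite mem_cat !mem_filter !mem_iota !add0n !ltnS.
case: (prime p); rewrite ?andbF //=; case: (ltnP z p) => //= pz.
by rewrite (leq_trans pz zY).
Qed.

Lemma size_primes_range (n : nat) : (0 < n <= B)%N ->
  size (primes n) = (num_divisors_in range_primes n + num_divisors_in off_range_primes n)%N.
Proof.
case/andP=> n_gt0 nB; rewrite /num_divisors_in -count_cat.
rewrite -(permP perm_range_primes) -size_filter.
apply: perm_size; apply: uniq_perm; rewrite ?primes_uniq ?filter_uniq ?iota_uniq //.
move=> p; rewrite mem_filter mem_primes_upto mem_primes n_gt0 /=.
case: (boolP (p %| n)%N) => pn; rewrite ?andbF //= ?andbT.
by rewrite (leq_trans (dvdn_leq n_gt0 pn) nB) andbT.
Qed.

Lemma inv_sum_range (R : realType) :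
  inv_sum R range_primes = inv_sum R (primes_upto Y) - inv_sum R (primes_upto z).
Proof.
rewrite /inv_sum (perm_big _ perm_primes_upto_range) /= big_cat /=.
by rewrite [RHS]addrC addKr.
Qed.

Lemma inv_sum_off_range (R : realType) :
  inv_sum R off_range_primes = inv_sum R (primes_upto B) - inv_sum R range_primes.
Proof.
rewrite /inv_sum (perm_big _ perm_range_primes) /= big_cat /=.
by rewrite [RHS]addrC addKr.
Qed.

End PrimeRange.

Section RangeSums.
Variables (R : realType) (L : R).
Hypotheses (L_ge : 5 <= L) (L_exp : L ^+ 6 <= expR L).

(* [L] plays the role of [log log x]. The lower limit makes [1/p] beat the losses
   [exp(O(L^2))]; the upper limit keeps products of [O(L^2)] primes below [x^(1/2)]. *)
Definition range_lo : nat := Num.truncn (expR (L ^+ 3)).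
Definition range_hi : nat := Num.truncn (expR (expR L / L ^+ 3)).
Definition range_top : nat := Num.truncn (expR (2 * expR L)).

Let L0 : 0 < L. Proof. by apply: lt_le_trans L_ge; rewrite ltr0n. Qed.
Let L3 : 0 < L ^+ 3. Proof. by rewrite exprn_gt0. Qed.

Lemma cube_le_exp_div : L ^+ 3 <= expR L / L ^+ 3.
Proof. by rewrite ler_pdivlMr // -exprD. Qed.

Lemma range_lo_le_hi : (range_lo <= range_hi)%N.
Proof. by apply: le_truncn; rewrite ler_expR cube_le_exp_div. Qed.

Lemma range_hi_le_top : (range_hi <= range_top)%N.
Proof.
have L5 := L_ge.
apply: le_truncn; rewrite ler_expR ler_pdivrMr //.
have : 1 <= L ^+ 3 by rewrite exprn_ege1 //; lra.
have := expR_gt0 L; nra.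
Qed.

Lemma range_lo_gt1 : (1 < range_lo)%N.
Proof.
have L5 := L_ge.
rewrite /range_lo truncn_ge_nat ?expR_ge0 //.
apply: le_trans (expR_ge1Dx _).
have : 1 <= L ^+ 3 by rewrite exprn_ege1 //; lra.
lra.
Qed.

Lemma ln_truncn_expR_le (v : R) : (0 < Num.truncn (expR v))%N -> ln (Num.truncn (expR v))%:R <= v.
Proof.
move=> v_gt0; rewrite -[leRHS]expRK ler_ln ?posrE ?expR_gt0 ?ltr0n //.
by rewrite truncn_le expR_ge0.
Qed.

Lemma ln_ge1 : 1 <= ln L.
Proof.
have L5 := L_ge.
have : expR 1 <= L.
  have h : expR (2^-1) <= 2 :> R.
    have := expR_ge1Dx (- 2^-1 : R); rewrite expRN => h.
    rewrite -[leLHS]invrK -[leRHS]invrK lef_pV2 ?posrE ?invr_gt0 ?expR_gt0 //.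
    by apply: le_trans h; lra.
  have -> : 1 = 2^-1 + 2^-1 :> R by lra.
  rewrite expRD; have := expR_gt0 (2^-1 : R); nra.
by move=> h; rewrite -[leLHS]expRK ler_ln ?posrE ?expR_gt0.
Qed.

Lemma inv_sum_range_hi_ge : L - 3 * ln L - 1 <= inv_sum R (primes_upto range_hi).
Proof.
have L5 := L_ge.
have Y0 : (0 < range_hi)%N by apply: leq_trans range_lo_le_hi; apply: ltnW range_lo_gt1.
have := loglog_le_inv_sum R Y0; rewrite -lerBlDr; apply: le_trans.
have -> : L - 3 * ln L = ln (expR L / L ^+ 3).
  by rewrite ln_div ?posrE ?expR_gt0 // expRK lnXn // -[ln L *+ 3]mulr_natl.
have d0 : 0 < expR L / L ^+ 3 by rewrite divr_gt0 ?expR_gt0.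
have h : expR L / L ^+ 3 <= ln range_hi.+1%:R.
  rewrite -[leLHS]expRK ler_ln ?posrE ?expR_gt0 ?ltr0n //.
  by rewrite ltW // truncnS_gt.
by rewrite lerD2r ler_ln ?posrE // (lt_le_trans d0).
Qed.

Lemma expR_inv_le (v : R) : 1 < v -> expR v^-1 <= v / (v - 1).
Proof.
move=> v1; have v0 : 0 < v by apply: lt_trans v1.
have := expR_ge1Dx (- v^-1); rewrite expRN => h.
rewrite -[leLHS]invrK -[leRHS]invrK lef_pV2 ?posrE ?invr_gt0 ?divr_gt0 ?expR_gt0 ?subr_gt0 //.
by rewrite invf_div mulrBl divff ?gt_eqF // mul1r.
Qed.

Lemma inv_sum_range_lo_le : inv_sum R (primes_upto range_lo) <= 8 * ln L + 2.
Proof.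
have L5 := L_ge.
(* Rankin's parameter [1/2] costs a factor up to 2, affordable because only [O(log L)] is wanted for
   the small primes. *)
have := @inv_sum_le R range_lo 2^-1 range_lo_gt1; rewrite invr_gt0 ltr0n => /(_ isT)/le_trans; apply.
have e2 : expR 2^-1 <= 2 :> R.
  have h : 1 < 2 :> R by rewrite ltr1n.
  apply: le_trans (expR_inv_le h) _.
  by have -> : 2 - 1 = 1 :> R by [lra]; rewrite divr1.
have lz : ln range_lo%:R <= L ^+ 3 by apply: ln_truncn_expR_le; apply: ltnW range_lo_gt1.
have lz0 : 0 <= ln range_lo%:R :> R by rewrite ln_ge0 // ler1n ltnW // range_lo_gt1.
have h : ln (1 + ln range_lo%:R / 2^-1) <= 4 * ln L.
  rewrite mulr_natl -lnXn // invrK ler_ln ?posrE ?exprn_gt0 //; last by move: lz0; lra.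
  have : 1 <= L ^+ 3 by rewrite exprn_ege1 //; lra.
  have : L ^+ 4 = L * L ^+ 3 by rewrite exprS.
  nra.
have h0 : 0 <= ln (1 + ln range_lo%:R / 2^-1) :> R by rewrite ln_ge0 // invrK; lra.
have := expR_gt0 (2^-1 : R); nra.
Qed.

(** Here the leading constant matters, as [ln C] will be about [L]. Rankin's parameter [1/L] makes
    the factor [1 + O(1/L)], at a total cost of [O(1)], while its reciprocal only adds [ln L]. *)
Lemma inv_sum_le_expR (N : nat) (v C : R) : (1 < N)%N -> ln N%:R <= v ->
  1 + L * v <= C -> inv_sum R (primes_upto N) <= L / (L - 1) * (ln C + 1).
Proof.
have L5 := L_ge.
move=> N1 Nv vC; have iL : 0 < L^-1 by rewrite invr_gt0.
apply: le_trans (inv_sum_le N1 iL) _.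
have lN : 0 <= ln N%:R :> R by rewrite ln_ge0 // ler1n ltnW.
have h : 1 + ln N%:R / L^-1 <= C.
  by apply: le_trans vC; rewrite invrK lerD2l mulrC ler_pM2l.
have h1 : 1 <= 1 + ln N%:R / L^-1 by rewrite lerDl invrK mulr_ge0 // ltW.
apply: ler_pM => //.
- by rewrite addr_ge0 // ln_ge0.
- by apply: expR_inv_le; lra.
have h2 : 0 < 1 + ln N%:R / L^-1 by lra.
by rewrite lerD2r ler_ln ?posrE // (lt_le_trans h2).
Qed.

Lemma inv_sum_range_hi_le : inv_sum R (primes_upto range_hi) <= L + 3.
Proof.
have L5 := L_ge.
have Y1 : (1 < range_hi)%N by apply: leq_trans range_lo_le_hi; apply: range_lo_gt1.
have := @inv_sum_le_expR range_hi (expR L / L ^+ 3) (expR L) Y1.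
rewrite expRK; move=> /(_ (ln_truncn_expR_le (ltnW Y1))) H.
apply: le_trans (H _) _.
  have -> : L * (expR L / L ^+ 3) = expR L / L ^+ 2.
    by field; rewrite gt_eqF.
  have L2 : 2 <= L ^+ 2 by rewrite expr2; nra.
  have e2 : 2 <= expR L by apply: le_trans (expR_ge1Dx _); lra.
  have : expR L / L ^+ 2 <= expR L / 2.
    by rewrite ler_pM2l ?expR_gt0 // lef_pV2 ?posrE //; lra.
  lra.
rewrite mulrAC ler_pdivrMr; last by lra.
nra.
Qed.

Lemma inv_sum_range_top_le : inv_sum R (primes_upto range_top) <= L + 2 * ln L + 5.
Proof.
have L5 := L_ge.
have Y1 : (1 < range_top)%N.
  by apply: leq_trans range_hi_le_top; apply: leq_trans range_lo_le_hi; apply: range_lo_gt1.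
have := @inv_sum_le_expR range_top (2 * expR L) (L ^+ 2 * expR L) Y1.
move=> /(_ (ln_truncn_expR_le (ltnW Y1))) H.
have e2 : 1 <= expR L by apply: le_trans (expR_ge1Dx _); lra.
apply: le_trans (H _) _.
  move: (expR L) e2 => e e1; have Le : 1 <= L * e by nra.
  have : 5 * (L * e) <= L * (L * e) by apply: ler_wpM2r => //; lra.
  rewrite expr2 -[in X in _ -> _ <= X]mulrA; lra.
rewrite lnM ?posrE ?exprn_gt0 ?expR_gt0 // expRK lnXn // -[(ln L) *+ 2]mulr_natl.
have := ln_sublinear L0; have := ln_ge1.
rewrite mulrAC ler_pdivrMr; last by lra.
nra.
Qed.

(** The range sum is at least [L - 11 ln L - 3], and subtracting this from the full sum leaves at
    most [13 ln L + 8]; [ln L >= 1] absorbs the constants into 14 and 21. *)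
Lemma range_sum_bounds :
  `|inv_sum R (range_primes range_lo range_hi) - L| <= 14 * ln L /\
  inv_sum R (off_range_primes range_lo range_hi range_top) <= 21 * ln L.
Proof.
have L5 := L_ge.
rewrite (inv_sum_off_range _ range_hi_le_top) !(inv_sum_range range_lo_le_hi).
have := inv_sum_range_top_le; have := inv_sum_range_hi_le.
have := inv_sum_range_hi_ge; have := inv_sum_range_lo_le; have := ln_ge1.
have : 0 <= inv_sum R (primes_upto range_lo) by apply: sumr_ge0 => p _; rewrite invr_ge0.
by move=> *; split; rewrite ?ler_norml; lra.
Qed.

End RangeSums.

(** * Size of the error terms *)

Section GapError.
Variables (R : realType) (L : R).
Hypotheses (L_ge : 1000 <= L) (L_exp : L ^+ 6 <= expR L).

Local Notation s := (range_primes (range_lo L) (range_hi L)).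
Local Notation t := (off_range_primes (range_lo L) (range_hi L) (range_top L)).

Definition trunc_order : nat := (Num.truncn (40 * L ^+ 2)).+1.
(* Number of discarded prime factors that is tolerated: [2 ^- slack <= L ^- 25]
   beats [exp] of the reciprocal sum of the discarded primes, at most [L ^+ 21]. *)
Definition slack : nat := (Num.truncn (50 * ln L)).+1.

Let L5 : 5 <= L. Proof. by have := L_ge; lra. Qed.
Let L1 : 1 <= L. Proof. by have := L_ge; lra. Qed.
Let L0 : 0 < L. Proof. by have := L_ge; lra. Qed.

Lemma prod_1Dinv_le (r : seq nat) (c : R) : 0 <= c ->
  \prod_(p <- r) (1 + c * p%:R^-1) <= expR (c * inv_sum R r).
Proof.
move=> c0; rewrite /inv_sum big_distrr /= expR_sum; apply: ler_prod => p _.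
by rewrite expR_ge1Dx andbT addr_ge0 // mulr_ge0 ?invr_ge0.
Qed.

Lemma range_prime_inv_le (p : nat) : p \in s -> p%:R^-1 <= expR (- L ^+ 3).
Proof.
rewrite mem_filter => /andP[zp _].
rewrite expRN lef_pV2 ?posrE ?expR_gt0 ?ltr0n ?(leq_ltn_trans _ zp) //.
by rewrite ltW // (lt_le_trans (truncnS_gt _)) // ler_nat.
Qed.

Lemma inv_sum_range_le2 : inv_sum R s <= 2 * L.
Proof.
rewrite (inv_sum_range (range_lo_le_hi L5 L_exp)).
have := inv_sum_range_hi_le L5 L_exp; have := L_ge.
have : 0 <= inv_sum R (primes_upto (range_lo L)) by apply: sumr_ge0 => p _; rewrite invr_ge0.
lra.
Qed.

Lemma expR_half_le2 : expR 2^-1 <= 2 :> R.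
Proof.
have h : 1 < 2 :> R by rewrite ltr1n.
apply: le_trans (expR_inv_le h) _.
by have -> : 2 - 1 = 1 :> R by [lra]; rewrite divr1.
Qed.

Lemma expR1_bounds : 2 <= expR 1 :> R /\ expR 1 <= 4 :> R.
Proof.
split; first by apply: le_trans (expR_ge1Dx _); lra.
have -> : 1 = 2^-1 + 2^-1 :> R by lra.
by rewrite expRD; have := expR_half_le2; have := expR_gt0 (2^-1 : R); nra.
Qed.

Lemma trunc_order_bounds : 40 * L ^+ 2 <= trunc_order%:R <= 41 * L ^+ 2.
Proof.
have h : 0 <= 40 * L ^+ 2 by rewrite mulr_ge0 ?sqr_ge0.
have := truncn_le (40 * L ^+ 2); rewrite h => h1.
have h2 := truncnS_gt (40 * L ^+ 2).
have L2 : 1 <= L ^+ 2 by rewrite exprn_ege1 //; have := L_ge; lra.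
apply/andP; split; first by rewrite ltW.
by rewrite /trunc_order -natr1; lra.
Qed.

Lemma exp3_le : 3 ^+ trunc_order <= expR (82 * L ^+ 2).
Proof.
have /andP[_ h] := trunc_order_bounds.
apply: (@le_trans _ _ (expR 2 ^+ trunc_order)).
  rewrite lerXn2r ?nnegrE ?expR_ge0 // (_ : 2 = 1 + 1 :> R); last by lra.
  by rewrite expRD; have [h2 _] := expR1_bounds; nra.
by rewrite -expRM_natl ler_expR; lra.
Qed.

Section Bound.
Variables (N k : nat).
Hypotheses (k_gt0 : (0 < k)%N) (k_le : k%:R <= L) (N_ge : expR (expR L / 2) <= N%:R).

Let tau : R := (size s * k).+1%:R^-1.

Let N0 : 0 < N%:R :> R. Proof. by apply: lt_le_trans N_ge; exact: expR_gt0. Qed.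

(** With [M = size s * k], the choice [tau = 1/(M+1)] keeps [(1 + tau)^M <= e] and turns the other
    power into [(M+1)^K <= exp(82 e^L/L)]. For [L >= 1000] this and the factor [3^K] are far below
    [exp(e^L/2)]. *)
Lemma subset_term_le :
  3 ^+ trunc_order * (tau ^- trunc_order * (1 + tau) ^+ (size s * k) / N%:R) <= expR (- L).
Proof.
have aux (a e b l : R) : 1000 * a <= e -> 1000 * b <= e -> l <= b -> 0 < e -> 1000 <= l ->
  82 * b + (82 * a + 1 - e / 2) <= - l by lra.
have L1000 := L_ge; set K := trunc_order; set E := expR L / L ^+ 3.
have E0 : 0 < E by rewrite divr_gt0 ?expR_gt0 ?exprn_gt0.
have LE : L <= E.
  apply: le_trans (cube_le_exp_div L5 L_exp); rewrite exprS ler_peMr ?(ltW L0) //.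
  by rewrite exprn_ege1 // L1.
have Me : (size s * k).+1%:R <= expR (2 * E).
  have sY : (size s)%:R <= expR E + 1.
    apply: (@le_trans _ _ (range_hi L).+1%:R).
      rewrite ler_nat /range_primes size_filter (leq_trans (count_size _ _)) //.
      by rewrite size_filter (leq_trans (count_size _ _)) // size_iota.
    by rewrite -natr1 lerD2r truncn_le expR_ge0.
  have LE1 : L <= expR E - 1 by have := expR_ge1Dx E; lra.
  rewrite -natr1 natrM.
  have : (size s)%:R * k%:R <= (expR E + 1) * (expR E - 1).
    by apply: ler_pM => //; apply: le_trans k_le LE1.
  have -> : expR (2 * E) = expR E * expR E by rewrite -expRD; congr expR; lra.
  lra.
have M0 : 0 < (size s * k).+1%:R :> R by rewrite ltr0n.
have t1 : tau ^- K <= expR (2 * E * (41 * L ^+ 2)).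
  rewrite /tau exprVn invrK.
  apply: (@le_trans _ _ (expR (2 * E) ^+ K)); first by rewrite lerXn2r ?nnegrE ?expR_ge0 // ltW.
  rewrite -expRM_natr ler_expR ler_wpM2l //; first by rewrite mulr_ge0 ?(ltW E0).
  by have /andP[] := trunc_order_bounds.
have t2 : (1 + tau) ^+ (size s * k) <= expR 1.
  apply: (@le_trans _ _ (expR tau ^+ (size s * k))).
    by rewrite lerXn2r ?nnegrE ?expR_ge0 ?expR_ge1Dx // addr_ge0 // invr_ge0.
  rewrite -expRM_natr ler_expR /tau mulrC ler_pdivrMr // mul1r ler_nat.
  exact: leqnSn.
have t0 : 0 <= tau by rewrite invr_ge0.
have iN : N%:R^-1 <= expR (- (expR L / 2)).
  by rewrite expRN lef_pV2 ?posrE ?expR_gt0.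
apply: (@le_trans _ _ (expR (82 * L ^+ 2) *
    (expR (2 * E * (41 * L ^+ 2)) * expR 1 * expR (- (expR L / 2))))).
  apply: ler_pM; rewrite ?exp3_le ?exprn_ge0 //.
    by rewrite !mulr_ge0 ?invr_ge0 ?exprn_ge0 ?addr_ge0.
  apply: ler_pM; rewrite ?mulr_ge0 ?invr_ge0 ?exprn_ge0 ?addr_ge0 ?ler0n //.
  by apply: ler_pM; rewrite ?invr_ge0 ?exprn_ge0 ?addr_ge0.
rewrite -!expRD ler_expR.
have -> : 2 * E * (41 * L ^+ 2) = 82 * (expR L / L).
  by rewrite /E; field; rewrite gt_eqF.
have h1 : 1000 * (expR L / L) <= expR L.
  rewrite mulrA ler_pdivrMr; last exact: L0.
  by rewrite mulrC ler_pM2l; [exact: L_ge | exact: expR_gt0].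
have h2 : 1000 * L ^+ 2 <= expR L.
  apply: le_trans L_exp; rewrite (_ : 6 = 4 + 2)%N // exprD ler_wpM2r ?sqr_ge0 //.
  apply: le_trans (L_ge) _; rewrite exprS ler_peMr ?(ltW L0) //.
  by rewrite exprn_ege1 // L1.
have h3 : L <= L ^+ 2 by rewrite expr2 ler_peMr ?(ltW L0) //; lra.
exact: (aux _ _ _ _ h1 h2 h3 (expR_gt0 L) L_ge).
Qed.

Lemma power_prod_le (c : R) : 0 <= c ->
  (\prod_(p <- s) (1 + c * p%:R^-1)) ^+ k <= expR (c * (2 * L ^+ 2)).
Proof.
move=> c0; apply: (@le_trans _ _ (expR (c * inv_sum R s) ^+ k)).
  rewrite lerXn2r ?nnegrE ?expR_ge0 ?prod_1Dinv_le //.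
  by apply: prodr_ge0 => p _; rewrite addr_ge0 // mulr_ge0 ?invr_ge0.
rewrite -expRM_natr ler_expR -mulrA ler_wpM2l //.
have -> : 2 * L ^+ 2 = (2 * L) * L by rewrite expr2 mulrA.
apply: ler_pM => //; last exact: inv_sum_range_le2.
by apply: sumr_ge0 => p _; rewrite invr_ge0.
Qed.

(** One factor [1/p] of each square is at most [exp(-L^3)], which beats the remaining
    [exp(O(L^2))]. *)
Lemma collision_term_le :
  3 ^+ trunc_order * (k%:R ^+ 2 * (\sum_(p <- s) (p%:R^-1) ^+ 2)
    * (\prod_(p <- s) (1 + p%:R^-1)) ^+ k) <= expR (- L).
Proof.
have L1000 := L_ge.
have p1 : (\prod_(p <- s) (1 + p%:R^-1)) ^+ k <= expR (2 * L ^+ 2).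
  have := @power_prod_le 1 ler01; rewrite mul1r; apply: le_trans.
  rewrite le_eqVlt; apply/orP; left; apply/eqP; congr (_ ^+ _).
  by apply: eq_bigr => p _; rewrite mul1r.
have sq : \sum_(p <- s) (p%:R^-1) ^+ 2 <= expR (- L ^+ 3) * (2 * L).
  apply: (@le_trans _ _ (expR (- L ^+ 3) * inv_sum R s)).
    rewrite /inv_sum big_distrr big_seq [leRHS]big_seq; apply: ler_sum => p ps /=.
    by rewrite expr2 ler_wpM2r ?invr_ge0 // range_prime_inv_le.
  by rewrite ler_wpM2l ?expR_ge0 // inv_sum_range_le2.
have s0 : 0 <= \sum_(p <- s) (p%:R^-1) ^+ 2 :> R.
  by apply: sumr_ge0 => p _; rewrite exprn_ge0 ?invr_ge0.
have pr0 : 0 <= \prod_(p <- s) (1 + p%:R^-1) :> R.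
  by apply: prodr_ge0 => p _; rewrite addr_ge0 ?invr_ge0.
have k2 : k%:R ^+ 2 <= L ^+ 2 by rewrite lerXn2r ?nnegrE // ltW.
have kk : k%:R ^+ 2 * (\sum_(p <- s) (p%:R^-1) ^+ 2) <= expR L * expR (- L ^+ 3).
  apply: (@le_trans _ _ (L ^+ 2 * (expR (- L ^+ 3) * (2 * L)))).
    by apply: ler_pM => //; rewrite exprn_ge0.
  rewrite mulrCA [leLHS]mulrC ler_wpM2r ?expR_ge0 //.
  apply: le_trans L_exp; rewrite (_ : 6 = 3 + 3)%N // exprD.
  have -> : L ^+ 2 * (2 * L) = 2 * L ^+ 3 by rewrite !exprS; ring.
  rewrite ler_wpM2r ?exprn_ge0 ?(ltW L0) //.
  apply: (@le_trans _ _ L); first by lra.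
  by rewrite exprS ler_peMr ?(ltW L0) // exprn_ege1 //; lra.
apply: (@le_trans _ _ (expR (82 * L ^+ 2) * (expR L * expR (- L ^+ 3) * expR (2 * L ^+ 2)))).
  apply: ler_pM; rewrite ?exp3_le ?exprn_ge0 //.
    by rewrite !mulr_ge0 ?exprn_ge0.
  by apply: ler_pM; rewrite ?mulr_ge0 ?exprn_ge0.
rewrite -!expRD ler_expR.
have L3 : L ^+ 3 = L * L ^+ 2 by rewrite exprS.
have : 1000 * L ^+ 2 <= L * L ^+ 2 by rewrite ler_wpM2r ?sqr_ge0.
have h3 : L <= L ^+ 2 by rewrite expr2 ler_peMr ?(ltW L0) //; lra.
rewrite L3; lra.
Qed.

(** [3/16 <= 1/4 <= 1/e], so [K >= 40 L^2] gives [exp(-40 L^2)] against the product's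
    [exp(16 * 2 L^2)]. *)
Lemma tail_term_le :
  3 ^+ trunc_order * (2 * (16 ^- trunc_order *
    (\prod_(p <- s) (1 + 16 * p%:R^-1)) ^+ k)) <= expR (- L).
Proof.
have L1000 := L_ge.
have p1 := @power_prod_le 16 (ler0n _ _).
have [e1 e2] := expR1_bounds.
have pr0 : 0 <= \prod_(p <- s) (1 + 16 * p%:R^-1) :> R.
  by apply: prodr_ge0 => p _; rewrite addr_ge0 // mulr_ge0 ?invr_ge0.
have /andP[Kl _] := trunc_order_bounds.
have h : 3 ^+ trunc_order * 16 ^- trunc_order <= expR (- (40 * L ^+ 2)) :> R.
  rewrite -exprVn -exprMn.
  apply: (@le_trans _ _ (expR (- 1) ^+ trunc_order)).
    rewrite lerXn2r ?nnegrE ?expR_ge0 // ?mulr_ge0 ?invr_ge0 //.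
    rewrite expRN -[leLHS]invrK lef_pV2 ?posrE ?invr_gt0 ?expR_gt0 ?divr_gt0 //.
    rewrite invf_div; lra.
  by rewrite -expRM_natl ler_expR; lra.
rewrite mulrCA mulrA [leLHS]mulrA -[2 * _ * _]mulrA.
apply: (@le_trans _ _ (expR 1 * expR (- (40 * L ^+ 2)) * expR (16 * (2 * L ^+ 2)))).
  apply: ler_pM; rewrite ?mulr_ge0 ?exprn_ge0 ?invr_ge0 ?exprn_ge0 //.
  by apply: ler_pM; rewrite ?mulr_ge0 ?exprn_ge0 ?invr_ge0 ?exprn_ge0.
rewrite -!expRD ler_expR.
have h3 : L <= L ^+ 2 by rewrite expr2 ler_peMr ?(ltW L0) //; lra.
lra.
Qed.

Lemma expRN_le_cube : expR (- L) <= L ^- 3.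
Proof.
rewrite expRN lef_pV2 ?posrE ?expR_gt0 ?exprn_gt0 //.
apply: le_trans L_exp; rewrite (_ : 6 = 3 + 3)%N // exprD ler_peMr ?exprn_ge0 ?(ltW L0) //.
by rewrite exprn_ege1 //; have := L_ge; lra.
Qed.

Lemma correlation_error_le : correlation_error s k trunc_order N tau <= 3 * L ^- 3.
Proof.
rewrite /correlation_error !mulrDr.
have aux (a b : R) : a <= b -> a + a + a <= 3 * b by lra.
apply: le_trans (aux _ _ expRN_le_cube).
by apply: lerD tail_term_le; apply: lerD subset_term_le collision_term_le.
Qed.

End Bound.

Lemma gap_error_le (N H : nat) : H.+1%:R <= L -> expR (expR L / 2) <= N%:R -> (H <= N)%N ->
  gap_error s t slack N H trunc_order (size s * H.+1).+1%:R^-1 <= 5 * L ^- 3.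
Proof.
move=> HL N_ge HN; rewrite /gap_error.
have L1000 := L_ge.
have N0 : 0 < N%:R :> R by apply: lt_le_trans N_ge; exact: expR_gt0.
have aux (a b d : R) : a <= 3 * d -> b <= 2 * d -> a + b <= 5 * d by lra.
apply: aux; first exact: correlation_error_le.
have aux2 (l v : R) : 50 * l < v -> 25 * l <= v * 2^-1 by lra.
suff b : H.+1%:R * (2 ^- slack * ((N + H)%:R / N%:R) * \prod_(p <- t) (1 + p%:R^-1)) <= 2 * L ^- 3 by [].
have p1 : \prod_(p <- t) (1 + p%:R^-1) <= L ^+ 21.
  apply: (@le_trans _ _ (expR (1 * inv_sum R t))).
    apply: le_trans (prod_1Dinv_le _ ler01).
    by rewrite le_eqVlt; apply/orP; left; apply/eqP; apply: eq_bigr => p _; rewrite mul1r.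
  rewrite mul1r -[leRHS]lnK ?posrE ?exprn_gt0 // ler_expR lnXn // -[ln L *+ 21]mulr_natl.
  by have [] := range_sum_bounds L5 L_exp.
have p2 : (N + H)%:R / N%:R <= 2 :> R.
  by rewrite ler_pdivrMr // -natrM ler_nat mul2n -addnn leq_add2l.
have p3 : 2 ^- slack <= L ^- 25.
  rewrite lef_pV2 ?posrE ?exprn_gt0 //.
  apply: (@le_trans _ _ (expR 2^-1 ^+ slack)); last first.
    by rewrite lerXn2r ?nnegrE ?expR_ge0 // expR_half_le2.
  rewrite -expRM_natl -[leLHS]lnK ?posrE ?exprn_gt0 // ler_expR lnXn // -[ln L *+ 25]mulr_natl.
  by apply: aux2; exact: truncnS_gt.
have pr0 : 0 <= \prod_(p <- t) (1 + p%:R^-1) :> R.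
  by apply: prodr_ge0 => p _; rewrite addr_ge0 ?invr_ge0.
(* A union bound over at most [L] shifts; the powers combine to [2 L^-3]. *)
apply: (@le_trans _ _ (L * (L ^- 25 * 2 * L ^+ 21))).
  apply: ler_pM => //; first by rewrite !mulr_ge0 ?invr_ge0 ?exprn_ge0.
  by apply: ler_pM => //; apply: ler_pM.
by rewrite le_eqVlt; apply/orP; left; apply/eqP; field; rewrite gt_eqF.
Qed.

End GapError.

(** * Passage to the limit *)

Section Growth.
Variable R : realType.

Lemma cvgy_powR (a : R) : 0 < a -> L `^ a @[L --> +oo] --> +oo.
Proof.
move=> a0; apply/cvgryPge => A; near=> L.
have A0 : 0 <= `|A| + 1 by rewrite addr_ge0.
apply: (@le_trans _ _ (`|A| + 1)); first by rewrite ler_wpDr // ler_norm.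
have <- : ((`|A| + 1) `^ a^-1) `^ a = `|A| + 1.
  by rewrite -powRrM mulVf ?gt_eqF // powRr1.
have h : (`|A| + 1) `^ a^-1 <= L by near: L; apply: nbhs_pinfty_ge; rewrite num_real.
by apply: ge0_ler_powR => //; rewrite ?nnegrE ?powR_ge0 ?(ltW a0) // (le_trans (powR_ge0 _ _) h).
Unshelve. all: by end_near. Qed.

Lemma cvgy_ln : ln L @[L --> +oo] --> (+oo : set_system R).
Proof.
apply/cvgryPge => A; near=> L.
have h : expR A <= L by near: L; apply: nbhs_pinfty_ge; rewrite num_real.
by rewrite -[A]expRK ler_ln ?posrE ?expR_gt0 // (lt_le_trans (expR_gt0 A)).
Unshelve. all: by end_near. Qed.

Lemma cvg_powRN (a : R) : 0 < a -> L `^ (- a) @[L --> +oo] --> (0 : R).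
Proof.
move=> a0; have := cvgy_powR a0; rewrite -gtr0_cvgV0; last first.
  by near=> L; apply: powR_gt0; near: L; apply: nbhs_pinfty_gt; rewrite num_real.
apply: cvg_trans; apply: near_eq_cvg; near=> L.
by rewrite /= powRN.
Unshelve. all: by end_near. Qed.

Lemma ln_le_powR (b L : R) : 0 < b -> 0 < L -> ln L <= b^-1 * L `^ b.
Proof.
move=> b0 L0; rewrite mulrC ler_pdivlMr // mulrC -ln_powR ltW //.
by apply: ln_sublinear; apply: powR_gt0.
Qed.

Lemma cvg_ln_powRN (a : R) : 0 < a -> ln L * L `^ (- a) @[L --> +oo] --> (0 : R).
Proof.
move=> a0; have a20 : 0 < a / 2 by rewrite divr_gt0.
apply: (@squeeze_cvgr _ _ _ _ (fun=> 0) (fun L => (a / 2)^-1 * L `^ (- (a / 2)))).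
- near=> L; have L1 : 1 <= L by near: L; apply: nbhs_pinfty_ge; rewrite num_real.
  have L0 : 0 < L by apply: lt_le_trans L1.
  apply/andP; split; first by rewrite mulr_ge0 ?ln_ge0 ?powR_ge0.
  have -> : L `^ (- (a / 2)) = L `^ (a / 2) * L `^ (- a).
    rewrite -powRD; last by rewrite (gt_eqF L0) implybT.
    by congr (_ `^ _); lra.
  by rewrite mulrA ler_wpM2r ?powR_ge0 // ln_le_powR.
- exact: cvg_cst.
- rewrite -[X in _ --> X](mulr0 (a / 2)^-1); apply: cvgMr; exact: cvg_powRN.
Unshelve. all: by end_near. Qed.

Lemma near_ln_le_powR (C a : R) : 0 < a -> \forall L \near +oo, C * ln L <= L `^ a.
Proof.
move=> a0; have a20 : 0 < a / 2 by rewrite divr_gt0.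
have := cvgy_powR a20 => /cvgryPge /(_ (`|C| * (a / 2)^-1)) => h; near=> L.
have L1 : 1 <= L by near: L; apply: nbhs_pinfty_ge; rewrite num_real.
have L0 : 0 < L by apply: lt_le_trans L1.
have hL : `|C| * (a / 2)^-1 <= L `^ (a / 2) by near: L; exact: h.
apply: (@le_trans _ _ (`|C| * ((a / 2)^-1 * L `^ (a / 2)))).
  apply: (@le_trans _ _ (`|C| * ln L)); first by rewrite ler_wpM2r ?ln_ge0 ?ler_norm.
  by rewrite ler_wpM2l // ln_le_powR.
have -> : L `^ a = L `^ (a / 2) * L `^ (a / 2).
  rewrite -powRD; last by rewrite (gt_eqF L0) implybT.
  by congr (_ `^ _); lra.
by rewrite mulrA ler_wpM2r ?powR_ge0.
Unshelve. all: by end_near. Qed.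

Lemma near_expX_le_expR : \forall L \near +oo, (L : R) ^+ 6 <= expR L.
Proof.
near=> L; have L0 : 0 <= L by near: L; apply: nbhs_pinfty_ge; rewrite num_real.
have Lf : 7`!%:R <= L by near: L; apply: nbhs_pinfty_ge; rewrite num_real.
apply: le_trans (expR_ge1Dxn 6 L0).
have f0 : 0 < 7`!%:R :> R by rewrite ltr0n fact_gt0.
move: (7`!%:R : R) f0 Lf => f f0 Lf; rewrite ler_wpDl // [L ^+ 7]exprS mulrAC.
by rewrite ler_peMl ?exprn_ge0 // ler_pdivlMr // mul1r.
Unshelve. all: by end_near. Qed.

End Growth.

(** * Asymptotics of the window probability *)

Section WindowLimit.
Variables (R : realType) (delta : R).
Hypotheses (delta_gt0 : 0 < delta) (delta_lt : delta < 1 / 2).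

Definition density (L : R) : R := L `^ (- (1 / 2) + delta).
Definition half_width (L : R) : R := Num.sqrt (pi / 2) * L `^ delta.
Definition model_primes (L : R) : seq nat := range_primes (range_lo L) (range_hi L).
Definition window_mean (L v : R) : R :=
  prime_model_mean (model_primes L) (fun a => (in_window L v a)%:R).

Local Notation c := (Num.sqrt (pi / 2) : R).

Let c_gt0 : 0 < c. Proof. by rewrite sqrtr_gt0 divr_gt0 ?pi_gt0. Qed.

(** Relative error in the number of integers of the window, from moving its edges by [slack] and
    from rounding, against the main term [2 * half_width]. *)
Definition edge_ratio (L : R) : R := ((slack L)%:R + 1) / half_width L.
Definition local_exponent (L : R) : R :=
  13 * ((c + 1) * L `^ delta) ^+ 2 / L + 4 * expR (- L ^+ 3) * L.

(** This explains the constant [sqrt(pi/2)]: about [2 * half_width] values, each of probability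
    [1/sqrt(2 pi L)], add up to [density] exactly. *)
Lemma density_sqrt (L : R) : 0 < L ->
  density L * Num.sqrt (2 * pi * L) = 2 * half_width L.
Proof.
move=> L0; have p0 := pi_gt0 R.
have -> : 2 * pi * L = 4 * (pi / 2) * L by lra.
rewrite sqrtrM ?mulr_ge0 ?divr_ge0 ?(ltW p0) // sqrtrM //.
have -> : Num.sqrt 4 = 2 :> R.
  by have -> : 4 = 2 ^+ 2 :> R by [rewrite expr2; lra]; rewrite sqrtr_sqr ger0_norm.
rewrite -[Num.sqrt L]powR12_sqrt ?(ltW L0) // /half_width.
have -> : L `^ delta = density L * L `^ 2^-1.
  rewrite /density -powRD; last by rewrite (gt_eqF L0) implybT.
  by congr (_ `^ _); lra.
by ring.
Qed.

Lemma slack_le (L : R) : 5 <= L -> (slack L)%:R <= 51 * ln L.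
Proof.
move=> L5; have l1 := ln_ge1 L5.
have h : 0 <= 50 * ln L by lra.
have := truncn_le (50 * ln L); rewrite h /slack -natr1; lra.
Qed.

(** [bernoulli_window] is used with [u = (c + 1) L^delta], which dominates both the widened
    half-width and the deviation [14 ln L] of the reciprocal sum from [L], and with
    [rho = exp(-L^3)], as all model primes exceed [exp(L^3)]. *)
Lemma near_window_mean : \forall L \near +oo, forall v : R,
  half_width L - (slack L)%:R <= v <= half_width L + (slack L)%:R ->
  (1 - edge_ratio L) * expR (- local_exponent L) <= window_mean L v / density L
    <= (1 + edge_ratio L) * expR (local_exponent L).
Proof.
near=> L; move=> v /andP[v1 v2].
have d0 := delta_gt0; have c0 := c_gt0.
have L1000 : 1000 <= L by near: L; apply: nbhs_pinfty_ge; rewrite num_real.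
have L6 : L ^+ 6 <= expR L by near: L; exact: near_expX_le_expR.
have h51 : 51 * ln L <= L `^ delta by near: L; exact: near_ln_le_powR.
have hc : 51 / c * ln L <= L `^ delta by near: L; exact: near_ln_le_powR.
have hd : 4 * (c + 1) <= L `^ (1 - delta).
  near: L; have : 0 < 1 - delta by have := delta_lt; lra.
  by move=> /cvgy_powR /cvgryPge; apply.
have L5 : 5 <= L by lra.
have L0 : 0 < L by lra.
have l1 := ln_ge1 L5; have sl := slack_le L5.
have P0 : 0 < L `^ delta by exact: powR_gt0.
have P1 : 1 <= L `^ delta by lra.
have hw : half_width L = c * L `^ delta by [].
have cE : (c + 1) * L `^ delta = half_width L + L `^ delta by rewrite hw mulrDl mul1r.
have hc' : 51 * ln L <= half_width L.
  rewrite hw -ler_pdivrMl //; apply: le_trans hc.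
  by rewrite le_eqVlt; apply/orP; left; apply/eqP; ring.
have m0 : 0 <= (slack L)%:R :> R by [].
have hw0 : 0 < half_width L by rewrite hw mulr_gt0.
have q0 : 0 < density L by exact: powR_gt0.
have s0 : 0 < Num.sqrt (2 * pi * L) by rewrite sqrtr_gt0 !mulr_gt0 ?pi_gt0.
have L3 : L <= L ^+ 3.
  by rewrite exprS ler_peMr ?(ltW L0) // exprn_ege1 //; lra.
have e3 := expR_ge1Dx (L ^+ 3).
have e30 : 0 < expR (L ^+ 3) by exact: expR_gt0.
have r0 : 0 <= expR (- L ^+ 3) by exact: expR_ge0.
have r1 : expR (- L ^+ 3) <= 2^-1.
  by rewrite expRN lef_pV2 ?posrE //; lra.
have r2 : 8 * expR (- L ^+ 3) * L <= 1.
  rewrite expRN mulrAC ler_pdivrMr // mul1r.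
  apply: (@le_trans _ _ (L ^+ 3)); last by lra.
  rewrite exprS mulrC ler_pM2l // expr2.
  have : 1000 * L <= L * L by rewrite ler_pM2r.
  lra.
have xb (i : 'I_(size (model_primes L))) :
    0 <= ((nth 0%N (model_primes L) i)%:R^-1 : R) <= expR (- L ^+ 3).
  by rewrite invr_ge0 ler0n /= range_prime_inv_le // mem_nth.
have uL : 4 * ((c + 1) * L `^ delta) <= L.
  have {2}-> : L = L `^ (1 - delta) * L `^ delta.
    rewrite -powRD; last by rewrite (gt_eqF L0) implybT.
    by rewrite subrK powRr1 // ltW.
  by rewrite mulrA ler_pM2r.
have u1 : 1 <= (c + 1) * L `^ delta.
  by rewrite cE; lra.
have SL : `|\sum_(i < size (model_primes L)) (nth 0%N (model_primes L) i)%:R^-1 - L| <= (c + 1) * L `^ delta.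
  have [+ _] := range_sum_bounds L5 L6.
  rewrite /inv_sum (big_nth 0%N) big_mkord => /le_trans; apply.
  by rewrite cE; lra.
have vb : 0 <= v <= (c + 1) * L `^ delta.
  by rewrite cE; apply/andP; split; lra.
have := bernoulli_window r0 xb r1 u1 uL r2 SL vb.
rewrite -/(window_mean L v) -/(local_exponent L).
set B := bernoulli_mean _ _.
have -> : window_mean L v = B by [].
have Bq : B / density L = B * Num.sqrt (2 * pi * L) / (2 * half_width L).
  by rewrite -density_sqrt // invfM mulrACA divff ?gt_eqF // mulr1.
rewrite Bq; move=> /andP[b1 b2].
have w20 : 0 < 2 * half_width L by rewrite mulr_gt0.
rewrite ler_pdivlMr // ler_pdivrMr //.
have er : edge_ratio L * (2 * half_width L) = 2 * ((slack L)%:R + 1).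
  by rewrite /edge_ratio; field; rewrite gt_eqF.
have er1 : (1 - edge_ratio L) * (2 * half_width L) = 2 * half_width L - 2 * ((slack L)%:R + 1).
  by rewrite -er; ring.
have er2 : (1 + edge_ratio L) * (2 * half_width L) = 2 * half_width L + 2 * ((slack L)%:R + 1).
  by rewrite -er; ring.
apply/andP; split.
  apply: le_trans b1; rewrite mulrAC ler_wpM2r ?expR_ge0 //.
  by rewrite er1; lra.
apply: (le_trans b2); rewrite [leRHS]mulrAC ler_wpM2r ?expR_ge0 //.
by rewrite er2; lra.
Unshelve. all: by end_near. Qed.

Lemma cvg_edge_ratio : edge_ratio L @[L --> +oo] --> (0 : R).
Proof.
have d0 := delta_gt0; have c0 := c_gt0.
apply: (@squeeze_cvgr _ _ _ _ (fun=> 0) (fun L => 52 / c * (ln L * L `^ (- delta)))).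
- near=> L; have L5 : 5 <= L by near: L; apply: nbhs_pinfty_ge; rewrite num_real.
  have L0 : 0 < L by lra.
  have l1 := ln_ge1 L5; have sl := slack_le L5.
  have P0 : 0 < L `^ delta by exact: powR_gt0.
  have m0 : 0 <= (slack L)%:R :> R by [].
  rewrite /edge_ratio /half_width; apply/andP; split.
    by rewrite divr_ge0 ?mulr_ge0 ?(ltW c0) ?(ltW P0) //; lra.
  rewrite ler_pdivrMr ?mulr_gt0 // powRN.
  have -> : 52 / c * (ln L / L `^ delta) * (c * L `^ delta) = 52 * ln L.
    by field; rewrite !gt_eqF.
  lra.
- exact: cvg_cst.
- rewrite -[X in _ --> X](mulr0 (52 / c)); apply: cvgMr; exact: cvg_ln_powRN.
Unshelve. all: by end_near. Qed.

(** The main part is of order [L^(2 delta - 1)], which tends to 0 because [delta < 1/2]. *)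
Lemma cvg_local_exponent : local_exponent L @[L --> +oo] --> (0 : R).
Proof.
have d0 := delta_gt0; have d1 := delta_lt.
have a0 : 0 < 1 - 2 * delta by lra.
apply: (@squeeze_cvgr _ _ _ _ (fun=> 0)
  (fun L => 13 * (c + 1) ^+ 2 * L `^ (- (1 - 2 * delta)) + 4 * L `^ (- 1))).
- near=> L; have L5 : 5 <= L by near: L; apply: nbhs_pinfty_ge; rewrite num_real.
  have L0 : 0 < L by lra.
  rewrite /local_exponent; apply/andP; split.
    apply: addr_ge0; first by rewrite divr_ge0 ?(ltW L0) // mulr_ge0 // sqr_ge0.
    by rewrite mulr_ge0 ?(ltW L0) // mulr_ge0 // expR_ge0.
  have -> : L `^ (- (1 - 2 * delta)) = L `^ delta * L `^ delta / L.
    rewrite -[X in _ / X]powRr1 ?(ltW L0) // -powRN -!powRD ?(gt_eqF L0) ?implybT //.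
    by congr (_ `^ _); lra.
  apply: lerD.
    by rewrite le_eqVlt; apply/orP; left; apply/eqP; rewrite !exprMn [L `^ delta ^+ 2]expr2; ring.
  rewrite powR_inv1 ?(ltW L0) // -mulrA ler_pM2l // expRN.
  rewrite -(ler_pM2r L0) mulVf ?gt_eqF // -mulrA mulrC ler_pdivrMr ?expR_gt0 // mul1r.
  apply: le_trans (expR_ge1Dx _); rewrite ler_wpDl // [L ^+ 3]exprS expr2.
  by rewrite ler_peMl ?mulr_ge0 ?(ltW L0) //; lra.
- exact: cvg_cst.
- rewrite -[X in _ --> X](addr0 0); apply: cvgD.
    rewrite -[X in _ --> X](mulr0 (13 * (c + 1) ^+ 2)); apply: cvgMr; exact: cvg_powRN.
  rewrite -[X in _ --> X](mulr0 4); apply: cvgMr; exact: cvg_powRN.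
Unshelve. all: by end_near. Qed.

End WindowLimit.

Section PowerLimit.
Variable R : realType.

Lemma cvg_expR (f : R -> R) (l : R) : f L @[L --> +oo] --> l ->
  expR (f L) @[L --> +oo] --> expR l.
Proof. by move=> fl; apply: continuous_cvg => //; exact: continuous_expR. Qed.

(** Raise [exp(-b/(1-b)) <= 1 - b <= exp(-b)] to the power [h]; both ends have exponent tending to
    [-mu]. *)
Lemma cvg_pow1B (b : R -> R) (h : R -> nat) (mu : R) :
  (\forall L \near +oo, 0 <= b L) -> b L @[L --> +oo] --> (0 : R) ->
  b L * (h L)%:R @[L --> +oo] --> mu ->
  (1 - b L) ^+ h L @[L --> +oo] --> expR (- mu).
Proof.
move=> b0 bl bh.
apply: (@squeeze_cvgr _ _ _ _ (fun L => expR (- (b L * (h L)%:R * (1 - b L)^-1)))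
  (fun L => expR (- (b L * (h L)%:R)))).
- near=> L.
  have b0' : 0 <= b L by near: L.
  have b1 : b L < 1.
    by near: L; apply: (cvgr_lt 0 bl); rewrite ltr01.
  have d0 : 0 < 1 - b L by rewrite subr_gt0.
  have e x : expR (- (x * (h L)%:R)) = expR (- x) ^+ h L.
    by rewrite -mulNr -expRM_natr.
  rewrite mulrAC !e; apply/andP; split; last first.
    by rewrite lerXn2r ?nnegrE ?expR_ge0 ?(ltW d0) // expR_ge1Dx.
  rewrite lerXn2r ?nnegrE ?expR_ge0 ?(ltW d0) //.
  rewrite expRN -[leRHS]invrK lef_pV2 ?posrE ?expR_gt0 ?invr_gt0 //.
  apply: le_trans (expR_ge1Dx _); rewrite le_eqVlt; apply/orP; left; apply/eqP.
  by field; rewrite gt_eqF.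
- apply: cvg_expR; apply: cvgN; rewrite -[X in _ --> X]mulr1; apply: cvgM => //.
  rewrite -[X in _ --> X]invr1; apply: cvgV; first exact: oner_neq0.
  by rewrite -[X in _ --> X](subr0 1); apply: cvgB => //; exact: cvg_cst.
- by apply: cvg_expR; exact: cvgN.
Unshelve. all: by end_near. Qed.

End PowerLimit.

(** * Asymptotics of the number of normal integers followed by a gap *)

Section GapLimit.
Variables (R : realType) (delta theta mu : R).
Hypotheses (delta_gt0 : 0 < delta) (delta_lt : delta < 1 / 2)
  (theta_gt0 : 0 < theta) (mu_ge0 : 0 <= mu).

Local Notation q := (density delta).
Local Notation x L := (expR (expR L)).

(** The place where the normal integer of index [theta * x] is expected. In the definitions below,
    [mu = 0] empties the gap condition, so that the same limit also counts normal integers. *)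
Definition gap_range (L : R) : nat := Num.truncn (theta * x L / q L).
Definition gap_length (L : R) : nat := Num.truncn (mu / q L).
Definition gap_count (L : R) : nat :=
  normal_gaps L (half_width delta L) (gap_range L) (gap_length L).

Local Notation mean_lo L := (window_mean L (half_width delta L - (slack L)%:R)).
Local Notation mean_hi L := (window_mean L (half_width delta L + (slack L)%:R)).

Let q_bounds (L : R) : 1 <= L -> 0 < q L /\ q L <= 1 /\ L^-1 <= q L.
Proof.
move=> L1; have d0 := delta_gt0; have d1 := delta_lt.
have L0 : 0 < L by lra.
split; first exact: powR_gt0.
split; first by rewrite -[leRHS](powRr0 L) /density ler_powR //; lra.
by rewrite -powR_inv1 ?(ltW L0) // /density ler_powR //; lra.
Qed.

Lemma near_gap_params : \forall L \near +oo,
  [/\ (gap_length L).+1%:R <= L, expR (expR L / 2) <= (gap_range L)%:R,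
      (gap_length L <= gap_range L)%N,
      (gap_range L + gap_length L)%:R < x L ^+ 2 :> R &
      (gap_range L + gap_length L <= range_top L)%N].
Proof.
near=> L.
have d0 := delta_gt0; have d1 := delta_lt; have t0 := theta_gt0; have m0 := mu_ge0.
have L1000 : 1000 <= L by near: L; apply: nbhs_pinfty_ge; rewrite num_real.
have L6 : L ^+ 6 <= expR L by near: L; exact: near_expX_le_expR.
have Lmu : 2 * mu <= L `^ (1 / 2 + delta).
  near: L; have : 0 < 1 / 2 + delta by have := delta_gt0; lra.
  by move=> /cvgy_powR /cvgryPge; apply.
have Lt : 2 / theta <= L by near: L; apply: nbhs_pinfty_ge; rewrite num_real.
have Lt' : 2 * theta <= L by near: L; apply: nbhs_pinfty_ge; rewrite num_real.
have L1 : 1 <= L by lra.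
have L0 : 0 < L by lra.
have [q0 [q1 qL]] := q_bounds L1.
have X0 : 0 < expR (expR L / 2) by exact: expR_gt0.
have xX : x L = expR (expR L / 2) * expR (expR L / 2) by rewrite -expRD -splitr.
have LX : L + 1 <= expR (expR L / 2).
  apply: le_trans (expR_ge1Dx _); rewrite addrC lerD2l ler_pdivlMr //.
  apply: le_trans L6; rewrite exprS ler_pM2l //.
  by apply: (@le_trans _ _ L); [lra | rewrite exprS ler_peMr ?(ltW L0) // exprn_ege1].
have h1 : (gap_length L).+1%:R <= L.
  rewrite -natr1 /gap_length.
  have : (Num.truncn (mu / q L))%:R <= mu / q L by rewrite truncn_le divr_ge0 // ltW.
  suff : mu / q L <= L / 2 by lra.
  rewrite ler_pdivrMr //.
  have -> : L / 2 * q L = L `^ (1 / 2 + delta) / 2.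
    rewrite mulrAC -{1}[L]powRr1 ?(ltW L0) // /density -powRD ?(gt_eqF L0) ?implybT //.
    by congr (_ `^ _ / _); lra.
  lra.
have vq : theta * x L <= theta * x L / q L.
  by rewrite ler_pdivlMr // ler_piMr // mulr_ge0 ?expR_ge0 // ltW.
have vq0 : 0 <= theta * x L / q L.
  by rewrite divr_ge0 ?(ltW q0) // mulr_ge0 ?expR_ge0 // ltW.
have h2 : expR (expR L / 2) <= (gap_range L)%:R.
  have := truncnS_gt (theta * x L / q L); rewrite -natr1 -/(gap_range L).
  have : 2 * expR (expR L / 2) <= theta * x L.
    rewrite xX mulrA ler_pM2r // mulrC -ler_pdivrMr //; apply: le_trans Lt _; lra.
  lra.
have h3 : (gap_length L <= gap_range L)%N.
  rewrite -(ler_nat R); apply: le_trans h2; apply: le_trans LX.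
  by move: h1; rewrite -natr1; lra.
have h4 : (gap_range L + gap_length L)%:R < x L ^+ 2.
  have N2 : (gap_range L + gap_length L)%:R <= 2 * (gap_range L)%:R :> R.
    by rewrite -natrM ler_nat mul2n -addnn leq_add2l.
  apply: le_lt_trans N2 _.
  have NL : (gap_range L)%:R <= theta * x L * L.
    apply: (@le_trans _ _ (theta * x L / q L)); first by rewrite truncn_le.
    rewrite ler_wpM2l //; first by rewrite mulr_ge0 ?expR_ge0 // ltW.
    by rewrite -[leRHS]invrK lef_pV2 ?posrE ?invr_gt0.
  apply: (@le_lt_trans _ _ (2 * theta * L * x L)).
    by rewrite -!mulrA ler_pM2l // [L * _]mulrC mulrA.
  rewrite expr2 ltr_pM2r ?expR_gt0 //.
  have lt : L + 1 <= expR L.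
    by apply: le_trans (expR_ge1Dx _); rewrite addrC.
  have LL : 2 * theta * L <= L * L by rewrite ler_pM2r.
  apply: (le_lt_trans LL); rewrite xX; nra.
split => //.
rewrite /range_top truncn_ge_nat ?expR_ge0 // ltW //.
by rewrite (_ : expR (2 * expR L) = x L ^+ 2) // -expRM_natl.
Unshelve. all: by end_near. Qed.

Lemma near_gap_sandwich : \forall L \near +oo,
  mean_lo L * (1 - mean_hi L) ^+ gap_length L - 5 * L ^- 3
  <= (gap_count L)%:R / (gap_range L)%:R
  <= mean_hi L * (1 - mean_lo L) ^+ gap_length L + 5 * L ^- 3.
Proof.
near=> L.
have L1000 : 1000 <= L by near: L; apply: nbhs_pinfty_ge; rewrite num_real.
have L6 : L ^+ 6 <= expR L by near: L; exact: near_expX_le_expR.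
have [p1 p2 p3 p4 p5] : [/\ (gap_length L).+1%:R <= L, expR (expR L / 2) <= (gap_range L)%:R,
      (gap_length L <= gap_range L)%N,
      (gap_range L + gap_length L)%:R < x L ^+ 2 :> R &
      (gap_range L + gap_length L <= range_top L)%N] by near: L; exact: near_gap_params.
have L5 : 5 <= L by lra.
have YB := range_hi_le_top L5.
have Hs : all (leq (gap_length L).+1) (model_primes L).
  apply/allP => p; rewrite mem_filter => /andP[zp _].
  apply: leq_trans zp; rewrite -(ler_nat R).
  apply: le_trans p1 _; apply: ltW; apply: le_lt_trans (truncnS_gt _).
  apply: le_trans (expR_ge1Dx _); rewrite ler_wpDl //.
  by rewrite exprS ler_peMr ?exprn_ege1 //; lra.
have N_gt0 : (0 < gap_range L)%N.
  by rewrite -(ltr0n R); apply: lt_le_trans p2; exact: expR_gt0.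
pose tau : R := (size (model_primes L) * (gap_length L).+1).+1%:R^-1.
have tau01 : 0 < tau <= 1 by rewrite invr_gt0 ltr0n /= invf_le1 ?ltr0n // ler1n.
have := normal_gaps_bounds L (half_width delta L) (slack L)
  (range_primes_prime _ _) (range_primes_uniq _ _)
  (off_range_primes_prime _ _ _) (off_range_primes_uniq _ _ _)
  (@size_primes_range (range_lo L) _ _ YB) (trunc_order L) Hs N_gt0 p5 tau01.
have err := gap_error_le L1000 L6 p1 p2 p3.
move=> /andP[b1 b2]; apply/andP; split.
  by apply: le_trans b1; rewrite lerB.
by apply: (le_trans b2); rewrite lerD2l.
Unshelve. all: by end_near. Qed.

Lemma cvg_density : q L @[L --> +oo] --> (0 : R).
Proof.
have h : 0 < 1 / 2 - delta by have := delta_lt; lra.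
have := cvg_powRN h; apply: cvg_trans; apply: near_eq_cvg; near=> L.
by rewrite /density; congr (_ `^ _); lra.
Unshelve. all: by end_near. Qed.

Lemma cvg_window_mean (v : R -> R) :
  (forall L, half_width delta L - (slack L)%:R <= v L <= half_width delta L + (slack L)%:R) ->
  window_mean L (v L) / q L @[L --> +oo] --> (1 : R).
Proof.
move=> vw.
have r0 := cvg_edge_ratio delta_gt0; have e0 := cvg_local_exponent delta_gt0 delta_lt.
apply: (@squeeze_cvgr _ _ _ _ (fun L => (1 - edge_ratio delta L) * expR (- local_exponent delta L))
  (fun L => (1 + edge_ratio delta L) * expR (local_exponent delta L))).
- by have := near_window_mean delta_gt0 delta_lt; apply: filterS => L; apply.
- rewrite [X in _ --> X](_ : _ = (1 - 0) * expR (- 0)); last by rewrite subr0 oppr0 expR0 mulr1.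
  apply: cvgM; first by apply: cvgB => //; exact: cvg_cst.
  by apply: cvg_expR; exact: cvgN.
- rewrite [X in _ --> X](_ : _ = (1 + 0) * expR 0); last by rewrite addr0 expR0 mulr1.
  apply: cvgM; first by apply: cvgD => //; exact: cvg_cst.
  exact: cvg_expR.
Qed.

Lemma cvg_gap_length : q L * (gap_length L)%:R @[L --> +oo] --> mu.
Proof.
apply: (@squeeze_cvgr _ _ _ _ (fun L => mu - q L) (fun=> mu)).
- near=> L; have L1 : 1 <= L by near: L; apply: nbhs_pinfty_ge; rewrite num_real.
  have [q0 _] := q_bounds L1; have m0 := mu_ge0.
  have h0 : 0 <= mu / q L by rewrite divr_ge0 // ltW.
  have := truncnS_gt (mu / q L); rewrite -/(gap_length L) -natr1 => h1.
  have h2 : (gap_length L)%:R <= mu / q L by rewrite truncn_le.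
  have e : q L * (mu / q L) = mu by rewrite mulrCA divff ?gt_eqF // mulr1.
  apply/andP; split; last by rewrite -[leRHS]e ler_pM2l.
  have : q L * (mu / q L) <= q L * ((gap_length L)%:R + 1) by rewrite ler_pM2l // ltW.
  by rewrite e mulrDr mulr1; lra.
- by rewrite -[X in _ --> X](subr0 mu); apply: cvgB; [exact: cvg_cst | exact: cvg_density].
- exact: cvg_cst.
Unshelve. all: by end_near. Qed.

Lemma cvg_window_pow (v : R -> R) :
  (forall L, half_width delta L - (slack L)%:R <= v L <= half_width delta L + (slack L)%:R) ->
  (1 - window_mean L (v L)) ^+ gap_length L @[L --> +oo] --> expR (- mu).
Proof.
move=> vw; have bq := cvg_window_mean vw.
have near_q : \forall L \near +oo, 0 < q L.
  near=> L; have L1 : 1 <= L by near: L; apply: nbhs_pinfty_ge; rewrite num_real.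
  by have [] := q_bounds L1.
have bE : \forall L \near +oo, window_mean L (v L) = window_mean L (v L) / q L * q L.
  by move: near_q; apply: filterS => L q0; rewrite divfK // gt_eqF.
apply: cvg_pow1B.
- have : \forall L \near +oo, 0 < window_mean L (v L) / q L.
    exact: (@cvgr_gt _ _ _ _ _ 1 bq 0 (@ltr01 R)).
  apply: filterS2 near_q => L q0; rewrite pmulr_lgt0 ?invr_gt0 //; exact: ltW.
- rewrite [X in _ --> X](_ : _ = 1 * 0); last by rewrite mulr0.
  apply: (cvg_trans _ (cvgM bq cvg_density)); apply: near_eq_cvg.
  by move: bE; apply: filterS => L e; rewrite /= -e.
- rewrite -[X in _ --> X]mul1r.
  apply: (cvg_trans _ (cvgM bq cvg_gap_length)); apply: near_eq_cvg.
  by move: bE; apply: filterS => L e; rewrite /= mulrA -e.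
Unshelve. all: by end_near. Qed.

Lemma cvg_gap_range : (gap_range L)%:R * q L / x L @[L --> +oo] --> theta.
Proof.
apply: (@squeeze_cvgr _ _ _ _ (fun L => theta - L `^ (- 1)) (fun=> theta)).
- near=> L; have L1 : 1 <= L by near: L; apply: nbhs_pinfty_ge; rewrite num_real.
  have [q0 [q1 _]] := q_bounds L1; have t0 := theta_gt0.
  have x0 : 0 < x L by exact: expR_gt0.
  have L0 : 0 < L by lra.
  have xL : L <= x L.
    apply: le_trans (expR_ge1Dx _); have := expR_ge1Dx L; lra.
  have h0 : 0 <= theta * x L / q L by rewrite divr_ge0 ?mulr_ge0 ?(ltW x0) // ltW.
  have := truncnS_gt (theta * x L / q L); rewrite -/(gap_range L) -natr1 => h1.
  have h2 : (gap_range L)%:R <= theta * x L / q L by rewrite truncn_le.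
  have e : theta * x L / q L * q L = theta * x L by rewrite divfK // gt_eqF.
  apply/andP; split; last by rewrite ler_pdivrMr // -e ler_pM2r.
  rewrite ler_pdivlMr // mulrBl.
  have l1 : 1 <= L `^ (- 1) * x L.
    by rewrite powR_inv1 ?(ltW L0) // mulrC ler_pdivlMr // mul1r.
  have : theta * x L / q L * q L <= ((gap_range L)%:R + 1) * q L by rewrite ler_pM2r // ltW.
  by rewrite e mulrDl mul1r; lra.
- by rewrite -[X in _ --> X](subr0 theta); apply: cvgB; [exact: cvg_cst | exact: cvg_powRN].
- exact: cvg_cst.
Unshelve. all: by end_near. Qed.

Lemma cvg_gap_count : (gap_count L)%:R / x L @[L --> +oo] --> theta * expR (- mu).
Proof.
have vlo L : half_width delta L - (slack L)%:R <= half_width delta L - (slack L)%:R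
    <= half_width delta L + (slack L)%:R.
  by have : 0 <= (slack L)%:R :> R by []; lra.
have vhi L : half_width delta L - (slack L)%:R <= half_width delta L + (slack L)%:R
    <= half_width delta L + (slack L)%:R.
  by have : 0 <= (slack L)%:R :> R by []; lra.
(* The exponent is that of [L^-3 / q]: the absolute error remains negligible after division by the
   density. *)
have err0 : 5 * L `^ (- (5 / 2 + delta)) @[L --> +oo] --> (0 : R).
  rewrite -[X in _ --> X](mulr0 5); apply: cvgMr; apply: cvg_powRN.
  by have := delta_gt0; lra.
have aux1 (a b d e : R) : a / d * b - 5 * (e / d) = (a * b - 5 * e) * d^-1 by ring.
have aux2 (a b d e : R) : a / d * b + 5 * (e / d) = (a * b + 5 * e) * d^-1 by ring.
have main : (gap_count L)%:R / ((gap_range L)%:R * q L) @[L --> +oo] --> expR (- mu).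
  apply: (@squeeze_cvgr _ _ _ _
    (fun L => mean_lo L / q L * (1 - mean_hi L) ^+ gap_length L - 5 * L `^ (- (5 / 2 + delta)))
    (fun L => mean_hi L / q L * (1 - mean_lo L) ^+ gap_length L + 5 * L `^ (- (5 / 2 + delta)))).
  - near=> L; have L1 : 1 <= L by near: L; apply: nbhs_pinfty_ge; rewrite num_real.
    have [q0 _] := q_bounds L1; have L0 : 0 < L by lra.
    have e : L `^ (- (5 / 2 + delta)) = L ^- 3 / q L.
      rewrite -powR_mulrn ?(ltW L0) // /density -!powRN -powRD ?(gt_eqF L0) ?implybT //.
      by congr (_ `^ _); lra.
    have : mean_lo L * (1 - mean_hi L) ^+ gap_length L - 5 * L ^- 3
      <= (gap_count L)%:R / (gap_range L)%:R
      <= mean_hi L * (1 - mean_lo L) ^+ gap_length L + 5 * L ^- 3.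
      by near: L; exact: near_gap_sandwich.
    have iq : 0 < (q L)^-1 by rewrite invr_gt0.
    have gE : (gap_count L)%:R / ((gap_range L)%:R * q L) = (gap_count L)%:R / (gap_range L)%:R * (q L)^-1.
      by rewrite invfM mulrA.
    rewrite gE e => /andP[b1 b2]; apply/andP; split.
      by apply: le_trans (ler_wpM2r (ltW iq) b1); rewrite aux1.
    by apply: (le_trans (ler_wpM2r (ltW iq) b2)); rewrite aux2.
  - have -> : expR (- mu) = 1 * expR (- mu) - 0 by rewrite mul1r subr0.
    apply: cvgB => //; apply: cvgM; [exact: cvg_window_mean | exact: cvg_window_pow].
  - have -> : expR (- mu) = 1 * expR (- mu) + 0 by rewrite mul1r addr0.
    apply: cvgD => //; apply: cvgM; [exact: cvg_window_mean | exact: cvg_window_pow].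
apply: (cvg_trans _ (cvgM cvg_gap_range main)); apply: near_eq_cvg; near=> L.
have L1 : 1 <= L by near: L; apply: nbhs_pinfty_ge; rewrite num_real.
have [q0 _] := q_bounds L1.
have N0 : 0 < (gap_range L)%:R :> R.
  apply: lt_le_trans (expR_gt0 (expR L / 2)) _.
  suff : [/\ (gap_length L).+1%:R <= L, expR (expR L / 2) <= (gap_range L)%:R,
      (gap_length L <= gap_range L)%N,
      (gap_range L + gap_length L)%:R < x L ^+ 2 :> R &
      (gap_range L + gap_length L <= range_top L)%N] by case.
  by near: L; exact: near_gap_params.
rewrite /=; have := expR_gt0 (expR L); move: (x L) => X X0.
by field; rewrite !gt_eqF.
Unshelve. all: by end_near. Qed.

End GapLimit.

(** * From integers to indices of normal integers *)

Section Counting.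
Variables (R : realType) (delta : R).
Hypotheses (delta_gt0 : 0 < delta) (delta_lt : delta < 1 / 2).

Lemma normals_gt0 (x : R) : all (leq 1) (normals delta x).
Proof. by apply/allP => n; rewrite mem_normals => /and3P[]. Qed.

Lemma mem_normals_window (x : R) (n : nat) : (0 < n)%N -> n%:R < x ^+ 2 ->
  (n \in normals delta x) = in_window (loglog x) (half_width delta (loglog x)) (size (primes n)).
Proof. by move=> n0 nx; rewrite mem_normals /delta_normal n0 nx. Qed.

(** All integers inspected are at most [N + H], so the cutoff at [x ^+ 2] is invisible. *)
Lemma normal_gaps_isolated (x : R) (N H : nat) : (N + H)%:R < x ^+ 2 ->
  normal_gaps (loglog x) (half_width delta (loglog x)) N H =
  (\sum_(n < N) ((n.+1 \in normals delta x) && gap_after (normals delta x) H n.+1))%N.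
Proof.
move=> NH; rewrite /normal_gaps; apply: eq_bigr => n _.
have bnd (m : nat) : (m <= N + H)%N -> m%:R < x ^+ 2.
  by move=> mNH; apply: le_lt_trans NH; rewrite ler_nat.
have nN := ltn_ord n.
rewrite mem_normals_window //; last by apply: bnd; lia.
congr (nat_of_bool (_ && _)); apply: eq_in_all => h; rewrite mem_iota => /andP[_ hH].
by rewrite mem_normals_window //; apply: bnd; lia.
Qed.

Lemma normal_gaps0 (x : R) (N : nat) : N%:R < x ^+ 2 ->
  normal_gaps (loglog x) (half_width delta (loglog x)) N 0 =
  (\sum_(n < N) (n.+1 \in normals delta x))%N.
Proof.
move=> Nx; rewrite normal_gaps_isolated ?addn0 //.
by apply: eq_bigr => n _; rewrite /gap_after /= andbT.
Qed.

(** Gaps are integers, so exceeding [lambda / q] is the same as exceeding its floor. *)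
Lemma num_large_gapsE (lambda x : R) : 0 <= lambda -> 0 < density delta (loglog x) ->
  num_large_gaps delta lambda x =
  large_gaps (normals delta x) (gap_length delta lambda (loglog x)) (Num.truncn x).
Proof.
move=> l0 q0; apply: eq_in_count => i; rewrite mem_iota => /andP[i_gt0 _].
congr (_ && _); rewrite /normal_scaled /normal_nth /= -/(density delta (loglog x)).
set a := nth _ _ i.-1; set b := nth _ _ i; rewrite -mulrBl -ltr_pdivrMr //.
have v0 : 0 <= lambda / density delta (loglog x) by rewrite divr_ge0 // ltW.
rewrite /gap_length; set v := lambda / _ in v0 *.
have h1 : (Num.truncn v)%:R <= v by rewrite truncn_le.
have h2 := truncnS_gt v.
apply/idP/idP => h.
  by rewrite -(ltr_nat R) natrD; lra.
have : ((a + Num.truncn v).+1)%:R <= b%:R :> R by rewrite ler_nat.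
rewrite -natr1 natrD; rewrite -natr1 in h2; lra.
Qed.

Lemma cvgy_loglog : loglog x @[x --> +oo] --> (+oo : set_system R).
Proof. exact: (cvg_comp _ _ (@cvgy_ln R) (@cvgy_ln R)). Qed.

Lemma near_loglog (P : R -> Prop) :
  (\forall L \near +oo, P L) -> \forall x \near +oo, P (loglog x).
Proof. exact: cvgy_loglog. Qed.

Lemma near_loglogK : \forall x \near +oo, expR (expR (loglog x)) = x :> R.
Proof.
near=> x.
have x1 : expR 1 < x by near: x; apply: nbhs_pinfty_gt; rewrite num_real.
have x0 : 0 < x by apply: lt_trans x1; exact: expR_gt0.
have l0 : 0 < ln x by apply: lt_trans (_ : 0 < 1) _ => //; rewrite -[1]expRK ltr_ln ?posrE ?expR_gt0.
by rewrite /loglog !lnK ?posrE.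
Unshelve. all: by end_near. Qed.

Local Notation gaps theta mu x := (gap_count delta theta mu (loglog x)).

Lemma cvg_gap_count_loglog (theta mu : R) : 0 < theta -> 0 <= mu ->
  (gaps theta mu x)%:R / x @[x --> +oo] --> theta * expR (- mu).
Proof.
move=> t0 m0.
have := cvg_gap_count delta_gt0 delta_lt t0 m0.
move=> /(cvg_comp _ _ cvgy_loglog); apply: cvg_trans; apply: near_eq_cvg.
by have := near_loglogK; apply: filterS => x e; rewrite /= e.
Qed.

Lemma near_gaps_isolated (theta mu : R) : 0 < theta -> 0 <= mu ->
  \forall x \near +oo, let N := gap_range delta theta (loglog x) in
  gaps theta mu x = (\sum_(n < N) ((n.+1 \in normals delta x)
      && gap_after (normals delta x) (gap_length delta mu (loglog x)) n.+1))%N /\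
  gaps theta 0 x = (\sum_(n < N) (n.+1 \in normals delta x))%N.
Proof.
move=> t0 m0; have h := near_loglog (near_gap_params delta_gt0 delta_lt t0 m0).
have hK := near_loglogK; near=> x.
have e : expR (expR (loglog x)) = x by near: x.
have : [/\ (gap_length delta mu (loglog x)).+1%:R <= loglog x,
    expR (expR (loglog x) / 2) <= (gap_range delta theta (loglog x))%:R,
    (gap_length delta mu (loglog x) <= gap_range delta theta (loglog x))%N,
    (gap_range delta theta (loglog x) + gap_length delta mu (loglog x))%:R
       < expR (expR (loglog x)) ^+ 2 :> R &
    (gap_range delta theta (loglog x) + gap_length delta mu (loglog x) <= range_top (loglog x))%N].
  by near: x.
case=> _ _ _; rewrite e => NH _; split; first exact: normal_gaps_isolated.
have gl0 : gap_length delta 0 (loglog x) = 0%N by rewrite /gap_length mul0r truncn0.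
rewrite /gap_count gl0 normal_gaps0 //; apply: le_lt_trans NH.
by rewrite ler_nat leq_addr.
Unshelve. all: by end_near. Qed.

(** The case [mu = 0] locates index [x]: fewer than [x] normal integers lie in the range for
    [1 - eps] and more than [x] in that for [1 + eps]. The second fact also shows that the list
    continues beyond the first range, as [large_gaps_ge] requires. *)
Lemma near_num_large_gaps (lambda eps : R) : 0 <= lambda -> 0 < eps -> eps < 1 ->
  \forall x \near +oo,
    (gaps (1 - eps) lambda x <= num_large_gaps delta lambda x
      <= gaps (1 + eps) lambda x)%N.
Proof.
move=> l0 e0 e1.
have tm : 0 < 1 - eps by lra.
have tp : 0 < 1 + eps by lra.
have clo := cvg_gap_count_loglog tm (lexx 0).
have chi := cvg_gap_count_loglog tp (lexx 0).
rewrite oppr0 expR0 mulr1 in clo chi.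
have nlo : \forall x \near +oo, (gaps (1 - eps) 0 x)%:R / x < 1.
  by apply: (@cvgr_lt _ _ _ _ _ _ clo); lra.
have nhi : \forall x \near +oo, 1 < (gaps (1 + eps) 0 x)%:R / x.
  by apply: (@cvgr_gt _ _ _ _ _ _ chi); lra.
have ilo := near_gaps_isolated tm l0; have ihi := near_gaps_isolated tp l0.
have ll0 : \forall x \near +oo, 0 < loglog (x : R).
  by apply: (near_loglog (P := fun L => 0 < L)); apply: nbhs_pinfty_gt; rewrite num_real.
near=> x.
have x0 : 0 < x by near: x; apply: nbhs_pinfty_gt; rewrite num_real.
have q0 : 0 < density delta (loglog x) by apply: powR_gt0; near: x.
have [glo glo0] : let N := gap_range delta (1 - eps) (loglog x) in
  gaps (1 - eps) lambda x = (\sum_(n < N) ((n.+1 \in normals delta x)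
      && gap_after (normals delta x) (gap_length delta lambda (loglog x)) n.+1))%N /\
  gaps (1 - eps) 0 x = (\sum_(n < N) (n.+1 \in normals delta x))%N by near: x.
have [ghi ghi0] : let N := gap_range delta (1 + eps) (loglog x) in
  gaps (1 + eps) lambda x = (\sum_(n < N) ((n.+1 \in normals delta x)
      && gap_after (normals delta x) (gap_length delta lambda (loglog x)) n.+1))%N /\
  gaps (1 + eps) 0 x = (\sum_(n < N) (n.+1 \in normals delta x))%N by near: x.
have : (gaps (1 - eps) 0 x)%:R / x < 1 by near: x.
have : 1 < (gaps (1 + eps) 0 x)%:R / x by near: x.
rewrite ltr_pdivlMr // ltr_pdivrMr // !mul1r => hi_x lo_x.
have sorted := normals_sorted delta x; have pos := normals_gt0 x.
rewrite (num_large_gapsE l0 q0) glo ghi; apply/andP; split.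
  apply: large_gaps_ge => //; rewrite -glo0.
    by rewrite truncn_ge_nat ?ltW // ltW.
  have lohi : (gaps (1 - eps) 0 x < gaps (1 + eps) 0 x)%N.
    by rewrite -(ltr_nat R); apply: lt_trans hi_x.
  apply: leq_trans lohi _; rewrite ghi0 sum_mem_count //.
  exact: count_size.
apply: large_gaps_le => //; rewrite -ghi0 -(ler_nat R); apply: le_trans (ltW hi_x).
by rewrite truncn_le ltW.
Unshelve. all: by end_near. Qed.

End Counting.

Theorem theorem2 (R : realType) (delta lambda : R)
    (delta_gt0 : 0 < delta) (delta_lt_half : delta < 1 / 2)
    (lambda_gt0 : 0 < lambda) :
  (1 / x) * (num_large_gaps delta lambda x)%:R @[x --> +oo] --> expR (- lambda).
Proof.
apply/cvgrPdist_le => e e0.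
(* Half of [e] pays for replacing [1 -+ eps] by 1 in the limit, the other half for convergence; the
   bound [1/2] keeps [1 - eps] positive. *)
pose eps : R := Num.min (1 / 2) (e / 2).
have eps0 : 0 < eps by rewrite lt_min; apply/andP; split; lra.
have eps1 : eps < 1 by rewrite /eps gt_min; apply/orP; left; lra.
have epse : eps <= e / 2 by rewrite /eps ge_min lexx orbT.
have tm : 0 < 1 - eps by lra.
have tp : 0 < 1 + eps by lra.
have lo := cvg_gap_count_loglog delta_gt0 delta_lt_half tm (ltW lambda_gt0).
have hi := cvg_gap_count_loglog delta_gt0 delta_lt_half tp (ltW lambda_gt0).
have e20 : 0 < e / 2 by lra.
move/cvgrPdist_le: lo => /(_ _ e20) nlo; move/cvgrPdist_le: hi => /(_ _ e20) nhi.
have nb := near_num_large_gaps delta_gt0 delta_lt_half (ltW lambda_gt0) eps0 eps1.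
near=> x.
have x0 : 0 < x by near: x; apply: nbhs_pinfty_gt; rewrite num_real.
have : `|(1 - eps) * expR (- lambda)
    - (gap_count delta (1 - eps) lambda (loglog x))%:R / x| <= e / 2 by near: x.
have : `|(1 + eps) * expR (- lambda)
    - (gap_count delta (1 + eps) lambda (loglog x))%:R / x| <= e / 2 by near: x.
have /andP[b1 b2] : (gap_count delta (1 - eps) lambda (loglog x) <= num_large_gaps delta lambda x
      <= gap_count delta (1 + eps) lambda (loglog x))%N by near: x.
have {}b1 : (gap_count delta (1 - eps) lambda (loglog x))%:R / x <= 1 / x * (num_large_gaps delta lambda x)%:R.
  by rewrite div1r mulrC ler_pM2l ?invr_gt0 // ler_nat.
have {}b2 : 1 / x * (num_large_gaps delta lambda x)%:R <= (gap_count delta (1 + eps) lambda (loglog x))%:R / x.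
  by rewrite div1r mulrC ler_pM2r ?invr_gt0 // ler_nat.
have l1 : expR (- lambda) <= 1 by rewrite expR_le1; lra.
have l0 := expR_ge0 (- lambda).
have le : eps * expR (- lambda) <= e / 2 by apply: le_trans epse; rewrite ler_piMr // ltW.
rewrite !ler_norml => /andP[h1 h2] /andP[h3 h4]; apply/andP; split; lra.
Unshelve. all: by end_near. Qed.
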